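(* For $m\in\mathbb N^*$ let $\Psi_m(w)=\max\{m\log|w_1|,\log|w_2|\}$ on $\mathbb D^2$. Let $a_1,\dots,a_N\in\mathbb D$ be distinct, $m_1,\dots,m_N\in\mathbb N^*$, and $S=\{((a_1,0),\Psi_{m_1}),\dots,((a_N,0),\Psi_{m_N})\}$. Then for every $z\in\mathbb D^2$, $$L_S(z)=G_S(z)=\max\Big\{\sum_{j=1}^N m_j\log|\phi_{a_j}(z_1)|,\ \log|z_2|\Big\}.$$ Moreover, if for each $k$ the points $a^{(k)}_{j,i}\in\mathbb D$ ($1\le j\le N$, $1\le i\le m_j$) are distinct and $\lim_{k\to\infty}a^{(k)}_{j,i}=a_j$ for all $1\le i\le m_j$, and $S^{(k)}$ is the pole system consisting of all points $(a^{(k)}_{j,i},0)$ with weight $1$, then $\lim_{k\to\infty}L_{S^{(k)}}(z)=L_S(z)$ and $\lim_{k\to\infty}G_{S^{(k)}}(z)=G_S(z)$ for every $z\in\mathbb D^2$.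
   Context: $\mathbb D$ is the open unit disc; $\phi_\xi(\zeta)=\frac{\xi-\zeta}{1-\bar\xi\zeta}$. $\Psi_m$ has Monge–Ampère mass $m$. For a system $T=\{(p_j,\Phi_j)\}$ of distinct points $p_j\in\mathbb D^2$ and indicators $\Phi_j$ with masses $\tau_j$ (for weight 1, $\Phi_j(w)=\max(\log|w_1|,\log|w_2|)$, $\tau_j=1$): $G_T(z)=\sup\{u(z):u$ negative plurisubharmonic on $\mathbb D^2$, $u(x)\le\Phi_j(x-p_j)+C_j$ near $p_j\}$, and $L_T(z)=\inf\{\sum_j\tau_j\log|\zeta_j|\}$ over holomorphic $\varphi:\mathbb D\to\mathbb D^2$ with $\varphi(0)=z$ and $\zeta_j\in\mathbb D$ such that $\Phi_j(\varphi(\zeta)-p_j)\le\tau_j\log|\zeta-\zeta_j|+C_j$ for $\zeta$ near $\zeta_j$. For weight-1 poles this is the usual Green function with logarithmic poles $\log\|x-p_j\|$ and Coman's Lempert function $\inf\{\sum_j\log|\zeta_j|:\varphi(0)=z,\varphi(\zeta_j)=p_j\}$. *)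

(* Defs.v *)
From HB Require Import structures.
From mathcomp Require Import all_boot all_order all_algebra.
From mathcomp Require Import all_classical all_reals all_analysis.
From mathcomp.real_closed Require Import complex.
Set Implicit Arguments. Unset Strict Implicit. Unset Printing Implicit Defensive.
Import Order.TTheory GRing.Theory Num.Theory.
Import numFieldNormedType.Exports.
Local Open Scope classical_set_scope.
Local Open Scope ring_scope.

Section PluriGreen.
Variable R : realType.

(* the complex plane, with its normed (topological) structure *)
Local Notation C := ((R[i])^o).

Definition cabs (x : R[i]) : R :=
  Num.sqrt (complex.Re x ^+ 2 + complex.Im x ^+ 2).

Definition logabs (x : R[i]) : \bar R :=
  if x == 0 then -oo%E else (ln (cabs x))%:E.

Definition unit_disc : set R[i] := [set z | cabs z < 1].
Definition bidisc : set (R[i] * R[i]) :=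
  [set z | unit_disc z.1 /\ unit_disc z.2].

Definition mobius (xi zeta : R[i]) : R[i] := (xi - zeta) / (1 - xi^* * zeta).

(* Psi_m(w) = max (m log|w_1|, log|w_2|); its Monge-Ampere mass is m *)
Definition Psi (m : nat) (w : R[i] * R[i]) : \bar R :=
  Order.max ((m%:R)%:E * logabs w.1)%E (logabs w.2).

Definition expi (t : R) : R[i] := Complex (cos t) (sin t).

Definition usc_on (D : set (R[i] * R[i])) (u : R[i] * R[i] -> \bar R) : Prop :=
  forall x, D x -> forall t : R, (u x < t%:E)%E ->
    \forall y \near (x : C * C), (u y < t%:E)%E.

Definition psh_on (D : set (R[i] * R[i])) (u : R[i] * R[i] -> \bar R) : Prop :=
  [/\ forall x, D x -> (u x < +oo)%E,
      usc_on D u &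
      forall a b : R[i] * R[i],
        (forall zeta, cabs zeta <= 1 -> D (a.1 + zeta * b.1, a.2 + zeta * b.2)) ->
        (u a <= ((pi *+ 2)^-1)%:E *
           \int[@lebesgue_measure R]_(t in `[0%R, (pi *+ 2)%R])
              u ((a.1 + expi t * b.1)%R, (a.2 + expi t * b.2)%R))%E].

Definition pole_cond (p : R[i] * R[i]) (m : nat) (u : R[i] * R[i] -> \bar R) : Prop :=
  exists c : R, \forall x \near (p : C * C),
    (u x <= Psi m ((x.1 - p.1)%R, (x.2 - p.2)%R) + c%:E)%E.

Definition green (I : finType) (p : I -> R[i] * R[i]) (mu : I -> nat)
    (z : R[i] * R[i]) : \bar R :=
  ereal_sup [set u z | u in
    [set u : R[i] * R[i] -> \bar R |
       [/\ psh_on bidisc u,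
           (forall x, bidisc x -> (u x < 0)%E) &
           forall j, pole_cond (p j) (mu j) u]]].

(* holomorphic on an (open) subset of C: complex differentiable at each point *)
Definition holo_on (D : set R[i]) (f : R[i] -> R[i]) : Prop :=
  forall z, D z -> derivable (f : C -> C) (z : C) (1 : C).

Definition lempert (I : finType) (p : I -> R[i] * R[i]) (mu : I -> nat)
    (z : R[i] * R[i]) : \bar R :=
  ereal_inf [set (\sum_(j : I) ((mu j)%:R)%:E * logabs (zeta j))%E | zeta in
    [set zeta : I -> R[i] |
       (forall j, unit_disc (zeta j)) /\
       exists phi1 phi2 : R[i] -> R[i],
         [/\ holo_on unit_disc phi1, holo_on unit_disc phi2,
             (forall t, unit_disc t -> bidisc (phi1 t, phi2 t)),
             (phi1 0, phi2 0) = z &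
             forall j, exists c : R, \forall t \near (zeta j : C),
               (Psi (mu j) ((phi1 t - (p j).1)%R, (phi2 t - (p j).2)%R)
                  <= ((mu j)%:R)%:E * logabs (t - zeta j)%R + c%:E)%E]]].

End PluriGreen.

(* Main.v *)
Require Import Defs.
From HB Require Import structures.
From mathcomp Require Import all_boot all_order all_algebra.
From mathcomp Require Import all_classical all_reals all_analysis measurable_realfun.
From mathcomp.real_closed Require Import complex.
From mathcomp Require Import ring lra.
Set Implicit Arguments. Unset Strict Implicit. Unset Printing Implicit Defensive.
Import Order.TTheory GRing.Theory Num.Theory.
Import numFieldNormedType.Exports.
Local Open Scope classical_set_scope.
Local Open Scope ring_scope.

(** Let B be the finite Blaschke product with a zero of order m_j at each a_j. The asserted value,
    [max_formula], is max(log|B(z_1)|, log|z_2|). The identities L = G = [max_formula] follow from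
    four inequalities, assembled in [green_lempert_formula] for an arbitrary finite index type.

    Green function from below ([max_formula_le_green]): log|B(z_1)| and log|z_2|, each lowered by a
    small constant, have a maximum that is a negative plurisubharmonic competitor with the right
    poles. Its sub-mean value property over affine discs reduces, factor by factor, to Jensen's
    formula for linear functions, with Fatou's lemma for circles through a zero.

    Green function from above ([psh_neg_le]): let u be a competitor. For |z_2| < |B(z_1)|, z lies on
    the graph w = c B(zeta) with |c| < 1. Along this graph u has at each pole at most the
    singularity of log|B|, so the maximum principle gives u <= log|B| there ([graph_le]). For |z_2|
    >= |B(z_1)|, u is compared with log|w| on the vertical annulus |B(z_1)| <= |w| < 1 ([slice_le]),
    and over a pole on the punctured vertical disc. Plurisubharmonicity is only stated on affine
    discs, so u is not restricted to the curved graph. Instead the maximum principle is run on the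
    two-dimensional region |w| <= |B| with a penalty K|g|^2, where g vanishes on the graph. On small
    discs tangent to a level set of g the mean of |g|^2 exceeds its centre value by O(r^4) only, and
    a perturbation -eps|zeta|^2, whose mean drops by eps r^2, absorbs this. [disc_comparison] is the
    common form of all these arguments.

    Lempert function from below ([max_formula_le]): for an admissible disc phi, both phi_2 and B o
    phi_1 are bounded by 1 and vanish to order m_j at zeta_j, so the Schwarz lemma with several
    zeros ([schwarz_zeros]) bounds their values at 0 by the product of the |zeta_j|^m_j.

    Lempert function from above ([lempert_le]): discs of the form (phi_{z_1} o psi, c times the
    Blaschke product of the zeta_j) are admissible when psi(0) = 0 and psi(zeta_j) = phi_{z_1}(a_j).
    If |z_2| <= |B(z_1)|, psi = id works. Otherwise psi_s(zeta) = zeta (zeta + s)/(1 + s zeta) is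
    used, where s and the choice of roots are tuned by the intermediate value theorem so that the
    product of the |zeta_j|^m_j is exactly |z_2|.

    The convergence statements follow because the formula applies to the split systems too and is
    continuous in the positions of the poles. *)

(** * The modulus, the topology and the unit circle of the complex plane *)

Section ComplexModulus.
Variable R : realType.
Local Notation C := ((R[i])^o).
Implicit Types x y z : R[i].

Lemma cabsE x : (cabs x)%:C%C = `|x|.
Proof. by rewrite normc_def. Qed.

Lemma cabs_ge0 x : 0 <= cabs x.
Proof. exact: sqrtr_ge0. Qed.

Lemma cabs_inj (a b : R) : a%:C%C = b%:C%C -> a = b.
Proof. by case. Qed.

Lemma cabs0 : cabs (0 : R[i]) = 0.
Proof. by apply: cabs_inj; rewrite cabsE normr0. Qed.

Lemma cabs1 : cabs (1 : R[i]) = 1.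
Proof. by apply: cabs_inj; rewrite cabsE normr1. Qed.

Lemma cabsM x y : cabs (x * y) = cabs x * cabs y.
Proof. by apply: cabs_inj; rewrite rmorphM /= !cabsE normrM. Qed.

Lemma cabsV x : cabs x^-1 = (cabs x)^-1.
Proof. by apply: cabs_inj; rewrite fmorphV /= !cabsE normfV. Qed.

Lemma cabsX x n : cabs (x ^+ n) = cabs x ^+ n.
Proof. by apply: cabs_inj; rewrite rmorphXn /= !cabsE normrX. Qed.

Lemma cabsN x : cabs (- x) = cabs x.
Proof. by apply: cabs_inj; rewrite !cabsE normrN. Qed.

Lemma cabsB x y : cabs (x - y) = cabs (y - x).
Proof. by rewrite -cabsN opprB. Qed.

Lemma cabsD x y : cabs (x + y) <= cabs x + cabs y.
Proof. by rewrite -lecR rmorphD /= !cabsE ler_normD. Qed.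

Lemma cabs_eq0 x : (cabs x == 0) = (x == 0).
Proof. by rewrite -(inj_eq (@complexI R)) /= cabsE normr_eq0. Qed.

Lemma cabs_gt0 x : (0 < cabs x) = (x != 0).
Proof. by rewrite lt0r cabs_ge0 andbT cabs_eq0. Qed.

Lemma cabs_prod (I : finType) (P : pred I) (F : I -> R[i]) :
  cabs (\prod_(j | P j) F j) = \prod_(j | P j) cabs (F j).
Proof. by apply: (big_morph _ cabsM cabs1). Qed.

Lemma sqr_cabs x : cabs x ^+ 2 = complex.Re x ^+ 2 + complex.Im x ^+ 2.
Proof. by rewrite sqr_sqrtr // addr_ge0 // sqr_ge0. Qed.

Lemma conjE x : x^* = conjc x.
Proof. by []. Qed.

Lemma cabs_conj x : cabs (x^*) = cabs x.
Proof. by case: x => a b; rewrite /cabs /= sqrrN. Qed.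

Lemma mul_conj x : x * x^* = (cabs x ^+ 2)%:C%C.
Proof. by rewrite rmorphXn /= cabsE normCK. Qed.

Lemma cabs_real (a : R) : cabs a%:C%C = `|a|.
Proof. by rewrite /cabs /= expr0n addr0 sqrtr_sqr. Qed.

Lemma Re_le_cabs x : `|complex.Re x| <= cabs x.
Proof. by rewrite -lecR cabsE normc_ge_Re. Qed.

Lemma Im_le_cabs x : `|complex.Im x| <= cabs x.
Proof.
rewrite -(@ler_pXn2r _ 2) ?nnegrE ?cabs_ge0 // sqr_cabs -normrX ger0_norm ?sqr_ge0 //.
by rewrite lerDr sqr_ge0.
Qed.

Lemma cabs_le_ReIm x : cabs x <= `|complex.Re x| + `|complex.Im x|.
Proof.
rewrite -(@ler_pXn2r _ 2) ?nnegrE ?cabs_ge0 ?addr_ge0 // sqr_cabs.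
rewrite -(real_normK (num_real (complex.Re x))) -(real_normK (num_real (complex.Im x))).
by rewrite sqrrD lerD2r lerDl mulrn_wge0 // mulr_ge0.
Qed.

Lemma Re_add x y : complex.Re (x + y) = complex.Re x + complex.Re y.
Proof. by case: x; case: y. Qed.
Lemma Im_add x y : complex.Im (x + y) = complex.Im x + complex.Im y.
Proof. by case: x; case: y. Qed.
Lemma Re_opp x : complex.Re (- x) = - complex.Re x.
Proof. by case: x. Qed.
Lemma Im_opp x : complex.Im (- x) = - complex.Im x.
Proof. by case: x. Qed.
Lemma Re_mul x y : complex.Re (x * y) =
  complex.Re x * complex.Re y - complex.Im x * complex.Im y.
Proof. by case: x; case: y. Qed.
Lemma Im_mul x y : complex.Im (x * y) =
  complex.Re x * complex.Im y + complex.Im x * complex.Re y.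
Proof. by case: x; case: y. Qed.

Lemma cabs_lerB x y : `|cabs x - cabs y| <= cabs (x - y).
Proof.
rewrite ler_norml; apply/andP; split.
  by rewrite lerNl opprB lerBlDr cabsB (le_trans _ (cabsD _ _)) // subrK.
by rewrite lerBlDr (le_trans _ (cabsD _ _)) // subrK.
Qed.

Lemma cabs_expi (t : R) : cabs (expi t) = 1.
Proof. by rewrite /cabs /= cos2Dsin2 sqrtr1. Qed.

Lemma expiD (s t : R) : expi (s + t) = expi s * expi t.
Proof.
rewrite /expi cosD sinD; apply/eqP; rewrite eq_complex /= eqxx /=.
by rewrite addrC.
Qed.

Lemma expi0 : expi (0 : R) = 1.
Proof. by rewrite /expi cos0 sin0. Qed.

Lemma expi_pi : expi (pi : R) = -1.
Proof. by rewrite /expi cospi sinpi; apply/eqP; rewrite eq_complex /= oppr0 !eqxx. Qed.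

Lemma expi_2pi (t : R) : expi (t + pi *+ 2) = expi t.
Proof. by rewrite expiD mulr2n expiD expi_pi mulrN1 opprK mulr1. Qed.

Lemma nbhs_cabsP (x : C) (P : set C) :
  nbhs x P <-> exists2 e : R, 0 < e & forall y, cabs (y - x) < e -> P y.
Proof.
split=> [/nbhs_ballP[e /= e0 eP]|[e e0 eP]].
  have er : e = (complex.Re e)%:C%C.
    by rewrite RRe_real // realE (ltW e0).
  exists (complex.Re e).
    by move: e0; rewrite er ltcR.
  move=> y yx; apply: eP; rewrite /ball /=.
  by rewrite distrC -cabsE er ltcR.
apply/nbhs_ballP; exists e%:C%C => /=; first by rewrite ltcR.
move=> y; rewrite /ball /= distrC -cabsE ltcR; exact: eP.
Qed.

Lemma nbhs_cabs2P (x : C * C) (P : set (C * C)) :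
  nbhs x P <-> exists2 e : R, 0 < e &
    forall w : R[i] * R[i], cabs (w.1 - x.1) < e -> cabs (w.2 - x.2) < e -> P w.
Proof.
split=> [[[A B] /= [/nbhs_cabsP[e e0 eA] /nbhs_cabsP[d d0 dB]] AB]|[e e0 eP]].
  exists (Num.min e d); first by rewrite lt_min e0.
  move=> [y1 y2] /=; rewrite !lt_min => /andP[+ _] /andP[_ +].
  by move=> /eA Ay /dB By; apply: AB.
exists ([set y | cabs (y - x.1) < e], [set y | cabs (y - x.2) < e]) => /=.
  by split; apply/nbhs_cabsP; exists e.
by move=> [y1 y2] /= [? ?]; exact: eP.
Qed.

Lemma cvg_cabsP (T : Type) (F : set_system T) (FF : Filter F) (f : T -> C) (l : C) :
  f @ F --> l <-> forall e : R, 0 < e -> \forall t \near F, cabs (f t - l) < e.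
Proof.
split=> [fl e e0|fl P /nbhs_cabsP[e e0 eP]].
  by apply: (fl [set y | cabs (y - l) < e]); apply/nbhs_cabsP; exists e.
by apply: filterS (fl _ e0) => t /= te; apply: eP.
Qed.

Lemma cabs_continuous : continuous (@cabs R : C -> R).
Proof.
move=> x; apply/(@cvgrPdist_lt _ R^o _ _ (@nbhs_filter C x)) => e e0; apply/nbhs_cabsP; exists e => // y yx.
by rewrite (le_lt_trans (cabs_lerB _ _)) // cabsB.
Qed.

Lemma Re_continuous : continuous (@complex.Re R : C -> R).
Proof.
move=> x; apply/(@cvgrPdist_lt _ R^o _ _ (@nbhs_filter C x)) => e e0; apply/nbhs_cabsP; exists e => // y yx.
by rewrite -Re_opp -Re_add (le_lt_trans (Re_le_cabs _)) // cabsB.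
Qed.

Lemma Im_continuous : continuous (@complex.Im R : C -> R).
Proof.
move=> x; apply/(@cvgrPdist_lt _ R^o _ _ (@nbhs_filter C x)) => e e0; apply/nbhs_cabsP; exists e => // y yx.
by rewrite -Im_opp -Im_add (le_lt_trans (Im_le_cabs _)) // cabsB.
Qed.

Lemma cvg_complex (T : Type) (F : set_system T) (FF : Filter F) (f g : T -> R) (a b : R) :
  f @ F --> a -> g @ F --> b -> (fun t => Complex (f t) (g t) : C) @ F --> (Complex a b : C).
Proof.
move=> fa gb; apply/cvg_cabsP => e e0.
have e2 : 0 < e / 2 by rewrite divr_gt0.
have {}fa := iffLR (@cvgrPdist_lt _ R^o _ F FF f a) fa _ e2.
have {}gb := iffLR (@cvgrPdist_lt _ R^o _ F FF g b) gb _ e2.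
near=> t; rewrite (le_lt_trans (cabs_le_ReIm _)) //= (splitr e) ltrD //.
  by rewrite distrC; near: t.
by rewrite distrC; near: t.
Unshelve. all: by end_near. Qed.

Lemma expi_continuous : continuous (@expi R : R -> C).
Proof.
by move=> t; apply: cvg_complex; [exact: continuous_cos|exact: continuous_sin].
Qed.

End ComplexModulus.

(** * Integrals of continuous real functions over segments *)

Section SegmentIntegral.
Variable R : realType.
Notation mu := (@lebesgue_measure R).
Implicit Types (f g : R -> R) (a b c : R).

Definition continuous_on_seg f a b := forall t, a <= t <= b -> {for t, continuous f}.

Definition seg_int f a b : R := \int[mu]_(t in `[a, b]) f t.

Lemma continuous_on_segW f a b a' b' : a <= a' -> b' <= b ->
  continuous_on_seg f a b -> continuous_on_seg f a' b'.
Proof.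
move=> aa bb cf t /andP[at_ tb]; apply: cf.
by rewrite (le_trans aa at_) (le_trans tb bb).
Qed.

Lemma continuous_on_seg_integrable f a b : continuous_on_seg f a b ->
  mu.-integrable `[a, b] (EFin \o f).
Proof.
move=> cf; apply: continuous_compact_integrable; first exact: segment_compact.
by apply: continuous_in_subspaceT => t; rewrite inE /= in_itv /=; exact: cf.
Qed.

Lemma eq_seg_int f g a b : (forall t, a <= t <= b -> f t = g t) ->
  seg_int f a b = seg_int g a b.
Proof.
move=> fg; rewrite /seg_int /Rintegral; congr fine; apply: eq_integral => t.
by rewrite inE /= in_itv /= => /fg ->.
Qed.

Lemma seg_int_cst c a b : a <= b -> seg_int (fun=> c) a b = c * (b - a).
Proof.
move=> ab; rewrite /seg_int Rintegral_cst //= lebesgue_measure_itv /= lte_fin.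
by case: (ltgtP a b) ab => //= -> _; rewrite subrr.
Qed.

Lemma seg_intD f g a b : continuous_on_seg f a b -> continuous_on_seg g a b ->
  seg_int (fun t => f t + g t) a b = seg_int f a b + seg_int g a b.
Proof.
move=> cf cg; rewrite /seg_int RintegralD //; exact: continuous_on_seg_integrable.
Qed.

Lemma seg_intB f g a b : continuous_on_seg f a b -> continuous_on_seg g a b ->
  seg_int (fun t => f t - g t) a b = seg_int f a b - seg_int g a b.
Proof.
move=> cf cg; rewrite /seg_int RintegralB //; exact: continuous_on_seg_integrable.
Qed.

Lemma seg_intZ f c a b : continuous_on_seg f a b ->
  seg_int (fun t => c * f t) a b = c * seg_int f a b.
Proof.
move=> cf; rewrite /seg_int RintegralZl //; exact: continuous_on_seg_integrable.
Qed.

Lemma le_seg_int f g a b : continuous_on_seg f a b -> continuous_on_seg g a b ->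
  (forall t, a <= t <= b -> f t <= g t) -> seg_int f a b <= seg_int g a b.
Proof.
move=> cf cg fg; rewrite /seg_int; apply: le_Rintegral => //.
- exact: continuous_on_seg_integrable.
- exact: continuous_on_seg_integrable.
Qed.

Lemma seg_int_le_cst f c a b : a <= b -> continuous_on_seg f a b ->
  (forall t, a <= t <= b -> f t <= c) -> seg_int f a b <= c * (b - a).
Proof.
move=> ab cf fc; rewrite -seg_int_cst //; apply: le_seg_int => // t _; exact: cst_continuous.
Qed.

Lemma seg_int_ge_cst f c a b : a <= b -> continuous_on_seg f a b ->
  (forall t, a <= t <= b -> c <= f t) -> c * (b - a) <= seg_int f a b.
Proof.
move=> ab cf fc; rewrite -seg_int_cst //; apply: le_seg_int => // t _; exact: cst_continuous.
Qed.

Lemma seg_int_bound f c a b : a <= b -> continuous_on_seg f a b ->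
  (forall t, a <= t <= b -> `|f t| <= c) -> `|seg_int f a b| <= c * (b - a).
Proof.
move=> ab cf fc; rewrite ler_norml -mulNr; apply/andP; split.
  by apply: seg_int_ge_cst => // t /fc; rewrite ler_norml => /andP[].
by apply: seg_int_le_cst => // t /fc; rewrite ler_norml => /andP[].
Qed.

Lemma seg_int_split f a b c : a <= c -> c <= b -> continuous_on_seg f a b ->
  seg_int f a b = seg_int f a c + seg_int f c b.
Proof.
move=> ac cb cf; have := @Rintegral_itvB R f (BLeft a) (BRight b) c.
rewrite !bnd_simp => /(_ (continuous_on_seg_integrable cf) ac cb).
rewrite Rintegral_itv_obnd_cbnd => [H|]; first by rewrite /seg_int -H addrC subrK.
apply: (@integrableS _ _ _ mu `[a, b]) => //; last exact: continuous_on_seg_integrable.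
by apply: subset_itvr; rewrite bnd_simp.
Qed.

Lemma seg_int_shift f a b c : a <= b -> continuous_on_seg f (a + c) (b + c) ->
  seg_int (fun t => f (t + c)) a b = seg_int f (a + c) (b + c).
Proof.
move=> ab cf; rewrite /seg_int /Rintegral; congr fine.
have dF t : is_derive t (1 : R) (fun t : R => t + c) 1.
  by apply: is_derive_eq; rewrite addr0.
have F'E : ((fun t : R => t + c)^`())%classic = cst 1.
  by apply/funext => t; rewrite derive1E; have /@derive_val -> := dF t.
rewrite (@integration_by_substitution_increasing R (fun t => t + c) f a b) //.
- by apply: eq_integral => t _ /=; rewrite !fctE F'E /= mulr1.
- by move=> x y _ _ xy; rewrite ltrD2r.
- by rewrite F'E => x _; exact: cst_continuous.
- by rewrite F'E; apply: is_cvg_cst.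
- by rewrite F'E; apply: is_cvg_cst.
- have cF : continuous (fun t : R => t + c).
    by move=> t; apply: cvgD; [exact: cvg_id|exact: cvg_cst].
  split.
  + by move=> x _; have := dF x => -[].
  + by apply: cvg_at_right_filter; exact: cF.
  + by apply: cvg_at_left_filter; exact: cF.
by apply: continuous_in_subspaceT => t; rewrite inE /= in_itv /=; exact: cf.
Qed.

End SegmentIntegral.

(** * Goursat's theorem for squares, in real coordinates *)

Section Goursat.
Variable R : realType.
Implicit Types (s t h k l e : R).

Lemma nested_intervals (s l : nat -> R) :
  (forall n, s n <= s n.+1) -> (forall n, s n.+1 + l n.+1 <= s n + l n) ->
  (forall n, 0 <= l n) -> exists x, forall n, s n <= x <= s n + l n.
Proof.
move=> s_incr sl_decr l_ge0.
have s_le m n : (m <= n)%N -> s m <= s n.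
  move=> /subnKC <-; elim: (n - m)%N => [|d IHd]; first by rewrite addn0.
  by rewrite addnS (le_trans IHd).
have sl_ge m n : (m <= n)%N -> s n + l n <= s m + l m.
  move=> /subnKC <-; elim: (n - m)%N => [|d IHd]; first by rewrite addn0.
  by rewrite addnS (le_trans _ IHd).
have s_sl m n : s m <= s n + l n.
  apply: (@le_trans _ _ (s (maxn m n))); first by rewrite s_le // leq_maxl.
  rewrite (@le_trans _ _ (s (maxn m n) + l (maxn m n))) ?lerDl //.
  by rewrite sl_ge // leq_maxr.
have s_sup : has_sup (range s).
  split; first by exists (s 0%N); exists 0%N.
  by exists (s 0%N + l 0%N) => _ [n _ <-].
exists (sup (range s)) => n; apply/andP; split.
  by apply: ub_le_sup => //; case: s_sup.
by apply: ge_sup => [|_ [m _ <-]] //; exists (s 0%N); exists 0%N.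
Qed.

Variables (U V : R -> R -> R) (smax : R).

(* U + iV is complex differentiable at s + it, with derivative al + i be *)
Definition cauchy_riemann_at s t := exists al be, forall e, 0 < e ->
  exists2 d, 0 < d & forall h k, `|h| < d -> `|k| < d ->
    `|U (s + h) (t + k) - U s t - (al * h - be * k)| <= e * (`|h| + `|k|) /\
    `|V (s + h) (t + k) - V s t - (be * h + al * k)| <= e * (`|h| + `|k|).

Hypothesis cr : forall s t, s < smax -> cauchy_riemann_at s t.

Lemma linear_error_continuous (f : R -> R) x c :
  (forall e, 0 < e -> exists2 d, 0 < d & forall h, `|h| < d ->
    `|f (x + h) - f x - c * h| <= e * `|h|) -> {for x, continuous f}.
Proof.
move=> /(_ _ ltr01)[d d0 dP]; apply/(@cvgrPdist_lt _ R^o) => e e0.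
have c0 : 0 < 1 + `|c| by rewrite ltr_wpDr.
near=> y; rewrite distrC.
have : `|y - x| < d by rewrite distrC; near: y; exact: cvgr_dist_lt.
move=> /dP; rewrite (addrC x) subrK mul1r => fy.
rewrite (@le_lt_trans _ _ ((1 + `|c|) * `|y - x|)) //.
  rewrite -[f y - f x](subrK (c * (y - x))) (le_trans (ler_normD _ _)) //.
  by rewrite mulrDl mul1r -normrM lerD2r.
rewrite mulrC -ltr_pdivlMr // distrC; near: y; apply: cvgr_dist_lt => //.
by rewrite divr_gt0.
Unshelve. all: by end_near. Qed.

Let contU s t : s < smax -> {for t, continuous (U s)}.
Proof.
move=> /(@cr s t)[al [be crst]]; apply: (@linear_error_continuous _ _ (- be)) => e e0.
have [d d0 dP] := crst e e0; exists d => // h hd.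
have [+ _] := dP 0 h ltac:(by rewrite normr0) hd.
by rewrite normr0 addr0 mulr0 !add0r mulNr.
Qed.

Let contV s t : s < smax -> {for s, continuous (V^~ t)}.
Proof.
move=> /(@cr s t)[al [be crst]]; apply: (@linear_error_continuous _ _ be) => e e0.
have [d d0 dP] := crst e e0; exists d => // h hd.
have [_] := dP h 0 hd ltac:(by rewrite normr0).
by rewrite normr0 !addr0 mulr0 addr0.
Qed.

(** The imaginary part of the contour integral of U + iV around the square with lower left corner
    (s, t) and side [l]. *)
Let bdry s t l := seg_int (fun tau => U (s + l) tau - U s tau) t (t + l) -
  seg_int (fun sig => V sig (t + l) - V sig t) s (s + l).

Let bdryE s t l : 0 <= l -> s + l < smax ->
  bdry s t l = seg_int (U (s + l)) t (t + l) - seg_int (U s) t (t + l) -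
    (seg_int (V^~ (t + l)) s (s + l) - seg_int (V^~ t) s (s + l)).
Proof.
move=> l0 sl; rewrite /bdry seg_intB ?seg_intB //.
- by move=> x /andP[_ xs]; apply: contV; rewrite (le_lt_trans xs).
- by move=> x /andP[_ xs]; apply: contV; rewrite (le_lt_trans xs).
- by move=> x _; exact: contU.
- by move=> x _; apply: contU; rewrite (le_lt_trans _ sl) // lerDl.
Qed.

Let bdry_quarter s t l : 0 <= l -> s + (l + l) < smax ->
  bdry s t (l + l) = bdry s t l + bdry (s + l) t l + bdry s (t + l) l +
    bdry (s + l) (t + l) l.
Proof.
move=> l0 sl2.
have sl : s + l < smax by rewrite (le_lt_trans _ sl2) // lerD2l lerDl.
have s1 : s < smax by rewrite (le_lt_trans _ sl) // lerDl.
have l20 : 0 <= l + l by rewrite addr_ge0.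
rewrite !bdryE ?addrA //; last 3 first.
- by rewrite -addrA.
- by rewrite -addrA.
- by rewrite -addrA.
have splitU x : x < smax -> seg_int (U x) t (t + l + l) =
    seg_int (U x) t (t + l) + seg_int (U x) (t + l) (t + l + l).
  by move=> xs; apply: seg_int_split; rewrite ?lerDl // => y _; exact: contU.
have splitV y : seg_int (V^~ y) s (s + l + l) =
    seg_int (V^~ y) s (s + l) + seg_int (V^~ y) (s + l) (s + l + l).
  apply: seg_int_split; rewrite ?lerDl // => x /andP[_ xs]; apply: contV.
  by rewrite (le_lt_trans xs) // -addrA.
by rewrite !splitV !splitU -?addrA //; ring.
Qed.

(** The linear part of U + iV contributes [al * l * l] to both integrals, which cancels. Only the
    differentiability error is left, small relative to the area. *)
Let bdry_small s t : s < smax -> forall e, 0 < e -> exists2 d, 0 < d &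
  forall s' t' l, 0 < l < d -> s' + l < smax -> s' <= s <= s' + l -> t' <= t <= t' + l ->
    `|bdry s' t' l| <= e * (l * l).
Proof.
move=> ssmax e e0; have [al [be crst]] := @cr s t ssmax.
have [d d0 dP] := crst (e / 8) ltac:(by rewrite divr_gt0).
exists d => // s' t' l /andP[l0 ld] sl /andP[ss' ss'l] /andP[tt' tt'l].
have close x x' y : x' <= x <= x' + l -> x' <= y <= x' + l -> `|y - x| <= l.
  move=> /andP[? ?] /andP[? ?]; rewrite ler_norml; apply/andP; split; lra.
have sg : s' <= s <= s' + l by rewrite ss'.
have tg : t' <= t <= t' + l by rewrite tt'.
have l1 : s' <= s' <= s' + l by rewrite lexx lerDl ltW.
have l2 : s' <= s' + l <= s' + l by rewrite lexx lerDl ltW.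
have l3 : t' <= t' <= t' + l by rewrite lexx lerDl ltW.
have l4 : t' <= t' + l <= t' + l by rewrite lexx lerDl ltW.
have err x y : s' <= x <= s' + l -> t' <= y <= t' + l ->
    `|U x y - U s t - (al * (x - s) - be * (y - t))| <= e / 4 * l /\
    `|V x y - V s t - (be * (x - s) + al * (y - t))| <= e / 4 * l.
  move=> xs yt; have xsl := close _ _ _ sg xs; have ytl := close _ _ _ tg yt.
  have [] := dP (x - s) (y - t); rewrite ?(le_lt_trans _ ld) //.
  rewrite !(addrC s) !(addrC t) !subrK => h1 h2.
  have h3 : e / 8 * (`|x - s| + `|y - t|) <= e / 4 * l.
    have -> : e / 4 * l = e / 8 * (l + l) by field.
    by rewrite ler_wpM2l ?lerD // ltW // divr_gt0.
  by split; rewrite (le_trans _ h3).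
have -> : bdry s' t' l =
    seg_int (fun tau => U (s' + l) tau - U s' tau - al * l) t' (t' + l) -
    seg_int (fun sig => V sig (t' + l) - V sig t' - al * l) s' (s' + l).
  have s's : s' < smax by rewrite (le_lt_trans _ ssmax).
  rewrite [in RHS]seg_intB; last 2 first.
  - by move=> x _; apply: continuousB; apply: contU.
  - by move=> x _; exact: cst_continuous.
  rewrite [X in _ = _ - X]seg_intB; last 2 first.
  - move=> x /andP[_ xs]; have xm := le_lt_trans xs sl.
    by apply: (@continuousB _ _ _ (V^~ (t' + l)) (V^~ t')); exact: contV.
  - by move=> x _; exact: cst_continuous.
  rewrite !seg_int_cst ?lerDl ?ltW // /bdry; ring.
have fin : e * (l * l) = e / 2 * l * (t' + l - t') + e / 2 * l * (s' + l - s').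
  by field.
rewrite (le_trans (ler_normB _ _)) // fin lerD //.
- apply: seg_int_bound; first by rewrite lerDl ltW.
    move=> x _; apply: continuousB; last exact: cst_continuous.
    by apply: continuousB; apply: contU => //; rewrite (le_lt_trans _ ssmax).
  move=> y yt; have [h1 _] := err _ _ l2 yt; have [h2 _] := err _ _ l1 yt.
  have -> : U (s' + l) y - U s' y - al * l =
    (U (s' + l) y - U s t - (al * (s' + l - s) - be * (y - t))) -
    (U s' y - U s t - (al * (s' - s) - be * (y - t))) by ring.
  by rewrite (le_trans (ler_normB _ _)) // (le_trans (lerD h1 h2)) //; lra.
- apply: seg_int_bound; first by rewrite lerDl ltW.
    move=> x /andP[_ xs]; have xm := le_lt_trans xs sl.
    apply: (@continuousB _ _ _ (fun x => V x (t' + l) - V x t')); last exact: cst_continuous.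
    by apply: (@continuousB _ _ _ (V^~ (t' + l)) (V^~ t')); exact: contV.
  move=> x xs; have [_ h1] := err _ _ xs l4; have [_ h2] := err _ _ xs l3.
  have -> : V x (t' + l) - V x t' - al * l =
    (V x (t' + l) - V s t - (be * (x - s) + al * (t' + l - t))) -
    (V x t' - V s t - (be * (x - s) + al * (t' - t))) by ring.
  by rewrite (le_trans (ler_normB _ _)) // (le_trans (lerD h1 h2)) //; lra.
Qed.

(** Repeated quartering: if the integral were too large, some quarter would again be too large
    relative to its area. The nested squares shrink to a point, where [bdry_small] is
    contradicted. *)
Let bdry0 s t l : 0 < l -> s + l < smax -> bdry s t l = 0.
Proof.
move=> l0 slm; apply/eqP; rewrite -normr_le0; apply/ler_addgt0Pr => e e0; rewrite add0r.
rewrite leNgt; apply/negP => bad0.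
pose ln n : R := l / 2 ^+ n.
have ln0 n : 0 < ln n by rewrite divr_gt0 // exprn_gt0.
have lnS n : ln n = ln n.+1 + ln n.+1 by rewrite /ln exprS; field; rewrite expf_neq0.
pose c : R := e / (l * l).
have c0 : 0 < c by rewrite divr_gt0 // mulr_gt0.
pose bad n (p : R * R) := c * (ln n * ln n) < `|bdry p.1 p.2 (ln n)|.
(* Selects the corner of a quarter that is still bad; the last quarter is taken by default, and
   [badS] shows that it is bad when the other three are not. *)
pose next n (p : R * R) :=
  if bad n.+1 p then p else
  if bad n.+1 (p.1 + ln n.+1, p.2) then (p.1 + ln n.+1, p.2) else
  if bad n.+1 (p.1, p.2 + ln n.+1) then (p.1, p.2 + ln n.+1) else
  (p.1 + ln n.+1, p.2 + ln n.+1).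
have badS n p : p.1 + ln n < smax -> bad n p -> bad n.+1 (next n p).
  case: p => p1 p2 /= pm bp; rewrite /next /=.
  case: ifPn => //; rewrite /bad /= -leNgt => b1.
  case: ifPn => //; rewrite -leNgt => b2.
  case: ifPn => //; rewrite -leNgt => b3.
  rewrite ltNge; apply/negP => b4; move: bp; rewrite /bad /= ltNge => /negP; apply.
  have L0 := ltW (ln0 n.+1).
  rewrite lnS bdry_quarter //; last by rewrite -lnS.
  apply: (le_trans (ler_normD _ _)).
  have := lerD (lerD (lerD b1 b2) b3) b4.
  set L := ln n.+1 => Hb.
  have -> : c * ((L + L) * (L + L)) = c * (L * L) + c * (L * L) + c * (L * L) + c * (L * L).
    by ring.
  apply: le_trans Hb; rewrite lerD2r; apply: (le_trans (ler_normD _ _)).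
  rewrite lerD2r; exact: ler_normD.
pose fix p_ n : R * R := if n is m.+1 then next m (p_ m) else (s, t).
have nextP n p : (p.1 <= (next n p).1) /\ ((next n p).1 + ln n.+1 <= p.1 + ln n) /\
    (p.2 <= (next n p).2) /\ ((next n p).2 + ln n.+1 <= p.2 + ln n).
  have := ln0 n.+1; rewrite /next (lnS n).
  by case: ifP => _ /=; [|case: ifP => _ /=; [|case: ifP => _ /=]] => ?;
    split=> //=; try split => //=; try split => //=; lra.
have [x xP] : exists x, forall n, (p_ n).1 <= x <= (p_ n).1 + ln n.
  apply: nested_intervals => [n|n|n]; last exact/ltW.
    by have [] := nextP n (p_ n).
  by have [_ []] := nextP n (p_ n).
have [y yP] : exists y, forall n, (p_ n).2 <= y <= (p_ n).2 + ln n.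
  apply: nested_intervals => [n|n|n]; last exact/ltW.
    by have [_ [_ []]] := nextP n (p_ n).
  by have [_ [_ []]] := nextP n (p_ n).
have pm n : (p_ n).1 + ln n < smax.
  elim: n => [|n IHn]; first by rewrite /ln expr0 divr1.
  by have [_ [h _]] := nextP n (p_ n); apply: le_lt_trans IHn.
have bad_n n : bad n (p_ n).
  elim: n => [|n IHn]; last exact: badS.
  by rewrite /bad /= /ln expr0 divr1 /c divfK // mulf_neq0 ?gt_eqF.
have xm : x < smax by have /andP[_ /le_lt_trans] := xP 0%N; apply; exact: pm.
have [d d0 dP] := bdry_small y xm c0.
have [n nd] : exists n, ln n < d.
  have : (fun n => l * (2^-1) ^+ n) @ \oo --> l * 0.
    by apply: cvgMr; apply: cvg_expr; rewrite ger0_norm // invf_lt1 // ltr1n.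
  rewrite mulr0 => /(@cvgrPdist_lt _ R^o) /(_ _ d0)[n _ /(_ n) /=].
  rewrite sub0r normrN exprVn => /(_ (leqnn _)) h; exists n.
  by apply: le_lt_trans h; exact: ler_norm.
have := bad_n n; rewrite /bad ltNge dP //.
by rewrite ln0.
Qed.

Lemma goursat_square s t l : 0 < l -> s + l < smax ->
  seg_int (U (s + l)) t (t + l) - seg_int (U s) t (t + l) =
  seg_int (V^~ (t + l)) s (s + l) - seg_int (V^~ t) s (s + l).
Proof.
by move=> l0 sl; apply/eqP; rewrite -subr_eq0 -bdryE ?ltW // bdry0.
Qed.

End Goursat.

(** * The mean value property of holomorphic functions *)

Section MeanValueProperty.
Variable R : realType.
Local Notation C := ((R[i])^o).

Lemma derivable_linear_error (K : numFieldType) (f : K -> K) (x : K) :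
  derivable f x 1 -> forall e : K, 0 < e -> exists2 d : K, 0 < d &
    forall h, `|h| < d -> `|f (x + h) - f x - 'D_1 f x * h| <= e * `|h|.
Proof.
move=> df e e0; have := df; rewrite /derivable /derive => /cvg_ex[l fl].
have -> : lim (h^-1 *: (f (h *: (1 : K) + x) - f x) @[h --> 0^']) = l.
  exact: (cvg_lim _ fl).
have := fl; move=> /(@cvgrPdist_lt _ K^o) /(_ _ e0).
rewrite /dnbhs near_withinE => /nbhs_ballP[d /= d0 dP]; exists d => // h hd.
have [->|h0] := eqVneq h 0; first by rewrite addr0 mulr0 subrr subr0 !normr0 mulr0.
have := dP h; rewrite /ball /= sub0r normrN => /(_ hd h0) H.
have hn : 0 < `|h| by rewrite normr_gt0.
rewrite -ler_pdivrMr // -normfV -normrM.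
apply/ltW; apply: le_lt_trans H.
rewrite le_eqVlt; apply/orP; left; apply/eqP.
rewrite -[RHS]normrN; congr (`|_|).
by rewrite /GRing.scale /= mulr1 (addrC h); field.
Qed.

Lemma derivable_linear_error_C (f : C -> C) (x : C) :
  derivable f x 1 -> exists D : R[i], forall e : R, 0 < e -> exists2 d : R, 0 < d &
    forall h, cabs h < d -> cabs (f (x + h) - f x - D * h) <= e * cabs h.
Proof.
move=> df; exists ('D_1 f x) => e e0.
have [|d d0 dP] := @derivable_linear_error _ f x df e%:C%C; first by rewrite ltcR.
have dr : d = (complex.Re d)%:C%C by rewrite RRe_real // realE (ltW d0).
exists (complex.Re d); first by rewrite -ltcR -dr.
move=> h hd; have := dP h; rewrite -cabsE dr ltcR => /(_ hd).
by rewrite -!cabsE -rmorphM lecR.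
Qed.

Lemma derivable_linear_error_R (f : R -> R) (x D : R) :
  is_derive x (1 : R) f D -> forall e : R, 0 < e -> exists2 d : R, 0 < d &
    forall h, `|h| < d -> `|f (x + h) - f x - D * h| <= e * `|h|.
Proof.
move=> [df <-] e e0; exact: derivable_linear_error.
Qed.

(** Differentiability at 0 of the complex exponential, assembled from [expR], [cos] and [sin]. *)
Lemma expR_expi_error (e : R) : 0 < e -> exists2 d : R, 0 < d &
  forall h k : R, `|h| < d -> `|k| < d ->
    cabs ((expR h)%:C%C * expi k - 1 - Complex h k) <= e * (`|h| + `|k|).
Proof.
move=> e0; pose e' := Num.min (e / 20) (1 / 20).
have e'0 : 0 < e' by rewrite lt_min !divr_gt0.
have e'e : e' <= e / 20 by rewrite ge_min lexx.
have e'1 : e' <= 1 / 20 by rewrite ge_min lexx orbT.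
clearbody e'.
have := @derivable_linear_error_R (@expR R) 0 (expR 0) (is_derive_expR 0).
rewrite expR0 => /(_ _ e'0)[d1 d10 d1P].
have := @derivable_linear_error_R (@cos R) 0 (- sin 0) (is_derive_cos 0).
rewrite sin0 cos0 oppr0 => /(_ _ e'0)[d2 d20 d2P].
have := @derivable_linear_error_R (@sin R) 0 (cos 0) (is_derive_sin 0).
rewrite sin0 cos0 => /(_ _ e'0)[d3 d30 d3P].
exists (Num.min e' (Num.min d1 (Num.min d2 d3))).
  by rewrite !lt_min e'0 d10 d20 d30.
move=> h k; rewrite !lt_min => /and4P[he' h1 h2 h3] /and4P[ke' k1 k2 k3].
have := d1P _ h1; have := d2P _ k2; have := d3P _ k3.
rewrite !add0r !mul0r !mul1r !subr0 => S Co E.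
have h0 := normr_ge0 h; have k0 := normr_ge0 k.
have Eb : `|expR h - 1| <= 2 * `|h|.
  rewrite -[expR h - 1](subrK h) (le_trans (ler_normD _ _)) //.
  have : e' * `|h| <= 1 * `|h| by rewrite ler_wpM2r //; lra.
  lra.
have E3 : `|expR h| <= 2.
  have -> : expR h = (expR h - 1) + 1 by rewrite subrK.
  rewrite (le_trans (ler_normD _ _)) // normr1; lra.
apply: le_trans (cabs_le_ReIm _) _.
rewrite !Re_add !Im_add !Re_opp !Im_opp /= !mul0r subr0 addr0 oppr0 addr0.
have -> : expR h * cos k - 1 - h = (expR h - 1 - h) + expR h * (cos k - 1) by ring.
have -> : expR h * sin k - k = expR h * (sin k - k) + (expR h - 1) * k by ring.
have ehk : e' * `|h| <= e / 20 * `|h| by rewrite ler_wpM2r.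
have ekk : e' * `|k| <= e / 20 * `|k| by rewrite ler_wpM2r.
have E1 : `|expR h * (cos k - 1)| <= 2 * (e / 20 * `|k|).
  by rewrite normrM ler_pM // (le_trans Co).
have E2 : `|expR h * (sin k - k)| <= 2 * (e / 20 * `|k|).
  by rewrite normrM ler_pM // (le_trans S).
have E4 : `|(expR h - 1) * k| <= 2 * (e / 20 * `|k|).
  rewrite normrM (le_trans (ler_wpM2r k0 Eb)) // -(mulrA 2) ler_pM2l //.
  by rewrite ler_wpM2r // (le_trans _ e'e) // ltW.
apply: le_trans (lerD (ler_normD _ _) (ler_normD _ _)) _.
have : 0 <= e * `|h| by rewrite mulr_ge0 // ltW.
have : 0 <= e * `|k| by rewrite mulr_ge0 // ltW.
lra.
Qed.

(* s + it is sent to the point of polar coordinates (e^s, t) about z0 *)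
Definition polar (z0 : R[i]) (rho s t : R) : R[i] :=
  z0 + (rho * expR s)%:C%C * expi t.

Lemma polar_error z0 rho s t (e : R) : 0 < e -> exists2 d : R, 0 < d &
  forall h k : R, `|h| < d -> `|k| < d ->
    cabs (polar z0 rho (s + h) (t + k) - polar z0 rho s t -
       (polar z0 rho s t - z0) * Complex h k) <= e * (`|h| + `|k|).
Proof.
move=> e0; set w := polar z0 rho s t - z0.
have w0 : 0 < cabs w + 1 by rewrite ltr_wpDl // cabs_ge0.
have [d d0 dP] := @expR_expi_error (e / (cabs w + 1)) ltac:(by rewrite divr_gt0).
exists d => // h k hd kd.
have -> : polar z0 rho (s + h) (t + k) - polar z0 rho s t - w * Complex h k =
    w * ((expR h)%:C%C * expi k - 1 - Complex h k).
  by rewrite /w /polar expRD expiD !rmorphM /=; ring.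
rewrite cabsM (le_trans (ler_wpM2l (cabs_ge0 _) (dP h k hd kd))) //.
rewrite mulrCA !mulrA ler_wpM2r ?addr_ge0 // -mulrA ler_piMr ?(ltW e0) //.
by rewrite mulrC ler_pdivrMr // mul1r lerDl.
Qed.

Lemma derivable_polar (f : R[i] -> R[i]) z0 rho s t :
  derivable (f : C -> C) (polar z0 rho s t : C) 1 ->
  exists D : R[i], forall e : R, 0 < e -> exists2 d : R, 0 < d &
  forall h k : R, `|h| < d -> `|k| < d ->
    cabs (f (polar z0 rho (s + h) (t + k)) - f (polar z0 rho s t) -
       D * Complex h k) <= e * (`|h| + `|k|).
Proof.
set p := polar _ _ _ _ => /derivable_linear_error_C[D Df].
exists (D * (p - z0)) => e e0; set w := p - z0.
have w0 : 0 < cabs w + 1 by rewrite ltr_wpDl // cabs_ge0.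
have D0 : 0 < cabs D + 1 by rewrite ltr_wpDl // cabs_ge0.
have e1 : 0 < e / 2 / (cabs w + 1) by rewrite !divr_gt0.
have [d1 d10 d1P] := Df _ e1.
pose e2 := Num.min 1 (e / 2 / (cabs D + 1)).
have e20 : 0 < e2 by rewrite lt_min ltr01 !divr_gt0.
have [d2 d20 d2P] := polar_error z0 rho s t e20.
pose d3 := d1 / (2 * (cabs w + 1)).
have d30 : 0 < d3 by rewrite divr_gt0 // mulr_gt0.
exists (Num.min d2 d3); first by rewrite lt_min d20.
move=> h k; rewrite !lt_min => /andP[h2 h3] /andP[k2 k3].
have := d2P h k h2 k2; rewrite -/p -/w; set q := polar _ _ _ _ => qP.
have hk0 : 0 <= `|h| + `|k| by rewrite addr_ge0.
have qp : cabs (q - p) <= (cabs w + 1) * (`|h| + `|k|).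
  rewrite -[q - p](subrK (w * Complex h k)) (le_trans (cabsD _ _)) //.
  rewrite [leRHS]mulrDl mul1r addrC lerD // ?(le_trans qP) //.
    by rewrite cabsM ler_wpM2l ?cabs_ge0 // (le_trans (cabs_le_ReIm _)).
  by rewrite ler_piMl // ge_min lexx.
have qd : cabs (q - p) < d1.
  rewrite (le_lt_trans qp) // mulrC -ltr_pdivlMr //.
  have -> : d1 / (cabs w + 1) = d3 + d3 by rewrite /d3; field; rewrite gt_eqF.
  exact: ltrD.
have := d1P _ qd; rewrite (addrC p) subrK => fq.
have -> : f q - f p - D * w * Complex h k =
  (f q - f p - D * (q - p)) + D * (q - p - w * Complex h k) by ring.
rewrite (le_trans (cabsD _ _)) // {1}[e]splitr [leRHS]mulrDl lerD //.
  rewrite (le_trans fq) // (le_trans (ler_wpM2l (ltW e1) qp)) //.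
  by rewrite mulrA divfK // gt_eqF.
rewrite cabsM (le_trans (ler_wpM2l (cabs_ge0 _) qP)) // mulrA ler_wpM2r //.
have : cabs D * e2 <= cabs D * (e / 2 / (cabs D + 1)).
  by rewrite ler_wpM2l ?cabs_ge0 // ge_min lexx orbT.
move=> /le_trans; apply; rewrite mulrCA ler_piMr ?divr_ge0 ?(ltW e0) //.
by rewrite ler_pdivrMr // mul1r lerDl.
Qed.

Lemma derivable_continuous_C (f : C -> C) (x : C) :
  derivable f x 1 -> {for x, continuous f}.
Proof. by move=> /derivable1_diffP /differentiable_continuous. Qed.

Definition circle_int (F : R -> R) : R := seg_int F 0 (pi *+ 2).

Lemma pi2_gt0 : 0 < (pi : R) *+ 2.
Proof. by rewrite pmulrn_rgt0 // pi_gt0. Qed.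

Lemma polar_continuous z0 rho s : continuous (polar z0 rho s : R -> C).
Proof.
move=> t; apply: (@cvgD _ C); first exact: cvg_cst.
apply: (@cvgM R[i]); first exact: cvg_cst.
exact: expi_continuous.
Qed.

(** In logarithmic polar coordinates the function is 2 pi-periodic in t, so on a square of side 2 pi
    the two horizontal sides cancel. Goursat's theorem then says that the circle integral is the
    same at s and at s - 2 pi. Iterating shrinks the circle to [z0], where continuity gives the
    value. *)
Lemma mean_value_Re (f : R[i] -> R[i]) (z0 : R[i]) (r rho : R) :
  0 < rho < r -> (forall z, cabs (z - z0) < r -> derivable (f : C -> C) (z : C) 1) ->
  circle_int (fun t => complex.Re (f (z0 + rho%:C%C * expi t))) =
  pi *+ 2 * complex.Re (f z0).
Proof.
move=> /andP[rho0 rhor] df; have p2 := pi2_gt0.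
have r0 := lt_trans rho0 rhor.
pose smax := ln (r / rho).
have smax0 : 0 < smax by rewrite ln_gt0 // ltr_pdivlMr // mul1r.
have polarE s t : cabs (polar z0 rho s t - z0) = rho * expR s.
  rewrite /polar addrC addKr cabsM cabs_expi mulr1 cabs_real ger0_norm //.
  by rewrite mulr_ge0 ?expR_ge0 // ltW.
have inr s t : s < smax -> cabs (polar z0 rho s t - z0) < r.
  rewrite polarE mulrC -ltr_pdivlMr // => ss.
  rewrite -[ltRHS]lnK ?posrE ?divr_gt0 //.
  by rewrite ltr_expR.
pose U s t := complex.Re (f (polar z0 rho s t)).
pose V s t := complex.Im (f (polar z0 rho s t)).
have cr s t : s < smax -> cauchy_riemann_at U V s t.
  move=> /(inr s t)/df/derivable_polar[D Df].
  exists (complex.Re D), (complex.Im D) => e /Df[d d0 dP]; exists d => // h k hd kd.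
  have H := dP h k hd kd; split.
    apply: le_trans H; apply: le_trans (Re_le_cabs _).
    by rewrite !Re_add !Re_opp Re_mul /=.
  apply: le_trans H; apply: le_trans (Im_le_cabs _).
  by rewrite !Im_add !Im_opp Im_mul /= [X in _ - X]addrC.
have per s t : polar z0 rho s (t + pi *+ 2) = polar z0 rho s t.
  by rewrite /polar expi_2pi.
pose Phi s := circle_int (U s).
have PhiS s : s < smax -> Phi s = Phi (s - pi *+ 2).
  move=> ss; have := @goursat_square R U V smax cr (s - pi *+ 2) 0 (pi *+ 2) p2.
  rewrite subrK => /(_ ss); rewrite add0r.
  have -> : V^~ (pi *+ 2) = V^~ 0.
    by apply/funext => x; rewrite /V -[pi *+ 2]add0r per.
  by rewrite subrr; exact: subr0_eq.
have negn n : - (pi *+ 2) *+ n < smax.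
  apply: le_lt_trans smax0; rewrite mulNrn oppr_le0 mulrn_wge0 //; exact: ltW.
have PhiN n : Phi 0 = Phi (- (pi *+ 2) *+ n).
  elim: n => [|n IHn]; first by rewrite mulr0n.
  by rewrite mulrSr IHn; exact: (PhiS _ (negn n)).
have -> : circle_int (fun t => complex.Re (f (z0 + rho%:C%C * expi t))) = Phi 0.
  by apply: eq_seg_int => t _; rewrite /U /polar expR0 mulr1.
apply/eqP; rewrite -subr_eq0 -normr_le0; apply/ler_addgt0Pr => e e0; rewrite add0r.
have fz0 : {for (z0 : C), continuous (f : C -> C)}.
  by apply: derivable_continuous_C; apply: df; rewrite subrr cabs0.
have e1 : 0 < e / (pi *+ 2) by rewrite divr_gt0.
have := iffLR (cvg_cabsP (nbhs_filter (z0 : C)) _ _) fz0 _ e1.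
move=> /nbhs_cabsP[d d0 dP].
have [n nd] : exists n, rho * expR (- (pi *+ 2) *+ n) < d.
  have : (fun n => rho * (expR (- (pi *+ 2))) ^+ n) @ \oo --> rho * 0.
    apply: cvgMr; apply: cvg_expr; rewrite ger0_norm ?expR_ge0 // expR_lt1.
    by rewrite oppr_lt0.
  rewrite mulr0 => /(@cvgrPdist_lt _ R^o) /(_ _ d0)[n _ /(_ n) /=].
  rewrite sub0r normrN => /(_ (leqnn _)) h; exists n.
  rewrite -mulr_natl expRM_natl; apply: le_lt_trans h; exact: ler_norm.
rewrite (PhiN n) /Phi /circle_int.
have := negn n; set s := _ *+ n => ss.
have cU : continuous_on_seg (U s) 0 (pi *+ 2).
  move=> t _; apply: (@continuous_comp R C R (f \o polar z0 rho s) (@complex.Re R)); last first.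
    exact: Re_continuous.
  apply: (@continuous_comp R C C (polar z0 rho s) f); first exact: polar_continuous.
  apply: derivable_continuous_C; apply: df; exact: inr.
have -> : seg_int (U s) 0 (pi *+ 2) - pi *+ 2 * complex.Re (f z0) =
    seg_int (fun t => U s t - complex.Re (f z0)) 0 (pi *+ 2).
  rewrite seg_intB //; last by move=> t _; exact: cst_continuous.
  by rewrite seg_int_cst ?(ltW p2) // subr0 (mulrC (complex.Re _)).
apply: le_trans (@seg_int_bound _ _ (e / (pi *+ 2)) 0 (pi *+ 2) (ltW p2) _ _) _.
- by move=> t t2; apply: continuousB; [exact: (cU t t2)|exact: cst_continuous].
- move=> t _; rewrite /U -Re_opp -Re_add (le_trans (Re_le_cabs _)) //.
  by apply/ltW/dP; rewrite polarE.
- by rewrite subr0 divfK // gt_eqF.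
Qed.

End MeanValueProperty.

(** * Jensen's formula for linear functions *)

Section JensenLinear.
Variable R : realType.
Local Notation C := ((R[i])^o).

Lemma circle_int_rotation (F : R -> R) (c : R) : continuous F ->
  (forall t, F (t + pi *+ 2) = F t) -> 0 <= c <= pi *+ 2 ->
  circle_int (fun t => F (t + c)) = circle_int F.
Proof.
move=> cF perF /andP[c0 c2]; have p2 := ltW (pi2_gt0 R).
have cFs a b : continuous_on_seg F a b by move=> t _; exact: cF.
rewrite /circle_int seg_int_shift // add0r.
rewrite (@seg_int_split _ _ c (pi *+ 2 + c) (pi *+ 2)) ?lerDl //.
rewrite (@seg_int_split _ F 0 (pi *+ 2) c) // addrC; congr (_ + _).
have -> : seg_int F (pi *+ 2) (pi *+ 2 + c) = seg_int F (0 + pi *+ 2) (c + pi *+ 2).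
  by rewrite add0r addrC.
rewrite -seg_int_shift //; apply: eq_seg_int => t _; exact: perF.
Qed.

Lemma ln_cabs_continuous (T : topologicalType) (g : T -> R[i]) (t : T) :
  {for t, continuous (g : T -> C)} -> g t != 0 ->
  {for t, continuous (fun x => ln (cabs (g x)))}.
Proof.
move=> cg gt0; apply: (@continuous_comp T R R (fun x => cabs (g x)) (@ln R)).
  by apply: (@continuous_comp T C R g (@cabs R)) => //; exact: cabs_continuous.
by apply: continuous_ln; rewrite cabs_gt0.
Qed.

Lemma expiMn (t : R) n : expi (t *+ n) = expi t ^+ n.
Proof. by elim: n => [|n IHn]; rewrite ?mulr0n ?expi0 // mulrS expiD IHn exprS. Qed.

(** With x = (b e^{it})^(2^k), 1 - x^2 = (1 - x)(1 + x), and rotation by pi / 2^k exchanges the two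
    factors. Hence replacing x by x^2 doubles the integral. All these integrals are bounded by one
    constant since |x| <= |b| < 1, so the first one vanishes. *)
Lemma circle_int_ln_cabs1B (b : R[i]) : cabs b < 1 ->
  circle_int (fun t => ln (cabs (1 - b * expi t))) = 0.
Proof.
move=> b1; have p2 := pi2_gt0 R; have b0 := cabs_ge0 b.
pose x k t := (b * expi t) ^+ (2 ^ k).
have xb k t : cabs (x k t) <= cabs b.
  rewrite cabsX cabsM cabs_expi mulr1 -[leRHS]expr1.
  by rewrite ler_wiXn2l // ?ltW // expn_gt0.
have cabsB_ge y : cabs y <= cabs b -> 1 - cabs b <= cabs (1 - y).
  move=> yb; have := cabsD (1 - y) y; rewrite subrK cabs1; lra.
have ne k t : 1 - x k t != 0 /\ 1 + x k t != 0.
  rewrite -!cabs_gt0; split.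
    by rewrite (lt_le_trans _ (cabsB_ge _ (xb k t))) // subr_gt0.
  rewrite -[x k t]opprK (lt_le_trans _ (cabsB_ge _ _)) ?cabsN // subr_gt0 //.
have cx k : continuous (x k : R -> C).
  have cbx : continuous (fun t => b * expi t : C).
    move=> t; apply: (@cvgM R[i]); [exact: cvg_cst|exact: expi_continuous].
  rewrite /x; elim: (2 ^ k)%N => [|n IHn] t; first exact: cst_continuous.
  have -> : (fun t : R => (b * expi t) ^+ n.+1 : C) =
      (fun t => (b * expi t) * (b * expi t) ^+ n) by apply/funext => u; rewrite exprS.
  by apply: (@cvgM R[i]); [exact: cbx|exact: IHn].
pose F k t := ln (cabs (1 - x k t)); pose G k t := ln (cabs (1 + x k t)).
have cF k : continuous (F k).
  move=> t; apply: ln_cabs_continuous; last by have [] := ne k t.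
  by apply: (@cvgB _ C); [exact: cvg_cst|exact: cx].
have cG k : continuous (G k).
  move=> t; apply: ln_cabs_continuous; last by have [] := ne k t.
  by apply: (@cvgD _ C); [exact: cvg_cst|exact: cx].
have GF k : circle_int (G k) = circle_int (F k).
  pose c : R := pi / 2 ^+ k.
  have k1 : 1 <= 2 ^+ k :> R by rewrite exprn_ege1 // ler1n.
  have k0 : 0 < 2 ^+ k :> R by rewrite exprn_gt0.
  rewrite -(@circle_int_rotation (F k) c); first last.
  - rewrite /c divr_ge0 ?pi_ge0 ?(ltW k0) //= mulr2n ler_pdivrMr //.
    apply: (@le_trans _ _ ((pi + pi) * 1)); first by rewrite mulr1 lerDl pi_ge0.
    by rewrite ler_wpM2l // addr_ge0 // pi_ge0.
  - by move=> t; rewrite /F /x expi_2pi.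
  - exact: cF.
  apply: eq_seg_int => t _; rewrite /G /F /x; congr (ln (cabs _)).
  rewrite expiD mulrA [in RHS]exprMn -[expi c ^+ _]expiMn -mulr_natr natrX divfK ?gt_eqF //.
  by rewrite expi_pi mulrN1 opprK.
have FS k : circle_int (F k.+1) = 2 * circle_int (F k).
  have -> : circle_int (F k.+1) = circle_int (fun t => F k t + G k t).
    apply: eq_seg_int => t _; rewrite /F /G -lnM ?posrE ?cabs_gt0; try by have [] := ne k t.
    rewrite -cabsM; congr (ln (cabs _)).
    by rewrite /x expnS mulnC exprM; ring.
  rewrite [LHS]seg_intD; [|by move=> t _; exact: cF|by move=> t _; exact: cG].
  by rewrite -[X in _ + X]/(circle_int (G k)) GF mulr2n mulrDl mul1r.
have FX k : circle_int (F k) = 2 ^+ k * circle_int (F 0%N).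
  by elim: k => [|k IHk]; rewrite ?expr0 ?mul1r // FS IHk mulrA -exprS.
have -> : circle_int (fun t => ln (cabs (1 - b * expi t))) = circle_int (F 0%N).
  by apply: eq_seg_int => t _; rewrite /F /x expn0 expr1.
pose K := ln 2 - ln (1 - cabs b).
have bb : 0 < 1 - cabs b by rewrite subr_gt0.
have K0 : 0 <= ln 2 :> R by rewrite ln_ge0 // ler1n.
have K1 : ln (1 - cabs b) <= 0 by rewrite -(ln1 R) ler_ln ?posrE //; lra.
have FK k t : `|F k t| <= K.
  have h1 : ln (1 - cabs b) <= F k t.
    have Fp : 0 < cabs (1 - x k t) by rewrite cabs_gt0; have [] := ne k t.
    by rewrite /F ler_ln ?posrE //; exact: cabsB_ge (xb k t).
  have h2 : F k t <= ln 2.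
    have Fp : 0 < cabs (1 - x k t) by rewrite cabs_gt0; have [] := ne k t.
    rewrite /F ler_ln ?posrE //.
    have := cabsD 1 (- x k t); rewrite cabsN cabs1; have := xb k t; lra.
  rewrite /K ler_norml; apply/andP; split; lra.
apply/eqP; rewrite -normr_le0; apply/ler_addgt0Pr => e e0; rewrite add0r.
have [k kP] : exists k, K * (pi *+ 2) * (2^-1) ^+ k < e.
  have : (fun k => K * (pi *+ 2) * (2^-1) ^+ k) @ \oo --> K * (pi *+ 2) * 0.
    by apply: cvgMr; apply: cvg_expr; rewrite ger0_norm // invf_lt1 // ltr1n.
  rewrite mulr0 => /(@cvgrPdist_lt _ R^o) /(_ _ e0)[n _ /(_ n) /=].
  rewrite sub0r normrN => /(_ (leqnn _)) h; exists n.
  by apply: le_lt_trans h; exact: ler_norm.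
apply/ltW; apply: le_lt_trans kP; rewrite exprVn ler_pdivlMr ?exprn_gt0 //.
rewrite -[X in _ * X <= _]ger0_norm ?exprn_ge0 // -normrM mulrC -FX.
have := @seg_int_bound _ (F k) K 0 (pi *+ 2) (ltW p2).
by rewrite subr0; apply => [t _|t _]; [exact: cF|exact: FK].
Qed.

Lemma circle_int_ln_cabsB (a b : R[i]) : cabs b < cabs a ->
  circle_int (fun t => ln (cabs (a - b * expi t))) = pi *+ 2 * ln (cabs a).
Proof.
move=> ba; have a0 : 0 < cabs a by rewrite (le_lt_trans _ ba) // cabs_ge0.
have an0 : a != 0 by rewrite -cabs_gt0.
have ba1 : cabs (b / a) < 1 by rewrite cabsM cabsV ltr_pdivrMr // mul1r.
have nz t : 1 - b / a * expi t != 0.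
  apply/eqP => /eqP; rewrite subr_eq0 => /eqP h.
  have := congr1 (@cabs R) h; rewrite cabs1 cabsM cabs_expi mulr1 => h1.
  by move: ba1; rewrite -h1 ltxx.
have cF : continuous (fun t => ln (cabs (1 - b / a * expi t))).
  move=> t; apply: ln_cabs_continuous => //.
  apply: (@cvgB _ C); first exact: cvg_cst.
  by apply: (@cvgM R[i]); [exact: cvg_cst|exact: expi_continuous].
have -> : circle_int (fun t => ln (cabs (a - b * expi t))) =
    circle_int (fun t => ln (cabs a) + ln (cabs (1 - b / a * expi t))).
  apply: eq_seg_int => t _; rewrite -lnM ?posrE ?cabs_gt0 // -cabsM; congr (ln (cabs _)).
  by field.
rewrite [LHS]seg_intD; [|by move=> t _; exact: cst_continuous|by move=> t _; exact: cF].
rewrite -[X in _ + X]/(circle_int _) circle_int_ln_cabs1B // addr0.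
by rewrite seg_int_cst ?(ltW (pi2_gt0 R)) // subr0 mulrC.
Qed.

Lemma circle_int_ln_cabsD (a b : R[i]) : cabs b < cabs a ->
  circle_int (fun t => ln (cabs (a + b * expi t))) = pi *+ 2 * ln (cabs a).
Proof.
move=> ba; rewrite -(@circle_int_ln_cabsB a (- b)) ?cabsN //.
by apply: eq_seg_int => t _; rewrite mulNr opprK.
Qed.

Lemma continuous_affine_circle (a b : R[i]) : continuous (fun t : R => a + b * expi t : C).
Proof.
move=> t; apply: (@cvgD _ C); first exact: cvg_cst.
by apply: (@cvgM R[i]); [exact: cvg_cst|exact: expi_continuous].
Qed.

End JensenLinear.

(** * The maximum principle for upper semicontinuous functions *)

Section MaximumPrinciple.
Variable R : realType.
Local Notation C := ((R[i])^o).
Notation mu := (@lebesgue_measure R).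

(* Unlike [le_integral] and [ge0_le_integral], no measurability is required. *)
Lemma le_integral_nomeas d (T : measurableType d) (nu : {measure set T -> \bar R})
    (D : set T) (f g : T -> \bar R) :
  (forall x, D x -> (f x <= g x)%E) ->
  (\int[nu]_(x in D) f x <= \int[nu]_(x in D) g x)%E.
Proof.
move=> fg.
have ge0_mono (f' g' : T -> \bar R) : (forall x, (0 <= f' x)%E) ->
    (forall x, (f' x <= g' x)%E) -> (\int[nu]_x f' x <= \int[nu]_x g' x)%E.
  move=> f0 f'g'; rewrite !ge0_integralTE //; last first.
    by move=> x; exact: le_trans (f0 x) (f'g' x).
  by apply: le_ereal_sup => _ [h hf <-]; exists h => // x; exact: le_trans (hf x) (f'g' x).
rewrite (integral_mkcond D f) (integral_mkcond D g).
have fgD x : ((f \_ D) x <= (g \_ D) x)%E.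
  by rewrite /patch; case: ifPn => // /set_mem; exact: fg.
rewrite integralE [leRHS]integralE; apply: leeB; apply: ge0_mono => x.
- exact: funepos_ge0.
- by rewrite !funeposE ge_max !le_max lexx orbT fgD.
- exact: funeneg_ge0.
- by rewrite !funenegE ge_max !le_max lexx orbT leeN2 fgD.
Qed.

Lemma integral_seg_int (f : R -> R) a b : continuous_on_seg f a b ->
  (\int[mu]_(t in `[a, b]) (f t)%:E)%E = (seg_int f a b)%:E.
Proof.
move=> cf; rewrite /seg_int /Rintegral fineK //.
exact/integrable_fin_num/continuous_on_seg_integrable.
Qed.

(** If the supremum S were not attained, every point would have a neighbourhood on which F stays
    below some level t < S. Compactness, in its near-covering form along the filter [G] of levels
    tending to S from below, gives one level for all of K, a contradiction. *)
Lemma usc_attains_max (T : topologicalType) (K : set T) (F : T -> \bar R) :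
  compact K -> K !=set0 ->
  (forall x, K x -> forall t : R, (F x < t%:E)%E -> \forall y \near x, (F y < t%:E)%E) ->
  exists2 x, K x & (F x = +oo)%E \/ forall y, K y -> (F y <= F x)%E.
Proof.
move=> /compact_near_coveringP cK [x0 Kx0] uscF.
apply: contrapT => noMax.
pose S := ereal_sup (F @` K).
have FS x : K x -> (F x < S)%E.
  move=> Kx; rewrite ltNge; apply/negP => SF; apply: noMax; exists x => //; right=> y Ky.
  by apply: le_trans SF; apply: ereal_sup_ubound; exists y.
have [t FSt] : exists2 t : R, (t%:E < S)%E & forall x, K x -> (F x < t%:E)%E.
  have Sny : (-oo < S)%E by rewrite (le_lt_trans _ (FS _ Kx0)) // leNye.
  have [r0 r0S] : exists r0 : R, (r0%:E < S)%E.
    move: Sny; case: (S) => [s _| _|//]; last by exists 0; exact: ltry.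
    by exists (s - 1); rewrite lte_fin ltrBlDr ltrDl.
  pose G := [set A : set R | exists2 r : R, (r%:E < S)%E & forall t, r <= t -> (t%:E < S)%E -> A t].
  have FG : Filter G.
    split=> [|A B [r rS rA] [s sS sB]|A B AB [r rS rA]].
    - by exists r0.
    - exists (Num.max r s); first by case: (leP r s).
      by move=> t; rewrite ge_max => /andP[rt st] tS; split; [exact: rA|exact: sB].
    - by exists r => // t rt tS; exact/AB/rA.
  have := cK R G (fun t x => (F x < t%:E)%E) FG.
  case=> [x Kx|r rS /(_ r (lexx r) rS) rP]; last by exists r.
  have [t tS Ft] : exists2 t : R, (t%:E < S)%E & (F x < t%:E)%E.
    have := FS x Kx; case: (F x) => [f| |] //.
      move: Sny; case: (S) => [s _| _|//].
        by rewrite lte_fin => fs; exists ((f + s) / 2); rewrite lte_fin; lra.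
      by exists (f + 1); rewrite ?ltry // lte_fin ltrDl.
      by rewrite ltNge leey.
    by move=> _; exists r0 => //; exact: ltNyr.
  exists ([set y | (F y < t%:E)%E], [set s | t <= s]).
    by split; [exact: uscF|exists t].
  by move=> [y s] /= [Fy ts]; apply: (lt_le_trans Fy); rewrite lee_fin.
move=> FSt'; have : (S <= t%:E)%E.
  by apply: ge_ereal_sup => _ [x Kx <-]; exact/ltW/FSt'.
by rewrite leNgt FSt.
Qed.

(* [u - q] cannot have a positive maximum at a point of the second kind. *)
Lemma comparison_principle (T : topologicalType) (K : set T) (u : T -> \bar R) (q : T -> R) :
  compact K ->
  (forall x, K x -> (u x < +oo)%E) ->
  (forall x, K x -> forall t : R, (u x < t%:E)%E -> \forall y \near x, (u y < t%:E)%E) ->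
  (forall x, K x -> {for x, continuous q}) ->
  (forall x, K x -> (u x <= (q x)%:E)%E \/ exists g : R -> T,
     [/\ forall t, 0 <= t <= pi *+ 2 -> K (g t),
         continuous_on_seg (q \o g) 0 (pi *+ 2),
         (u x <= ((pi *+ 2)^-1)%:E * \int[mu]_(t in `[0%R, (pi *+ 2)%R]) u (g t))%E &
         circle_int (q \o g) < pi *+ 2 * q x]) ->
  forall x, K x -> (u x <= (q x)%:E)%E.
Proof.
move=> cK uoo uscu cq H x Kx; rewrite leNgt; apply/negP => qu.
have p2 := pi2_gt0 R.
pose F y := (u y - (q y)%:E)%E.
have Foo y : K y -> (F y < +oo)%E.
  by move=> /uoo; rewrite /F; case: (u y) => [r| |] //= _; rewrite ?ltry.
have [||x0 Kx0 maxF] := @usc_attains_max T K F cK; first by exists x.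
  move=> y Ky t; rewrite /F lteBlDr // -EFinD => uy.
  have [s us st] : exists2 s : R, (u y < s%:E)%E & s < t + q y.
    move: uy; case: (u y) => [r| |] //.
      by rewrite lte_fin => rt; exists ((r + (t + q y)) / 2); rewrite ?lte_fin; lra.
    by move=> _; exists (t + q y - 1); rewrite ?ltNyr //; lra.
  have [e e0 eE] : exists2 e, 0 < e & s + e = t + q y.
    by exists (t + q y - s); [rewrite subr_gt0|rewrite addrC subrK].
  near=> z; rewrite lteBlDr // -EFinD.
  have uz : (u z < s%:E)%E by near: z; exact: uscu.
  apply: (lt_trans uz); rewrite lte_fin.
  have : `|q y - q z| < e.
    by near: z; apply: (iffLR (@cvgrPdist_lt _ R^o _ _ (nbhs_filter y) _ _) (cq y Ky)).
  rewrite ltr_norml => /andP[_ ?]; lra.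
case: maxF => [F0|maxF]; first by have := Foo _ Kx0; rewrite F0 ltxx.
have F0 : (0 < F x0)%E.
  by apply: lt_le_trans (maxF _ Kx); rewrite /F sube_gt0.
have [m m0 FE] : exists2 m : R, 0 < m & F x0 = m%:E.
  by have := Foo _ Kx0; move: F0; case: (F x0) => [m| |] //; rewrite lte_fin; exists m.
have uE : u x0 = (q x0 + m)%:E.
  move: FE; rewrite /F; case: (u x0) => [r| |] //= [].
  by move=> <-; congr EFin; ring.
case: (H x0 Kx0); first by rewrite uE lee_fin leNgt ltrDl m0.
move=> [g [Kg cqg]]; rewrite uE => um qm.
have cm : continuous_on_seg (cst m) 0 (pi *+ 2) by move=> t _; exact: cst_continuous.
(* At the maximum point [x0] of u - q, with value m, u is at most q + m along the circle;
   integrating contradicts the strict inequality between q at the centre and its circle mean. *)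
have : (\int[mu]_(t in `[0%R, (pi *+ 2)%R]) u (g t) <=
    \int[mu]_(t in `[0%R, (pi *+ 2)%R]) ((q \o g) t + cst m t)%:E)%E.
  apply: le_integral_nomeas => t; rewrite /= in_itv /= => /Kg Kgt.
  by have := maxF _ Kgt; rewrite FE /F leeBlDr // -EFinD addrC.
rewrite integral_seg_int; last by move=> t t2; apply: continuousD; [exact: cqg|exact: cm].
rewrite seg_intD // seg_int_cst ?(ltW p2) // subr0 => ui.
have := le_trans um (lee_wpmul2l _ ui).
rewrite lee_fin invr_ge0 (ltW p2) => /(_ isT).
rewrite -EFinM lee_fin leNgt => /negP; apply.
rewrite -[_ \o _]/(q \o g) mulrDr (mulrC m) mulKf ?gt_eqF // ltrD2r.
by rewrite ltr_pdivrMl.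
Unshelve. all: by end_near. Qed.

End MaximumPrinciple.

Lemma continuous_lincomb (R : realType) (T : topologicalType) (x : T) (J : Type)
    (r : seq J) (P : pred J) (c : J -> R) (f : J -> T -> R) :
  (forall j, P j -> {for x, continuous (f j)}) ->
  {for x, continuous (fun t => \sum_(j <- r | P j) c j * f j t)}.
Proof.
move=> cf.
change ((fun t => \sum_(j <- r | P j) c j * f j t) @ x --> \sum_(j <- r | P j) c j * f j x).
elim: r => [|j r IHr].
  by under eq_fun do rewrite big_nil; rewrite big_nil; exact: cvg_cst.
under eq_fun do rewrite big_cons; rewrite big_cons; case: ifPn => // Pj.
by apply: cvgD => //; apply: cvgMr; exact: cf.
Qed.

(** * Moebius maps and the logarithm of a finite Blaschke product *)

Section Mobius.
Variable R : realType.
Local Notation C := ((R[i])^o).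
Implicit Types a z : R[i].

Lemma mobius_den_neq0 a z : cabs a < 1 -> cabs z <= 1 -> 1 - a^* * z != 0.
Proof.
move=> a1 z1; apply/eqP => /eqP; rewrite subr_eq0 => /eqP h.
have := congr1 (@cabs R) h; rewrite cabs1 cabsM cabs_conj => h1.
have : cabs a * cabs z <= cabs a * 1 by rewrite ler_wpM2l ?cabs_ge0.
rewrite -h1; lra.
Qed.

Lemma mobius_normE a z :
  cabs (1 - a^* * z) ^+ 2 - cabs (a - z) ^+ 2 = (1 - cabs a ^+ 2) * (1 - cabs z ^+ 2).
Proof.
rewrite !sqr_cabs conjE; case: a z => [a1 a2] [z1 z2] /=; ring.
Qed.

Lemma cabs_mobius a z : cabs (mobius a z) = cabs (a - z) / cabs (1 - a^* * z).
Proof. by rewrite /mobius cabsM cabsV. Qed.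

Lemma cabs_mobius_lt1 a z : cabs a < 1 -> cabs z < 1 -> cabs (mobius a z) < 1.
Proof.
move=> a1 z1; have d0 : 0 < cabs (1 - a^* * z) by rewrite cabs_gt0 mobius_den_neq0 ?ltW.
rewrite cabs_mobius ltr_pdivrMr // mul1r -(@ltr_pXn2r _ 2) ?nnegrE ?cabs_ge0 //.
rewrite -subr_gt0 mobius_normE mulr_gt0 // subr_gt0 -[ltRHS](expr1n _ 2);
  by rewrite ltr_pXn2r ?nnegrE ?cabs_ge0.
Qed.

Lemma mobius_eq0 a z : cabs a < 1 -> cabs z < 1 -> (mobius a z == 0) = (z == a).
Proof.
move=> a1 z1; rewrite mulf_eq0 invr_eq0 (negbTE (mobius_den_neq0 a1 (ltW z1))) orbF.
by rewrite subr_eq0 eq_sym.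
Qed.

Lemma mobius0 a : mobius a 0 = a.
Proof. by rewrite /mobius mulr0 !subr0 divr1. Qed.

Lemma conj_mul_cabs a : a^* * a = (cabs a ^+ 2)%:C%C.
Proof. by rewrite mulrC mul_conj. Qed.

Lemma mobiusK a z : cabs a < 1 -> cabs z < 1 -> mobius a (mobius a z) = z.
Proof.
move=> a1 z1; have d0 := mobius_den_neq0 a1 (ltW z1).
have da : 1 - a^* * a != 0 by rewrite mobius_den_neq0 // ltW.
have den : 1 - a^* * mobius a z = (1 - a^* * a) / (1 - a^* * z).
  by rewrite /mobius; field.
rewrite {1}/mobius den /mobius; field.
by rewrite d0 da.
Qed.

Lemma cabs_mobiusC a z : cabs (mobius a z) = cabs (mobius z a).
Proof.
rewrite !cabs_mobius (cabsB a z); congr (_ / _).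
by rewrite -[LHS]cabs_conj !conjE rmorphB rmorph1 rmorphM /= conjcK mulrC.
Qed.

Lemma derivable_mobius a z : cabs a < 1 -> cabs z < 1 ->
  derivable (mobius a : C -> C) (z : C) (1 : C).
Proof.
move=> a1 z1; apply: derivableM.
  by apply: derivableB; [exact: derivable_cst|exact: derivable_id].
apply: derivableV; first exact: mobius_den_neq0 (ltW z1).
apply: derivableB; first exact: derivable_cst.
by apply: derivableM; [exact: derivable_cst|exact: derivable_id].
Qed.

Lemma mobius_continuous a z : cabs a < 1 -> cabs z < 1 ->
  {for (z : C), continuous (mobius a : C -> C)}.
Proof. by move=> a1 z1; apply: derivable_continuous_C; exact: derivable_mobius. Qed.

Variables (I : finType) (a : I -> R[i]) (m : I -> nat).
Hypothesis a1 : forall j, cabs (a j) < 1.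

(** A real-valued version of log|B|. As [ln] is 0 at 0, it represents log|B| only away from the
    points [a j]. *)
Definition blaschke_ln (z : R[i]) : R := \sum_j (m j)%:R * ln (cabs (mobius (a j) z)).

Definition blaschke (z : R[i]) : R[i] := \prod_j mobius (a j) z ^+ m j.

Lemma blaschke_neq0 z : cabs z < 1 -> (forall j, z != a j) -> blaschke z != 0.
Proof.
move=> z1 za; apply/prodf_neq0 => j _; rewrite expf_neq0 // mobius_eq0 //; exact: za.
Qed.


Lemma expR_blaschke_ln z : cabs z < 1 -> (forall j, z != a j) ->
  expR (blaschke_ln z) = cabs (blaschke z).
Proof.
move=> z1 za; rewrite /blaschke /blaschke_ln cabs_prod expR_sum.
apply: eq_bigr => j _; rewrite expRM_natl lnK ?cabsX // posrE.
by rewrite cabs_gt0 mobius_eq0 // za.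
Qed.

Lemma blaschke_ln_le0 z : cabs z < 1 -> blaschke_ln z <= 0.
Proof.
move=> z1; apply: sumr_le0 => j _; rewrite mulr_ge0_le0 //.
by rewrite -(ln1 R) ; case: (ltP 0 (cabs (mobius (a j) z))) => [h|h];
  [rewrite ler_ln ?posrE // ltW // cabs_mobius_lt1|rewrite ln1 ln0].
Qed.

Lemma blaschke_ln_continuous z : cabs z < 1 -> (forall j, z != a j) ->
  {for (z : C), continuous (blaschke_ln : C -> R)}.
Proof.
move=> z1 za; apply: (@continuous_lincomb R C) => j _.
apply: (@ln_cabs_continuous R C (mobius (a j))); first exact: mobius_continuous.
by rewrite mobius_eq0 // za.
Qed.

(** log|B| is harmonic off its zeros: for each factor, Jensen's formula is applied to the numerator
    and to the denominator, neither of which vanishes in the closed disc. *)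
Lemma circle_int_blaschke_ln (z : R[i]) (r : R) : 0 <= r -> cabs z + r < 1 ->
  (forall j, r < cabs (z - a j)) ->
  circle_int (fun t => blaschke_ln (z + r%:C%C * expi t)) = pi *+ 2 * blaschke_ln z.
Proof.
move=> r0 zr ra; have p2 := pi2_gt0 R.
have z1 : cabs z < 1 by rewrite (le_lt_trans _ zr) // lerDl.
have cr : cabs r%:C%C = r by rewrite cabs_real ger0_norm.
have zt1 t : cabs (z + r%:C%C * expi t) < 1.
  by rewrite (le_lt_trans (cabsD _ _)) // cabsM cabs_expi mulr1 cr.
have zta j t : z + r%:C%C * expi t != a j.
  apply/eqP => h; have := ra j; rewrite -h opprD addNKr cabsN cabsM cabs_expi.
  by rewrite mulr1 cr ltxx.
have cza t : {for t, continuous (fun t => z + r%:C%C * expi t : C)}.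
  exact: continuous_affine_circle.
have cj j : continuous (fun t => ln (cabs (mobius (a j) (z + r%:C%C * expi t)))).
  move=> t; apply: (@ln_cabs_continuous R R (fun t => mobius (a j) (z + r%:C%C * expi t)));
    last by rewrite mobius_eq0 // zta.
  apply: (@continuous_comp R C C (fun t => z + r%:C%C * expi t) (mobius (a j))) => //.
  exact: mobius_continuous.
have one j : circle_int (fun t => ln (cabs (mobius (a j) (z + r%:C%C * expi t)))) =
    pi *+ 2 * ln (cabs (mobius (a j) z)).
  have nz : 0 < cabs (a j - z) by rewrite cabsB (le_lt_trans r0).
  have dz : 0 < cabs (1 - (a j)^* * z) by rewrite cabs_gt0 mobius_den_neq0 ?ltW.
  have d1 : cabs ((a j)^* * r%:C%C) < cabs (1 - (a j)^* * z).
    have h1 := cabsD (1 - (a j)^* * z) ((a j)^* * z).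
    move: h1; rewrite subrK cabs1 !cabsM cabs_conj cr.
    have : cabs (a j) * (cabs z + r) < 1 * 1.
      by apply: ltr_pM => //; rewrite ?cabs_ge0 // addr_ge0 // cabs_ge0.
    rewrite mulrDr; lra.
  have d2 : cabs r%:C%C < cabs (a j - z) by rewrite cr cabsB.
  rewrite cabs_mobius ln_div ?posrE // mulrBr -(circle_int_ln_cabsB d1) -(circle_int_ln_cabsB d2).
  have cl (al be : R[i]) : cabs be < cabs al ->
      continuous_on_seg (fun t => ln (cabs (al - be * expi t))) 0 (pi *+ 2).
    move=> ba t _; apply: ln_cabs_continuous.
      apply: (@cvgB _ C); first exact: cvg_cst.
      by apply: (@cvgM R[i]); [exact: cvg_cst|exact: expi_continuous].
    apply/eqP => /eqP; rewrite subr_eq0 => /eqP h; move: ba.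
    by rewrite h cabsM cabs_expi mulr1 ltxx.
  rewrite -[RHS]seg_intB; [|exact: cl|exact: cl].
  apply: eq_seg_int => t _; rewrite cabs_mobius ln_div ?posrE ?cabs_gt0.
  - by congr (ln (cabs _) - ln (cabs _)); ring.
  - by rewrite subr_eq0 eq_sym.
  - by rewrite mobius_den_neq0 // ltW.
have H : forall s : seq I, continuous (fun t => \sum_(j <- s) (m j)%:R *
      ln (cabs (mobius (a j) (z + r%:C%C * expi t)))) /\
    circle_int (fun t => \sum_(j <- s) (m j)%:R *
      ln (cabs (mobius (a j) (z + r%:C%C * expi t)))) =
    pi *+ 2 * \sum_(j <- s) (m j)%:R * ln (cabs (mobius (a j) z)).
  elim=> [|j s [cs IHs]].
    split; first by under eq_fun do rewrite big_nil; exact: cst_continuous.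
    under eq_fun do rewrite big_nil.
    by rewrite big_nil mulr0 /circle_int seg_int_cst ?mul0r ?(ltW p2).
  have cm : continuous (fun t => (m j)%:R * ln (cabs (mobius (a j) (z + r%:C%C * expi t)))).
    by move=> t; apply: cvgMr; exact: cj.
  split; first by under eq_fun do rewrite big_cons; move=> t; apply: cvgD; [exact: cm|exact: cs].
  under eq_fun do rewrite big_cons.
  rewrite /circle_int seg_intD; [|by move=> t _; exact: cm|by move=> t _; exact: cs].
  rewrite -[X in _ + X]/(circle_int _) IHs seg_intZ; last by move=> t _; exact: cj.
  rewrite -[X in _ * X + _]/(circle_int _) one big_cons; ring.
by have [_] := H (index_enum I).
Qed.

(** Every Moebius factor has modulus tending to 1 at the unit circle. Each term, weighted by the
    number of factors, is kept above -eta, and the estimates are averaged. *)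
Lemma blaschke_ln_boundary (eta : R) : 0 < eta -> exists2 rho, rho < 1 &
  forall z, rho <= cabs z < 1 -> - eta <= blaschke_ln z.
Proof.
move=> eta0.
have one j : exists2 rho, rho < 1 & forall z, rho <= cabs z < 1 ->
    - eta <= ((m j)%:R * #|I|%:R) * ln (cabs (mobius (a j) z)).
  pose k : R := (m j)%:R * #|I|%:R.
  have k0 : 0 <= k by rewrite mulr_ge0.
  pose b := expR (- (eta / (k + 1))).
  have ek : 0 < eta / (k + 1) by rewrite divr_gt0 // ltr_wpDl.
  have b0 : 0 < b by exact: expR_gt0.
  have b1 : b < 1 by rewrite expR_lt1 oppr_lt0.
  pose A := cabs (a j); have A0 : 0 <= A := cabs_ge0 _; have A1 : A < 1 := a1 j.
  (* By [mobius_normE], the Moebius factor has modulus at least [b] as soon as (1 - |a|^2)(1 -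
     |z|^2) <= (1 - b^2)|1 - conj(a) z|^2, whose right side is at least [c]. *)
  pose c := (1 - b ^+ 2) * (1 - A) ^+ 2.
  have c0 : 0 < c.
    rewrite mulr_gt0 ?exprn_gt0 ?subr_gt0 // -[ltRHS](expr1n _ 2).
    by rewrite ltr_pXn2r ?nnegrE // ltW.
  pose rho := 1 - Num.min (c / 4) (1 / 2).
  have rho0 : 1 / 2 <= rho by have : Num.min (c / 4) (1 / 2) <= 1 / 2; [rewrite ge_min lexx orbT|rewrite /rho; lra].
  have rhoc : 1 - rho <= c / 4 by have : Num.min (c / 4) (1 / 2) <= c / 4; [rewrite ge_min lexx|rewrite /rho; lra].
  exists rho.
    by have : 0 < Num.min (c / 4) (1 / 2); [rewrite lt_min; apply/andP; split; lra|rewrite /rho; lra].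
  move=> z /andP[rz z1].
  have den : 1 - A <= cabs (1 - (a j)^* * z).
    have := cabsD (1 - (a j)^* * z) ((a j)^* * z); rewrite subrK cabs1 cabsM cabs_conj.
    have : A * cabs z <= A * 1 by rewrite ler_wpM2l // ltW.
    rewrite /A; lra.
  have den0 : 0 < cabs (1 - (a j)^* * z) by rewrite (lt_le_trans _ den) // subr_gt0.
  have bm : b <= cabs (mobius (a j) z).
    rewrite cabs_mobius ler_pdivlMr // -(@ler_pXn2r _ 2) ?nnegrE ?mulr_ge0 ?cabs_ge0 ?(ltW b0) //.
    have E := mobius_normE (a j) z.
    have h1 : (1 - cabs (a j) ^+ 2) * (1 - cabs z ^+ 2) <= 2 * (1 - rho).
      have hz : 1 - cabs z ^+ 2 <= 2 * (1 - rho).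
        have -> : 1 - cabs z ^+ 2 = (1 - cabs z) * (1 + cabs z) by ring.
        rewrite mulrC ler_pM //; have := cabs_ge0 z; lra.
      have hz0 : 0 <= 1 - cabs z ^+ 2.
        by rewrite subr_ge0 -[leRHS](expr1n _ 2) ler_pXn2r ?nnegrE ?cabs_ge0 // ltW.
      apply: le_trans hz; rewrite ler_piMl //.
      by rewrite gerBl sqr_ge0.
    have h2 : c <= (1 - b ^+ 2) * cabs (1 - (a j)^* * z) ^+ 2.
      apply: ler_wpM2l; last first.
        by rewrite ler_pXn2r ?nnegrE ?subr_ge0 ?cabs_ge0 // ltW.
      by rewrite subr_ge0 -[leRHS](expr1n _ 2) ler_pXn2r ?nnegrE ?(ltW b0) // ltW.
    move: h2; rewrite mulrBl mul1r exprMn; lra.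
  have lb : - (eta / (k + 1)) <= ln (cabs (mobius (a j) z)).
    by rewrite -(expRK (- (eta / (k + 1)))) ler_ln ?posrE // (lt_le_trans b0).
  rewrite -/k; have := ler_wpM2l k0 lb; apply: le_trans.
  rewrite mulrN lerN2 mulrA ler_pdivrMr ?ltr_wpDl // mulrDr mulr1 mulrC lerDl; exact: ltW.
have /choice[rho rhoP] : forall j, exists rho, rho < 1 /\ forall z, rho <= cabs z < 1 ->
    - eta <= ((m j)%:R * #|I|%:R) * ln (cabs (mobius (a j) z)).
  by move=> j; have [rho r1 rP] := one j; exists rho.
exists (\big[Num.max/0]_j rho j).
  by apply: (big_ind (fun x => x < 1)) => // [x y x1 y1|j _]; [rewrite gt_max x1|have [] := rhoP j].
move=> z /andP[zr z1].
have lej j : rho j <= cabs z by apply: le_trans zr; exact: le_bigmax.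
have sum_ge : \sum_(j : I) - eta <= \sum_(j : I) ((m j)%:R * #|I|%:R) * ln (cabs (mobius (a j) z)).
  apply: ler_sum => j _; have [_ H] := rhoP j. by apply: H; rewrite lej.
have [I0|I0] := posnP #|I|.
  rewrite /blaschke_ln big_pred0 ?oppr_le0 ?(ltW eta0) // => j.
  by have /card0_eq /(_ j) := I0; rewrite !inE.
have I0' : 0 < #|I|%:R :> R by rewrite ltr0n.
rewrite -(ler_pM2l I0') /blaschke_ln mulr_sumr.
have E : \sum_(j : I) - eta = #|I|%:R * - eta.
  by rewrite sumr_const mulr_natl; congr (_ *+ _); exact: eq_card.
move: sum_ge; rewrite E => sum_ge; apply: (le_trans sum_ge).
by rewrite le_eqVlt; apply/orP; left; apply/eqP; apply: eq_bigr => j _; ring.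
Qed.

(** The divergence of log|B| to -oo at [a j]: a small multiple of it absorbs any constant near a
    pole. *)
Lemma blaschke_ln_pole_le (K : R) j : (0 < m j)%N -> exists2 d, 0 < d &
  forall z, cabs z < 1 -> 0 < cabs (z - a j) < d -> blaschke_ln z <= K.
Proof.
move=> mj; have A1 := a1 j.
exists (expR K * (1 - cabs (a j))); first by rewrite mulr_gt0 ?expR_gt0 ?subr_gt0.
move=> z z1 /andP[za zd]; rewrite /blaschke_ln (bigD1 j) //=.
have others : \sum_(i | i != j) (m i)%:R * ln (cabs (mobius (a i) z)) <= 0.
  apply: sumr_le0 => i _; rewrite mulr_ge0_le0 // -(ln1 R).
  by case: (ltP 0 (cabs (mobius (a i) z))) => [h|h];
    [rewrite ler_ln ?posrE // ltW // cabs_mobius_lt1|rewrite ln1 ln0].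
have den : 1 - cabs (a j) <= cabs (1 - (a j)^* * z).
  have := cabsD (1 - (a j)^* * z) ((a j)^* * z); rewrite subrK cabs1 cabsM cabs_conj.
  have : cabs (a j) * cabs z <= cabs (a j) * 1 by rewrite ler_wpM2l ?cabs_ge0 // ltW.
  lra.
have den0 : 0 < cabs (1 - (a j)^* * z) by rewrite (lt_le_trans _ den) // subr_gt0.
have mob0 : 0 < cabs (mobius (a j) z) by rewrite cabs_mobius divr_gt0 // cabsB.
have lmj : ln (cabs (mobius (a j) z)) <= K.
  rewrite -(expRK K) ler_ln ?posrE ?expR_gt0 // cabs_mobius ler_pdivrMr //.
  by rewrite cabsB (le_trans (ltW zd)) // ler_wpM2l ?expR_ge0.
have lm0 : ln (cabs (mobius (a j) z)) <= 0 by rewrite -(ln1 R) ler_ln ?posrE // ltW // cabs_mobius_lt1.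
rewrite -[leRHS]addr0 lerD //; apply: le_trans lmj.
by rewrite ler_neMl // ler1n.
Qed.

(** The other factors are nonzero at [a j], by injectivity, so they change log|B| only by a bounded
    amount near that point. *)
Lemma blaschke_ln_pole_ge j : injective a -> exists c : R, exists2 d, 0 < d &
  forall z, cabs z < 1 -> 0 < cabs (z - a j) < d ->
    (m j)%:R * ln (cabs (z - a j)) - c <= blaschke_ln z.
Proof.
move=> ainj; pose g z := \sum_(i | i != j) (m i)%:R * ln (cabs (mobius (a i) z)).
have cg : {for (a j : C), continuous (g : C -> R)}.
  apply: (@continuous_lincomb R C) => i ij.
  apply: (@ln_cabs_continuous R C (mobius (a i))); first exact: mobius_continuous.
  by rewrite mobius_eq0 // (inj_eq ainj) eq_sym.
have := iffLR (@cvgrPdist_lt _ R^o _ _ (nbhs_filter (a j : C)) _ _) cg _ ltr01.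
move=> /nbhs_cabsP[d d0 dP].
exists ((m j)%:R * ln 2 + 1 - g (a j)); exists d => // z z1 /andP[za zd].
have := dP _ zd; rewrite ltr_norml => /andP[_ gz].
rewrite /blaschke_ln (bigD1 j) //= -/(g z).
have den0 : 0 < cabs (1 - (a j)^* * z) by rewrite cabs_gt0 mobius_den_neq0 // ltW.
have den2 : cabs (1 - (a j)^* * z) <= 2.
  have := cabsD 1 (- ((a j)^* * z)); rewrite cabsN cabs1 cabsM cabs_conj.
  have : cabs (a j) * cabs z <= 1 * 1 by rewrite ler_pM ?cabs_ge0 // ltW.
  lra.
rewrite cabs_mobius ln_div ?posrE ?(cabsB (a j)) // mulrBr.
have : (m j)%:R * ln (cabs (1 - (a j)^* * z)) <= (m j)%:R * ln 2.
  by rewrite ler_wpM2l // ler_ln ?posrE.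
lra.
Qed.

End Mobius.

(** * Comparison with multiples of log|B| over the unit disc *)

Section DiscComparison.
Variable R : realType.
Local Notation C := ((R[i])^o).
Notation mu := (@lebesgue_measure R).

Lemma closed_cabs_le (rho : R) : closed [set z : C | cabs z <= rho].
Proof.
apply: (@preimage_closed C R (@cabs R) [set x | x <= rho]); last exact: closed_le.
by move=> x _; exact: cabs_continuous.
Qed.

Lemma closed_cabsB_ge (c : R[i]) (sig : R) : closed [set z : C | sig <= cabs (z - c)].
Proof.
apply: (@preimage_closed C R (fun z => cabs (z - c)) [set x | sig <= x]); last exact: closed_ge.
move=> x _; apply: (@continuous_comp C C R (fun z => z - c) (@cabs R)).
  apply: derivable_continuous_C.
  by apply: derivableB; [exact: derivable_id|exact: derivable_cst].
exact: cabs_continuous.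
Qed.

Lemma compact_cabs_le (rho : R) : compact [set z : C | cabs z <= rho].
Proof.
pose f (x : R * R) : C := Complex x.1 x.2.
apply: (@subclosed_compact C _ [set f x | x in `[- rho, rho] `*` `[- rho, rho]]).
- exact: closed_cabs_le.
- apply: continuous_compact; last by apply: compact_setX; exact: segment_compact.
  by apply: continuous_subspaceT => x; apply: cvg_complex; [exact: cvg_fst|exact: cvg_snd].
- move=> z /= zr; exists (complex.Re z, complex.Im z); last by case: z {zr}.
  by split; rewrite /= in_itv /= -ler_norml (le_trans _ zr) // ?Re_le_cabs ?Im_le_cabs.
Qed.

Lemma circle_int_Re_expi (c : R[i]) : circle_int (fun t => complex.Re (c * expi t)) = 0.
Proof.
have cF : continuous (fun t : R => complex.Re (c * expi t)).
  move=> t; apply: (@continuous_comp R C R (fun t => c * expi t) (@complex.Re R)).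
    by apply: (@cvgM R[i]); [exact: cvg_cst|exact: expi_continuous].
  exact: Re_continuous.
have := @circle_int_rotation R _ pi cF.
have -> : (fun t => complex.Re (c * expi (t + pi))) = (fun t => -1 * complex.Re (c * expi t)).
  by apply/funext => t; rewrite expiD expi_pi mulrN1 mulrN Re_opp mulN1r.
rewrite /circle_int seg_intZ => [H|t _]; last exact: cF.
have : -1 * seg_int (fun t => complex.Re (c * expi t)) 0 (pi *+ 2) =
    seg_int (fun t => complex.Re (c * expi t)) 0 (pi *+ 2).
  apply: H => [t|]; first by rewrite expi_2pi.
  by rewrite pi_ge0 /= mulr2n lerDl pi_ge0.
lra.
Qed.

(** The gain r^2 is what makes [- eps * |p x| ^ 2] strictly superharmonic in the comparison
    below. *)
Lemma circle_int_sqr_cabs (z : R[i]) (r : R) :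
  circle_int (fun t => cabs (z + r%:C%C * expi t) ^+ 2) = pi *+ 2 * (cabs z ^+ 2 + r ^+ 2).
Proof.
have E t : cabs (z + r%:C%C * expi t) ^+ 2 =
    cabs z ^+ 2 + r ^+ 2 + complex.Re (2%:R%:C%C * r%:C%C * z^* * expi t).
  rewrite !sqr_cabs !conjE ?(Re_add, Im_add, Re_mul, Im_mul); case: z => x y /=.
  apply/subr0_eq; transitivity (r ^+ 2 * (cos t ^+ 2 + sin t ^+ 2 - 1)); first by ring.
  by rewrite cos2Dsin2 subrr mulr0.
rewrite /circle_int; under eq_fun do rewrite E.
have cc : continuous_on_seg (fun t => complex.Re (2%:R%:C%C * r%:C%C * z^* * expi t)) 0 (pi *+ 2).
  move=> t _; apply: (@continuous_comp R C R (fun t => 2%:R%:C%C * r%:C%C * z^* * expi t) (@complex.Re R)).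
    by apply: (@cvgM R[i]); [exact: cvg_cst|exact: expi_continuous].
  exact: Re_continuous.
rewrite (@seg_intD _ (cst (cabs z ^+ 2 + r ^+ 2))) //; last by move=> t _; exact: cst_continuous.
rewrite -[X in _ + X]/(circle_int _) circle_int_Re_expi addr0.
by rewrite seg_int_cst ?(ltW (pi2_gt0 R)) // subr0 mulrC.
Qed.

Variables (I : finType) (a : I -> R[i]) (m : I -> nat).
Hypothesis a1 : forall j, cabs (a j) < 1.
Local Notation lnB := (blaschke_ln a m).

Lemma lt_bigmin (x y : R) (f : I -> R) : x < y -> (forall j, x < f j) ->
  x < \big[Num.min/y]_j f j.
Proof.
by move=> xy xf; apply: (big_ind (fun z => x < z)) => // u v xu xv; rewrite lt_min xu.
Qed.

(* [T] is fibred over the disc by [p]; the extra term [pen] is only required to be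
   subharmonic up to [O(r ^ 4)], which the perturbation [- eps * |p x| ^ 2] absorbs. *)
Lemma disc_comparison (T : topologicalType) (p : T -> R[i]) (X : set T)
    (v : T -> \bar R) (pen : T -> R) (c1 c2 : R)
    (bound := fun x => c1 + c2 * lnB (p x) + pen x) :
  (forall rho sig, rho < 1 -> 0 < sig ->
     compact [set x | [/\ X x, cabs (p x) <= rho & forall j, sig <= cabs (p x - a j)]]) ->
  (forall x, X x -> cabs (p x) < 1 -> (v x < +oo)%E) ->
  (forall x, X x -> cabs (p x) < 1 -> forall t : R, (v x < t%:E)%E ->
     \forall y \near x, (v y < t%:E)%E) ->
  continuous (p : T -> C) ->
  (forall x, X x -> cabs (p x) < 1 -> {for x, continuous pen}) ->
  (exists2 rho, rho < 1 & forall x, X x -> rho <= cabs (p x) < 1 -> (v x <= (bound x)%:E)%E) ->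
  (forall j, exists2 d, 0 < d & forall x, X x -> cabs (p x) < 1 ->
     0 < cabs (p x - a j) < d -> (v x <= (bound x)%:E)%E) ->
  (forall x, X x -> cabs (p x) < 1 -> (forall j, p x != a j) -> (v x <= (bound x)%:E)%E \/
     exists r0 c : R, 0 < r0 /\ forall r, 0 < r < r0 -> exists g : R -> T,
       [/\ forall t, X (g t), forall t, p (g t) = p x + r%:C%C * expi t,
           continuous (pen \o g),
           (v x <= ((pi *+ 2)^-1)%:E * \int[mu]_(t in `[0%R, (pi *+ 2)%R]) v (g t))%E &
           circle_int (pen \o g) <= pi *+ 2 * (pen x + c * r ^+ 4)]) ->
  forall x, X x -> cabs (p x) < 1 -> (forall j, p x != a j) -> (v x <= (bound x)%:E)%E.
Proof.
move=> cK voo uscv cp cpen [rho0 rho01 outer] poles inner x Xx px1 pxa.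
have p2 := pi2_gt0 R.
apply/lee_addgt0Pr => eps eps0; rewrite -EFinD.
have /choice[d dP] : forall j, exists d, 0 < d /\ forall x, X x -> cabs (p x) < 1 ->
    0 < cabs (p x - a j) < d -> (v x <= (bound x)%:E)%E.
  by move=> j; have [d d0 dP] := poles j; exists d.
(* A circle of radius below [D] about a point at distance at least [d j] from [a j] stays at
   distance at least [D] from it. *)
pose D := \big[Num.min/1]_j (d j / 2).
have D0 : 0 < D by apply: lt_bigmin => // j; rewrite divr_gt0 //; have [] := dP j.
have Dd j : D <= d j / 2 by exact: bigmin_le.
pose sig := Num.min D (\big[Num.min/1]_j cabs (p x - a j)).
have sig0 : 0 < sig.
  by rewrite /sig lt_min D0; apply: lt_bigmin => // j; rewrite cabs_gt0 subr_eq0.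
have sigD : sig <= D by rewrite ge_min lexx.
pose rho := Num.max rho0 (cabs (p x)).
have rho1 : rho < 1 by rewrite gt_max rho01.
(* Over the unit disc [q] lies between [bound] and [bound + eps], and its circle means lose
   [eps * r ^ 2], enough to beat the [c * r ^ 4] of the penalty. *)
pose q y := bound y + eps - eps * cabs (p y) ^+ 2.
have bq y : cabs (p y) < 1 -> bound y <= q y.
  move=> y1; rewrite /q -addrA lerDl subr_ge0 ler_piMr ?(ltW eps0) //.
  by rewrite expr_le1 ?cabs_ge0 // ltW.
have qE : q x <= bound x + eps by rewrite /q gerBl mulr_ge0 ?sqr_ge0 // ltW.
apply: (@le_trans _ _ (q x)%:E); last by rewrite lee_fin.
pose K := [set x | [/\ X x, cabs (p x) <= rho & forall j, sig <= cabs (p x - a j)]].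
apply: (@comparison_principle R T K v q (cK _ _ rho1 sig0)); last first.
- split=> //; first by rewrite le_max lexx orbT.
  by move=> j; rewrite ge_min; apply/orP; right; exact: bigmin_le.
- move=> y [Xy yrho ysig]; have y1 := le_lt_trans yrho rho1.
  have ya j : 0 < cabs (p y - a j) by exact: lt_le_trans (ysig j).
  have ya' j : p y != a j by rewrite -subr_eq0 -cabs_gt0.
  have [ry|ry] := leP rho0 (cabs (p y)).
    left; apply: (@le_trans _ _ (bound y)%:E); last by rewrite lee_fin bq.
    by apply: outer => //; rewrite ry.
  have [/existsP[j yj]|/existsPn yd] := boolP [exists j, cabs (p y - a j) < d j].
    left; apply: (@le_trans _ _ (bound y)%:E); last by rewrite lee_fin bq.
    by have [_] := dP j; apply => //; rewrite ya.
  case: (inner y Xy y1 ya') => [vy|[r0 [c [r00 sub]]]].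
    by left; apply: (le_trans vy); rewrite lee_fin bq.
  right.
  have ec : 0 < eps / (`|c| + 1) by rewrite divr_gt0 // ltr_wpDl.
  have ry' : 0 < rho - cabs (p y) by rewrite subr_gt0 (lt_le_trans ry) // le_max lexx.
  (* A radius below [M] makes the sub-mean inequality available, keeps the circle in [K], and
     ensures |c| r^2 < eps. *)
  pose M := Num.min (Num.min r0 (rho - cabs (p y))) (Num.min (Num.min 1 D) (eps / (`|c| + 1))).
  have M0 : 0 < M by rewrite /M !lt_min r00 ry' ltr01 D0 ec.
  pose r := M / 2; have r_gt0 : 0 < r by rewrite divr_gt0.
  have : r < M by rewrite /r; lra.
  rewrite /M !lt_min => /andP[/andP[rr0 rrho] /andP[/andP[rr1 rD] rec]].
  have [g [Xg pg cpg vg peng]] := sub r ltac:(by rewrite r_gt0).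
  have cr : cabs r%:C%C = r by rewrite cabs_real ger0_norm // ltW.
  have pg_rho t : cabs (p (g t)) <= rho.
    by rewrite pg (le_trans (cabsD _ _)) // cabsM cabs_expi mulr1 cr; lra.
  have far j : d j <= cabs (p y - a j) by rewrite leNgt; exact: yd.
  have pg_a t j : sig <= cabs (p (g t) - a j).
    have := cabsD (p (g t) - a j) (- (r%:C%C * expi t)).
    rewrite pg cabsN cabsM cabs_expi mulr1 cr.
    have -> : p y + r%:C%C * expi t - a j - r%:C%C * expi t = p y - a j by ring.
    by have := far j; have := Dd j; lra.
  have cB : continuous_on_seg (fun t => lnB (p y + r%:C%C * expi t)) 0 (pi *+ 2).
    move=> t _; have := @continuous_comp R C R (fun t => p y + r%:C%C * expi t) lnB t.
    apply; first exact: continuous_affine_circle.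
    apply: blaschke_ln_continuous => //; rewrite -pg ?(le_lt_trans (pg_rho _)) //.
    by move=> j; rewrite -subr_eq0 -cabs_gt0 (lt_le_trans sig0).
  have cS : continuous_on_seg (fun t => cabs (p y + r%:C%C * expi t) ^+ 2) 0 (pi *+ 2).
    move=> t _; apply: (@continuous_comp R R R (fun t => cabs (p y + r%:C%C * expi t)) (fun x => x ^+ 2)); last exact: exprn_continuous.
    apply: (@continuous_comp R C R (fun t => p y + r%:C%C * expi t) (@cabs R)); first exact: continuous_affine_circle.
    exact: cabs_continuous.
  have cP : continuous_on_seg (pen \o g) 0 (pi *+ 2) by move=> t _; exact: cpg.
  have cZ (f : R -> R) (k : R) : continuous_on_seg f 0 (pi *+ 2) ->
      continuous_on_seg (fun t => k * f t) 0 (pi *+ 2).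
    by move=> cf t t2; apply: continuousM; [exact: cst_continuous|exact: cf].
  have cD (f f' : R -> R) : continuous_on_seg f 0 (pi *+ 2) -> continuous_on_seg f' 0 (pi *+ 2) ->
      continuous_on_seg (fun t => f t + f' t) 0 (pi *+ 2).
    by move=> cf cf' t t2; apply: continuousD; [exact: cf|exact: cf'].
  have ccst k : continuous_on_seg (cst k : R -> R) 0 (pi *+ 2).
    by move=> t _; exact: cst_continuous.
  have qg : q \o g = (fun t => (c1 + eps) + (c2 * lnB (p y + r%:C%C * expi t) +
      ((pen \o g) t + (- eps) * cabs (p y + r%:C%C * expi t) ^+ 2))).
    by apply/funext => t; rewrite /q /bound /= pg; ring.
  have H1 := cZ _ (- eps) cS; have H2 := cD _ _ cP H1; have H3 := cZ _ c2 cB.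
  have H4 := cD _ _ H3 H2.
  exists g; rewrite qg; split=> //; first exact: (cD (cst (c1 + eps)) _ (ccst _) H4).
    rewrite /circle_int (@seg_intD _ (cst (c1 + eps))) //.
    rewrite (seg_int_cst _ (ltW p2)) subr0 (seg_intD H3 H2) (seg_intD cP H1).
    rewrite (seg_intZ c2 cB) (seg_intZ (- eps) cS).
    rewrite -[seg_int (pen \o g) _ _]/(circle_int (pen \o g)).
    rewrite -[X in c2 * X]/(circle_int (fun t => lnB (p y + r%:C%C * expi t))).
    rewrite -[X in - eps * X]/(circle_int (fun t => cabs (p y + r%:C%C * expi t) ^+ 2)).
    have yr : cabs (p y) + r < 1 by lra.
    have ra j : r < cabs (p y - a j) by have := far j; have := Dd j; lra.
    rewrite circle_int_sqr_cabs (circle_int_blaschke_ln m a1 (ltW r_gt0) yr ra).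
    have cr4 : c * r ^+ 4 < eps * r ^+ 2.
      have -> : c * r ^+ 4 = (c * r ^+ 2) * r ^+ 2 by ring.
      rewrite ltr_pM2r ?exprn_gt0 //.
      have : c * r ^+ 2 <= `|c| * r.
        rewrite (@le_trans _ _ (`|c| * r ^+ 2)) ?ler_wpM2r ?ler_norm ?exprn_ge0 ?(ltW r_gt0) //.
        by rewrite ler_wpM2l // expr2 ler_piMl ?(ltW r_gt0) // ltW.
      move: rec; rewrite ltr_pdivlMr ?ltr_wpDl // mulrDr mulr1 (mulrC r); lra.
    have := ltr_pM2l p2 (c * r ^+ 4) (eps * r ^+ 2); rewrite cr4 /q /bound => cr4'.
    apply: (@le_lt_trans _ _ (pi *+ 2 * (c1 + eps + c2 * lnB (p y) + pen y + c * r ^+ 4 -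
      eps * (cabs (p y) ^+ 2 + r ^+ 2)))).
      have -> : (c1 + eps) * (pi *+ 2) + (c2 * (pi *+ 2 * lnB (p y)) + (circle_int (pen \o g) +
         - eps * (pi *+ 2 * (cabs (p y) ^+ 2 + r ^+ 2)))) =
         pi *+ 2 * (c1 + eps + c2 * lnB (p y) - eps * (cabs (p y) ^+ 2 + r ^+ 2)) +
         circle_int (pen \o g) by ring.
      have := peng; rewrite mulrDr; lra.
    by rewrite ltr_pM2l //; lra.
- move=> y [Xy yrho ysig]; have y1 := le_lt_trans yrho rho1.
  have ya j : 0 < cabs (p y - a j) by exact: lt_le_trans (ysig j).
  have cpy : {for y, continuous (p : T -> C)} by exact: cp.
  apply: (@continuousB _ _ _ (fun t => bound t + eps)).
    apply: continuousD; last exact: cst_continuous.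
    apply: continuousD; last exact: cpen.
    apply: continuousD; first exact: cst_continuous.
    apply: continuousM; first exact: cst_continuous.
    apply: (@continuous_comp T C R p lnB) => //.
    apply: blaschke_ln_continuous => // j.
    by rewrite -subr_eq0 -cabs_gt0.
  apply: continuousM; first exact: cst_continuous.
  apply: (@continuous_comp T R R (fun t => cabs (p t)) (fun x => x ^+ 2)); last exact: exprn_continuous.
  by apply: (@continuous_comp T C R p (@cabs R)) => //; exact: cabs_continuous.
- by move=> y [Xy yrho _]; apply: uscv => //; exact: le_lt_trans rho1.
- by move=> y [Xy yrho _]; apply: voo => //; exact: le_lt_trans rho1.
Qed.

End DiscComparison.

(** * The Schwarz lemma with prescribed zeros *)

Section SchwarzLemma.
Variable R : realType.
Local Notation C := ((R[i])^o).
Notation mu := (@lebesgue_measure R).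

Lemma derivable_expr (f : R[i] -> R[i]) (z : R[i]) n :
  derivable (f : C -> C) (z : C) (1 : C) -> derivable ((fun z => f z ^+ n) : C -> C) (z : C) (1 : C).
Proof.
move=> df; elim: n => [|n IHn]; first exact: derivable_cst.
have -> : (fun z => f z ^+ n.+1) = (fun z => f z * f z ^+ n).
  by apply/funext => w; rewrite exprS.
exact: (@derivableM R[i] C f (fun z => f z ^+ n) z 1 df IHn).
Qed.

Lemma derivable_bigprod (J : Type) (s : seq J) (f : J -> R[i] -> R[i]) (z : R[i]) :
  (forall j, derivable (f j : C -> C) (z : C) (1 : C)) ->
  derivable ((fun z => \prod_(j <- s) f j z) : C -> C) (z : C) (1 : C).
Proof.
move=> df; elim: s => [|j s IHs].
  have -> : (fun z => \prod_(j <- [::]) f j z) = cst 1.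
    by apply/funext => w; rewrite big_nil.
  exact: derivable_cst.
have -> : (fun z => \prod_(j <- j :: s) f j z) = (fun z => f j z * \prod_(j <- s) f j z).
  by apply/funext => w; rewrite big_cons.
exact: (@derivableM R[i] C (f j) (fun z => \prod_(j <- s) f j z) z 1 (df j) IHs).
Qed.

Lemma derivable_blaschke (I : finType) (a : I -> R[i]) (m : I -> nat) z :
  (forall j, cabs (a j) < 1) -> cabs z < 1 ->
  derivable (blaschke a m : C -> C) (z : C) (1 : C).
Proof.
move=> a1 z1; apply: derivable_bigprod => j; apply: derivable_expr.
exact: derivable_mobius.
Qed.

(** Multiplying h by the unimodular [c] makes its value at the centre real and nonnegative; the mean
    value property of Re(c h) and Re(c h) <= |h| conclude. *)
Lemma cabs_le_circle_int (h : R[i] -> R[i]) (z0 : R[i]) (r rho : R) : 0 < rho < r ->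
  (forall z, cabs (z - z0) < r -> derivable (h : C -> C) (z : C) 1) ->
  pi *+ 2 * cabs (h z0) <= circle_int (fun t => cabs (h (z0 + rho%:C%C * expi t))).
Proof.
move=> rr dh; have [rho0 rhor] := andP rr.
have [h0|h0] := eqVneq (h z0) 0.
  rewrite h0 cabs0 mulr0; apply: Rintegral_ge0 => t _; exact: cabs_ge0.
pose c := (h z0)^* / (cabs (h z0))%:C%C.
have nz : (cabs (h z0))%:C%C != 0 :> R[i].
  by rewrite -cabs_eq0 cabs_real normr_eq0 cabs_eq0.
have c1 : cabs c = 1.
  by rewrite cabsM cabsV cabs_conj cabs_real ger0_norm ?cabs_ge0 // divff // cabs_eq0.
have ch : c * h z0 = (cabs (h z0))%:C%C.
  rewrite /c mulrAC conj_mul_cabs rmorphXn /= expr2; field.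
  by [].
have zt t : cabs (z0 + rho%:C%C * expi t - z0) < r.
  by rewrite addrC addKr cabsM cabs_expi mulr1 cabs_real ger0_norm // ltW.
have cc : continuous (fun t => h (z0 + rho%:C%C * expi t) : C).
  move=> t; apply: (@continuous_comp R C C (fun t => z0 + rho%:C%C * expi t) h).
    exact: continuous_affine_circle.
  by apply: derivable_continuous_C; exact: dh.
have dch z : cabs (z - z0) < r -> derivable ((fun z => c * h z) : C -> C) (z : C) 1.
  by move=> zr; apply: (@derivableM R[i] C (cst c) h); [exact: derivable_cst|exact: dh].
have := @mean_value_Re R (fun z => c * h z) z0 r rho rr dch.
rewrite ch => <-.
apply: le_seg_int => t _.
- apply: (@continuous_comp R C R (fun t => c * h (z0 + rho%:C%C * expi t)) (@complex.Re R)).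
    by apply: (@cvgM R[i]); [exact: cvg_cst|exact: cc].
  exact: Re_continuous.
- by apply: (@continuous_comp R C R (fun t => h (z0 + rho%:C%C * expi t)) (@cabs R));
    [exact: cc|exact: cabs_continuous].
- by rewrite (le_trans (ler_norm _)) // (le_trans (Re_le_cabs _)) // cabsM c1 mul1r.
Qed.

Variables (I : finType) (ze : I -> R[i]) (m : I -> nat).
Hypothesis ze1 : forall j, cabs (ze j) < 1.
Hypothesis ze_inj : injective ze.
Hypothesis m_gt0 : forall j, (0 < m j)%N.

(** The quotient h of f by the Blaschke product of its prescribed zeros is bounded near them, and
    |h| is subharmonic elsewhere. It is compared with 1 + eta - de log|B|: eta gives room at the
    unit circle, and -de log|B| tends to +oo at the zeros, so h need not be extended across them.
    Letting eta and de tend to 0 yields |h(0)| <= 1. *)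
Lemma schwarz_zeros (f : R[i] -> R[i]) :
  holo_on (@unit_disc R) f -> (forall t, cabs t < 1 -> cabs (f t) <= 1) ->
  (forall j, exists2 c : R, 0 < c & \forall t \near (ze j : C), cabs (f t) <= c * cabs (t - ze j) ^+ m j) ->
  cabs (f 0) <= \prod_j cabs (ze j) ^+ m j.
Proof.
move=> df f1 fz; have p2 := pi2_gt0 R.
have [/existsP[j /eqP zj]|/existsPn zn0] := boolP [exists j, ze j == 0].
  have [c c0 /nbhs_cabsP[e e0 /(_ 0)]] := fz j.
  rewrite zj subrr cabs0 => /(_ e0); rewrite expr0n (negbTE (lt0n_neq0 (m_gt0 j))) mulr0.
  by move=> /le_trans; apply; apply: prodr_ge0 => i _; rewrite exprn_ge0 ?cabs_ge0.
have zn0' j : 0 != ze j by rewrite eq_sym zn0.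
have c01 : cabs (0 : R[i]) < 1 by rewrite cabs0.
pose h z := f z / blaschke ze m z.
have dh z : cabs z < 1 -> (forall j, z != ze j) -> derivable (h : C -> C) (z : C) 1.
  move=> z1 zz; apply: derivableM; first exact: df.
  by apply: derivableV; [exact: blaschke_neq0|exact: derivable_blaschke].
have hE z : cabs z < 1 -> (forall j, z != ze j) ->
    cabs (h z) = cabs (f z) / expR (blaschke_ln ze m z).
  by move=> z1 zz; rewrite /h cabsM cabsV expR_blaschke_ln.
pose X := [set z : R[i] | forall j, z != ze j].
have main (eta de : R) : 0 < eta -> 0 < de ->
    cabs (h 0) <= 1 + eta + - de * blaschke_ln ze m 0 + 0.
  move=> eta0 de0; rewrite -lee_fin.
  apply: (@disc_comparison R I ze m ze1 C id X (fun z => (cabs (h z))%:E) (cst 0)) => //; last first.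
  - (* mean value inequality on small circles *)
    move=> z /= Xz z1 _; right.
    pose r0 := Num.min (1 - cabs z) (\big[Num.min/1]_j cabs (z - ze j)).
    have r00 : 0 < r0.
      rewrite /r0 lt_min subr_gt0 z1; apply: lt_bigmin => // j.
      by rewrite cabs_gt0 subr_eq0.
    have in_r0 w : cabs (w - z) < r0 -> cabs w < 1 /\ forall j, w != ze j.
      rewrite /r0 lt_min => /andP[h1 h2]; split.
        by have := cabsD (w - z) z; rewrite subrK; lra.
      move=> j; apply/eqP => wj; move: h2; rewrite wj cabsB ltNge => /negP; apply.
      exact: bigmin_le.
    exists r0, 0; split => // r rr; exists (fun t => z + r%:C%C * expi t); split => //.
    + move=> t; apply: (in_r0 _ _).2; rewrite addrC addKr cabsM cabs_expi mulr1 cabs_real.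
      by have /andP[r1 r2] := rr; rewrite ger0_norm // ltW.
    + by move=> t; exact: cst_continuous.
    + have ch : continuous_on_seg (fun t => cabs (h (z + r%:C%C * expi t))) 0 (pi *+ 2).
        move=> t _; apply: (@continuous_comp R C R (fun t => h (z + r%:C%C * expi t)) (@cabs R));
          last exact: cabs_continuous.
        apply: (@continuous_comp R C C (fun t => z + r%:C%C * expi t) h);
          first exact: continuous_affine_circle.
        have [] := in_r0 (z + r%:C%C * expi t).
          rewrite addrC addKr cabsM cabs_expi mulr1 cabs_real.
          by have /andP[r1 r2] := rr; rewrite ger0_norm // ltW.
        by move=> w1 w2; apply: derivable_continuous_C; exact: dh.
      rewrite (integral_seg_int ch) -EFinM lee_fin ler_pdivlMl //.
      apply: (@cabs_le_circle_int h z r0 r) => // w wr.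
      by have [w1 w2] := in_r0 _ wr; exact: dh.
    + rewrite [X in X <= _](seg_int_cst _ (ltW p2)) /= !mul0r addr0 mulr0; exact: lexx.
  - (* near a zero *)
    move=> j; have [c c0 /nbhs_cabsP[e e0 eP]] := fz j.
    have [k [d1 d10 d1P]] := @blaschke_ln_pole_ge R I ze m ze1 j ze_inj.
    have [d2 d20 d2P] := @blaschke_ln_pole_le R I ze m ze1 (- (c * expR k / de)) j (m_gt0 j).
    exists (Num.min e (Num.min d1 d2)); first by rewrite !lt_min e0 d10.
    move=> z /= Xz z1; rewrite !lt_min => /andP[zj /and3P[ze_ zd1 zd2]].
    rewrite lee_fin hE // ler_pdivrMr ?expR_gt0 //.
    have := eP z ze_; move=> /le_trans; apply.
    have lb : cabs (z - ze j) ^+ m j <= expR k * expR (blaschke_ln ze m z).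
      rewrite -expRD -[cabs (z - ze j)]lnK ?posrE // -expRM_natl ler_expR.
      by have := d1P z z1; rewrite zj zd1 => /(_ isT); lra.
    rewrite (le_trans (ler_wpM2l (ltW c0) lb)) // mulrA ler_wpM2r ?expR_ge0 //.
    have := d2P z z1; rewrite zj zd2 => /(_ isT); rewrite lerNr ler_pdivrMr // addr0.
    have := mulrC (- blaschke_ln ze m z) de; lra.
  - (* near the circle *)
    have l0 : 0 < ln (1 + eta) by rewrite ln_gt0 // ltrDl.
    have [rho rho1 rhoP] := @blaschke_ln_boundary R I ze m ze1 _ l0.
    exists rho => // z /= Xz zr; have /andP[_ z1] := zr.
    rewrite lee_fin hE // addr0; have := rhoP z zr; rewrite lerNl => h1.
    have h2 : cabs (f z) / expR (blaschke_ln ze m z) <= 1 + eta.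
      rewrite -expRN -[leRHS]mul1r ler_pM ?cabs_ge0 ?expR_ge0 ?f1 //.
      by rewrite -[leRHS]lnK ?ler_expR // posrE; lra.
    apply: (le_trans h2); rewrite lerDl mulNr oppr_ge0.
    by rewrite mulr_ge0_le0 ?(ltW de0) // blaschke_ln_le0.
  - by move=> z _ _; exact: cst_continuous.
  - by move=> z; exact: cvg_id.
  - move=> z Xz z1 t; rewrite lte_fin => ht.
    have ch : {for (z : C), continuous (fun z : C => cabs (h z))}.
      apply: (@continuous_comp C C R h (@cabs R)); last exact: cabs_continuous.
      by apply: derivable_continuous_C; exact: dh.
    have te : 0 < t - cabs (h z) by rewrite subr_gt0.
    have := iffLR (@cvgrPdist_lt _ R^o _ _ (nbhs_filter (z : C)) _ _) ch _ te.
    apply: filterS => y; rewrite lte_fin ltr_norml => /andP[? ?]; lra.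
  - by move=> z _ _; exact: ltry.
  - move=> rho sig rho1 sig0.
    pose S j := [set z : C | sig <= cabs (z - ze j)].
    have cS j : closed (S j) by exact: closed_cabsB_ge.
    apply: (@subclosed_compact C _ [set z | cabs z <= rho]); last 2 first.
    + exact: compact_cabs_le.
    + by move=> z [].
    have -> : [set x : R[i] | [/\ X x, cabs (id x) <= rho & forall j, sig <= cabs (id x - ze j)]] =
        [set z : C | cabs z <= rho] `&` \bigcap_(j in setT) S j.
      apply/seteqP; split=> [z [_ zr zs]|z [zr zs]]; first by split=> // j _; exact: zs.
      split=> //; last by move=> j; exact: zs.
      move=> j; apply/eqP => zj; have := zs j Logic.I; rewrite /S /= zj subrr cabs0 leNgt.
      by rewrite sig0.
    by apply: closedI; [exact: closed_cabs_le|exact: closed_bigI].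
have h01 : cabs (h 0) <= 1.
  apply/ler_addgt0Pr => eps eps0.
  pose L := - blaschke_ln ze m 0.
  have L0 : 0 <= L by rewrite oppr_ge0 blaschke_ln_le0.
  have := main (eps / 2) (eps / 2 / (L + 1)); rewrite !divr_gt0 ?ltr_wpDl // => /(_ isT isT).
  have : eps / 2 / (L + 1) * L <= eps / 2.
    by rewrite mulrAC ler_pdivrMr ?ltr_wpDl // ler_wpM2l ?divr_ge0 ?(ltW eps0) // lerDl.
  rewrite mulNr -mulrN -/L; lra.
have : cabs (f 0) <= cabs (blaschke ze m 0).
  have B0 : 0 < cabs (blaschke ze m 0) by rewrite cabs_gt0 blaschke_neq0.
  by move: h01; rewrite /h cabsM cabsV ler_pdivrMr // mul1r.
move=> /le_trans; apply; rewrite /blaschke cabs_prod le_eqVlt; apply/orP; left; apply/eqP.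
by apply: eq_bigr => j _; rewrite cabsX mobius0.
Qed.

End SchwarzLemma.

(** * Taylor remainders of polynomials and circle means of squared moduli *)

Section PolynomialLemmas.
Variable R : realType.
Local Notation C := ((R[i])^o).
Implicit Types (P Q : {poly R[i]}) (z w : R[i]).

Lemma derivable_horner P z : derivable (horner P : C -> C) (z : C) (1 : C).
Proof.
elim/poly_ind: P => [|P c IHP].
  have -> : horner (0 : {poly R[i]}) = cst 0 by apply/funext => w; rewrite horner0.
  exact: derivable_cst.
have -> : horner (P * 'X + c%:P) = (fun w => P.[w] * w + c).
  by apply/funext => w; rewrite !hornerE.
apply: (@derivableD R[i] C C (fun w => P.[w] * w) (cst c)); last exact: derivable_cst.
by apply: (@derivableM R[i] C (fun w => P.[w]) (fun w => w)); [exact: IHP|exact: derivable_id].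
Qed.

Lemma horner_continuous P : continuous (horner P : C -> C).
Proof. by move=> z; apply: derivable_continuous_C; exact: derivable_horner. Qed.

(** The remainder is itself a polynomial, so its circle means can be treated by the mean value
    property. *)
Lemma horner_taylor2 P z : exists Q, forall w,
  P.[z + w] = P.[z] + P^`().[z] * w + w ^+ 2 * Q.[w].
Proof.
elim/poly_ind: P => [|P c [Q PQ]].
  by exists 0 => w; rewrite deriv0 !horner0; ring.
exists (P^`().[z]%:P + Q * ('X + z%:P)) => w.
rewrite derivD derivM derivX derivC !hornerE PQ; ring.
Qed.

Lemma horner_bounded P : exists2 M : R, 0 <= M & forall z, cabs z <= 1 -> cabs P.[z] <= M.
Proof.
elim/poly_ind: P => [|P c [M M0 PM]]; first by exists 0 => // z _; rewrite horner0 cabs0.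
exists (M + cabs c) => [|z z1]; first by rewrite addr_ge0 ?cabs_ge0.
rewrite !hornerE (le_trans (cabsD _ _)) // lerD2r cabsM -[leRHS]mulr1.
by rewrite ler_pM ?cabs_ge0 // PM.
Qed.

(* The cross term is the real part of a holomorphic function vanishing at the centre. *)
Lemma circle_int_sqr_horner (g0 : R[i]) P : exists c : R, forall r, 0 < r < 1 ->
  circle_int (fun t => cabs (g0 + (r%:C%C * expi t) ^+ 2 * P.[r%:C%C * expi t]) ^+ 2) <=
  pi *+ 2 * (cabs g0 ^+ 2 + c * r ^+ 4).
Proof.
have [M M0 PM] := horner_bounded P; exists (M ^+ 2) => r /andP[r0 r1].
have p2 := pi2_gt0 R.
pose f := horner ((2%:R%:C%C * g0^*)%:P * 'X^2 * P).
have fE w : f w = 2%:R%:C%C * g0^* * (w ^+ 2 * P.[w]).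
  by rewrite /f !hornerM hornerC !hornerX expr2 !mulrA.
pose w t : R[i] := r%:C%C * expi t.
have w0 t : 0 + r%:C%C * expi t = w t by rewrite add0r.
have wr t : cabs (w t) = r by rewrite cabsM cabs_expi mulr1 cabs_real ger0_norm // ltW.
have sq t : cabs (g0 + w t ^+ 2 * P.[w t]) ^+ 2 <=
    (cabs g0 ^+ 2 + M ^+ 2 * r ^+ 4) + complex.Re (f (w t)).
  have -> : cabs (g0 + w t ^+ 2 * P.[w t]) ^+ 2 =
      cabs g0 ^+ 2 + cabs (w t ^+ 2 * P.[w t]) ^+ 2 + complex.Re (f (w t)).
    rewrite fE; move: (w t ^+ 2 * P.[w t]) => y.
    rewrite !sqr_cabs !conjE ?(Re_add, Im_add, Re_mul, Im_mul); case: g0 {f fE} => x x'; case: y => y y' /=.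
    ring.
  rewrite lerD2r lerD2l cabsM cabsX wr exprMn mulrC -exprM ler_pM2r ?exprn_gt0 //.
  by rewrite ler_pXn2r ?nnegrE ?cabs_ge0 // PM // wr ltW.
have cw : continuous (w : R -> C).
  move=> t; apply: (@cvgM R[i]); [exact: cvg_cst|exact: expi_continuous].
have cf : continuous (fun t => complex.Re (f (w t))).
  move=> t; apply: (@continuous_comp R C R (fun t => f (w t)) (@complex.Re R)).
    by apply: (@continuous_comp R C C w f); [exact: cw|exact: horner_continuous].
  exact: Re_continuous.
have MV : circle_int (fun t => complex.Re (f (w t))) = 0.
  have dfw z : cabs (z - 0) < 1 -> derivable (f : C -> C) (z : C) 1.
    by move=> _; exact: derivable_horner.
  have := @mean_value_Re R f 0 1 r ltac:(by rewrite r0) dfw.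
  have -> : f 0 = 0 by rewrite fE expr0n mul0r mulr0.
  rewrite [complex.Re 0]/= mulr0 => H; rewrite -[RHS]H.
  by apply: eq_seg_int => t _; rewrite w0.
have c1 k : continuous_on_seg (cst k : R -> R) 0 (pi *+ 2) by move=> t _; exact: cst_continuous.
apply: (@le_trans _ _ (seg_int (fun t => (cabs g0 ^+ 2 + M ^+ 2 * r ^+ 4) + complex.Re (f (w t)))
   0 (pi *+ 2))).
  apply: le_seg_int => t _; last exact: sq.
    apply: (@continuous_comp R R R (fun t => cabs (g0 + w t ^+ 2 * P.[w t])) (fun x => x ^+ 2));
      last exact: exprn_continuous.
    apply: (@continuous_comp R C R (fun t => g0 + w t ^+ 2 * P.[w t]) (@cabs R));
      last exact: cabs_continuous.
    have -> : (fun t => g0 + w t ^+ 2 * P.[w t] : C) = horner (g0%:P + 'X^2 * P) \o w.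
      by apply/funext => s; rewrite /= !hornerE ?hornerXn.
    by apply: (@continuous_comp R C C w); [exact: cw|exact: horner_continuous].
  by apply: continuousD; [exact: cst_continuous|exact: cf].
rewrite (@seg_intD _ (cst (cabs g0 ^+ 2 + M ^+ 2 * r ^+ 4))) //; last by move=> t _; exact: cf.
rewrite -[X in _ + X]/(circle_int (fun t => complex.Re (f (w t)))) MV addr0.
by rewrite (seg_int_cst _ (ltW p2)) subr0 mulrC lexx.
Qed.

End PolynomialLemmas.

(** * Plurisubharmonic functions on vertical discs *)

Section Slices.
Variable R : realType.
Local Notation C := ((R[i])^o).
Notation mu := (@lebesgue_measure R).
Variables (u : R[i] * R[i] -> \bar R).
Hypothesis psh_u : psh_on (@bidisc R) u.
Hypothesis u_lt0 : forall x, bidisc x -> (u x < 0)%E.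

Lemma psh_circle (x b : R[i] * R[i]) (r : R) : 0 <= r ->
  (forall ze, cabs ze <= r -> bidisc (x.1 + ze * b.1, x.2 + ze * b.2)) ->
  (u x <= ((pi *+ 2)^-1)%:E * \int[mu]_(t in `[0%R, (pi *+ 2)%R])
     u ((x.1 + r%:C%C * expi t * b.1)%R, (x.2 + r%:C%C * expi t * b.2)%R))%E.
Proof.
move=> r0 xb; have [_ _ /(_ x (r%:C%C * b.1, r%:C%C * b.2))] := psh_u.
have E t : expi t * (r%:C%C * b.1) = r%:C%C * expi t * b.1 by rewrite mulrCA mulrA.
have E' t : expi t * (r%:C%C * b.2) = r%:C%C * expi t * b.2 by rewrite mulrCA mulrA.
under eq_integral do rewrite /= E E'.
apply => ze ze1 /=; rewrite !mulrA; apply: xb.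
rewrite cabsM cabs_real ger0_norm // -[leRHS]mul1r.
by rewrite ler_wpM2r.
Qed.

Lemma usc_bidisc x : bidisc x -> forall t : R, (u x < t%:E)%E ->
  exists2 e : R, 0 < e & forall y : R[i] * R[i],
    cabs (y.1 - x.1) < e -> cabs (y.2 - x.2) < e -> (u y < t%:E)%E.
Proof. by case: psh_u => _ usc _ Dx t /(usc x Dx) /nbhs_cabs2P. Qed.

Lemma blaschke_ln0 (w : R[i]) :
  blaschke_ln (fun _ : 'I_1 => 0) (fun=> 1%N) w = ln (cabs w).
Proof.
rewrite /blaschke_ln big_ord1 mul1r cabs_mobius sub0r cabsN conjE conjc0 mul0r subr0.
by rewrite cabs1 divr1.
Qed.

(** Maximum principle on the annulus s <= |w| < 1, punctured at 0 when s = 0. The majorant is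
    harmonic, it is nonnegative near |w| = 1 because c1 > 0, and the bound at the inner edge is
    assumed. It is [disc_comparison] with a single simple pole at 0, for which log|B| = log|w|, and
    no penalty. *)
Lemma slice_le (z1 : R[i]) (s c1 c2 : R) : cabs z1 < 1 -> 0 <= s -> 0 < c1 -> 0 <= c2 <= 1 ->
  (exists2 d, 0 < d & forall w, cabs w < 1 -> 0 < cabs w -> s <= cabs w < s + d ->
     (u (z1, w) <= (c1 + c2 * ln (cabs w))%:E)%E) ->
  forall w, cabs w < 1 -> 0 < cabs w -> s <= cabs w ->
    (u (z1, w) <= (c1 + c2 * ln (cabs w))%:E)%E.
Proof.
move=> z11 s0 c10 /andP[c20 c21] [d d0 dP] w w1 w0 sw; have p2 := pi2_gt0 R.
have a1 (j : 'I_1) : cabs (0 : R[i]) < 1 by rewrite cabs0.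
pose X := [set w : R[i] | 0 < cabs w /\ s <= cabs w].
have := @disc_comparison R 'I_1 (fun=> 0) (fun=> 1%N) a1 C id X (fun w => u (z1, w)) (cst 0) c1 c2.
move=> /(_ _ _ _ _ _ _ _ _ w (conj w0 sw) w1); rewrite blaschke_ln0 /= addr0; apply.
- move=> rho sig rho1 sig0.
  apply: (@subclosed_compact C _ [set z | cabs z <= rho]); last 2 first.
  + exact: compact_cabs_le.
  + by move=> z [].
  have -> : [set x : R[i] | [/\ X x, cabs (id x) <= rho & forall j : 'I_1, sig <= cabs (id x - 0)]] =
      [set z : C | cabs z <= rho] `&` ([set z : C | s <= cabs (z - 0)] `&` [set z : C | sig <= cabs (z - 0)]).
    apply/seteqP; split=> [z [[_ sz] zr /(_ ord0) zs]|z [zr [sz zs]]].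
      by split => //; split => //=; rewrite subr0.
    move: sz zs; rewrite /= subr0 => sz zs.
    split; [split; [exact: lt_le_trans zs|exact: sz]|exact: zr|].
    by move=> _; exact: zs.
  apply: closedI; first exact: closed_cabs_le.
  by apply: closedI; exact: closed_cabsB_ge.
- by move=> x _ x1; case: psh_u => uoo _ _; apply: uoo.
- move=> x _ x1 t ut; have [e e0 eP] := @usc_bidisc (z1, x) (conj z11 x1) t ut.
  by apply/nbhs_cabsP; exists e => // y yx; apply: eP => //=; rewrite subrr cabs0.
- by move=> x; exact: cvg_id.
- by move=> x _ _; exact: cst_continuous.
- have [rho rho1 rhoP] := @blaschke_ln_boundary R 'I_1 (fun=> 0) (fun=> 1%N) a1 _ c10.
  exists rho => // x _ xr; have /andP[_ x1] := xr; have := rhoP x xr.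
  rewrite !blaschke_ln0 => lx; have Bx : bidisc (z1, x) by split.
  apply: (le_trans (ltW (u_lt0 Bx))).
  rewrite lee_fin addr0.
  rewrite -lerBlDl sub0r; apply: le_trans (ler_wpM2l c20 lx).
  by rewrite mulrN lerN2 ler_piMl // ltW.
- move=> _; exists d => // x [x0 sx] x1; rewrite subr0 => /andP[_ xd].
  rewrite addr0 blaschke_ln0; apply: dP => //; by rewrite sx (lt_le_trans xd) // lerDr.
- move=> x [x0 sx] x1 _; rewrite blaschke_ln0 addr0 {a1}.
  have [xd|xd] := ltP (cabs x) (s + d).
    by left; apply: dP => //; rewrite sx.
  right; pose r0 := Num.min (Num.min (cabs x) (1 - cabs x)) d.
  have r00 : 0 < r0 by rewrite !lt_min x0 subr_gt0 x1 d0.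
  exists r0, 0; split => // r /andP[r_gt0]; rewrite !lt_min => /andP[/andP[rx rx1] rd].
  have cr : cabs r%:C%C = r by rewrite cabs_real ger0_norm // ltW.
  exists (fun t => x + r%:C%C * expi t); split => //.
  + move=> t; have h : cabs x - r <= cabs (x + r%:C%C * expi t).
      have := cabsD (x + r%:C%C * expi t) (- (r%:C%C * expi t)).
      by rewrite addrK cabsN cabsM cabs_expi mulr1 cr; lra.
    by split; lra.
  + by move=> t; exact: cst_continuous.
  + have := @psh_circle (z1, x) (0, 1) r (ltW r_gt0).
    under eq_integral do rewrite /= mulr0 addr0 mulr1.
    apply => ze zr; rewrite /= mulr0 addr0 mulr1; split => //=.
    by rewrite /unit_disc /= (le_lt_trans (cabsD _ _)) //; lra.
  + rewrite [X in X <= _](seg_int_cst _ (ltW p2)) /= !mul0r addr0 mulr0; exact: lexx.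
- by move=> j; rewrite -cabs_gt0.
Qed.

End Slices.

(** * The bound u <= log|B| below the graph of |B| *)

Section GreenUpperBound.
Variable R : realType.
Local Notation C := ((R[i])^o).
Notation mu := (@lebesgue_measure R).
Variables (I : finType) (a : I -> R[i]) (m : I -> nat).
Hypothesis a1 : forall j, cabs (a j) < 1.
Hypothesis a_inj : injective a.
Hypothesis m_gt0 : forall j, (0 < m j)%N.
Local Notation lnB := (blaschke_ln a m).
Local Notation B := (blaschke a m).

(** With B = P/Q, clearing denominators makes the equation of a graph w = c B polynomial, hence
    continuous on the whole plane and with an exact Taylor expansion. *)
Definition blaschke_num : {poly R[i]} := \prod_j ((a j)%:P - 'X) ^+ m j.
Definition blaschke_den : {poly R[i]} := \prod_j (1 - (a j)^*%:P * 'X) ^+ m j.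
Local Notation P := blaschke_num.
Local Notation Q := blaschke_den.

Lemma horner_blaschke_num z : P.[z] = \prod_j (a j - z) ^+ m j.
Proof. by rewrite horner_prod; apply: eq_bigr => j _; rewrite horner_exp !hornerE. Qed.

Lemma horner_blaschke_den z : Q.[z] = \prod_j (1 - (a j)^* * z) ^+ m j.
Proof. by rewrite horner_prod; apply: eq_bigr => j _; rewrite horner_exp !hornerE. Qed.

Lemma blaschke_den_neq0 z : cabs z < 1 -> Q.[z] != 0.
Proof.
move=> z1; rewrite horner_blaschke_den; apply/prodf_neq0 => j _.
by rewrite expf_neq0 // mobius_den_neq0 // ltW.
Qed.

Lemma blaschkeE z : B z = P.[z] / Q.[z].
Proof.
rewrite horner_blaschke_num horner_blaschke_den /blaschke -prodfV -big_split /=.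
by apply: eq_bigr => j _; rewrite /mobius expr_div_n.
Qed.

Lemma cabs_blaschke_le_factor z j : cabs z < 1 -> cabs (B z) <= cabs (mobius (a j) z) ^+ m j.
Proof.
move=> z1; rewrite /blaschke cabs_prod (bigD1 j) //= cabsX ler_piMr ?exprn_ge0 ?cabs_ge0 //.
have : \prod_(i | i != j) cabs (mobius (a i) z ^+ m i) <= \prod_(i | i != j) 1.
  apply: ler_prod => i _; rewrite cabs_ge0 cabsX exprn_ile1 ?cabs_ge0 //.
  by rewrite ltW // cabs_mobius_lt1.
by rewrite [X in _ <= X -> _]big1.
Qed.

Lemma cabs_blaschke_lt1 z : (0 < #|I|)%N -> cabs z < 1 -> cabs (B z) < 1.
Proof.
move=> /card_gt0P[j _] z1; apply: le_lt_trans (cabs_blaschke_le_factor j z1) _.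
by rewrite exprn_ilt1 ?cabs_ge0 ?cabs_mobius_lt1 // -lt0n.
Qed.

Variable u : R[i] * R[i] -> \bar R.
Hypothesis psh_u : psh_on (@bidisc R) u.
Hypothesis u_lt0 : forall x, bidisc x -> (u x < 0)%E.
Hypothesis pole_u : forall j, pole_cond (a j, 0) (m j) u.
Hypothesis I_gt0 : (0 < #|I|)%N.

Lemma fst_continuousC : continuous (fst : C * C -> C).
Proof. by move=> x; exact: cvg_fst. Qed.

Lemma snd_continuousC : continuous (snd : C * C -> C).
Proof. by move=> x; exact: cvg_snd. Qed.

Lemma horner_fst_continuous (p : {poly R[i]}) :
  continuous (fun x : C * C => p.[x.1] : C).
Proof.
move=> x; apply: (@continuous_comp (C * C)%type C C fst (horner p)).
  exact: fst_continuousC.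
exact: horner_continuous.
Qed.

(* Inside the region |w| <= |B(ze)| every pole is seen with the singularity of log|B|. *)
Lemma pole_bound j : exists2 c, 0 <= c & exists2 d, 0 < d & forall x : R[i] * R[i],
  cabs x.1 < 1 -> 0 < cabs (x.1 - a j) < d -> (forall i, x.1 != a i) -> cabs x.2 <= cabs (B x.1) ->
  (u x <= (lnB x.1 + c)%:E)%E.
Proof.
have [c /nbhs_cabs2P[e e0 eP]] := pole_u j.
have [k [d1 d10 d1P]] := @blaschke_ln_pole_ge R I a m a1 j a_inj.
have [d2 d20 d2P] := @blaschke_ln_pole_le R I a m a1 (ln (e / 2)) j (m_gt0 j).
exists (`|c| + `|k|); first by rewrite addr_ge0.
exists (Num.min e (Num.min d1 d2)); first by rewrite !lt_min e0 d10.
move=> x x1; rewrite !lt_min => /andP[xa /and3P[xe xd1 xd2]] xna xB.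
have BE := expR_blaschke_ln m a1 x1 xna.
have x2e : cabs (x.2 - 0) < e.
  rewrite subr0 (le_lt_trans xB) // -BE.
  have := d2P _ x1; rewrite xa xd2 => /(_ isT) h.
  apply: (@le_lt_trans _ _ (e / 2)); last by lra.
  by rewrite -[leRHS]lnK ?posrE ?divr_gt0 // ler_expR.
apply: (le_trans (eP _ xe x2e)).
have hm : (Psi (m j) ((x.1 - a j)%R, (x.2 - 0)%R) <= (lnB x.1 + `|k|)%:E)%E.
  rewrite /Psi ge_max /=; apply/andP; split.
    rewrite /logabs -cabs_eq0 gt_eqF // -EFinM lee_fin.
    have := d1P _ x1; rewrite xa xd1 => /(_ isT); have := ler_norm k; lra.
  rewrite subr0 /logabs; have [x20|x20] := boolP (x.2 == 0); first exact: leNye.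
  rewrite lee_fin (@le_trans _ _ (lnB x.1)) ?lerDl //.
  by rewrite -(expRK (lnB x.1)) BE ler_ln ?posrE ?cabs_gt0 // blaschke_neq0.
apply: (le_trans (leeD hm (_ : (c%:E <= `|c|%:E)%E))); first by rewrite lee_fin ler_norm.
by rewrite -EFinD lee_fin -addrA (addrC `|k|).
Qed.

(** Compare u with eta + (1 - de) log|B| + pen on the region |w| <= |B|, where the penalty vanishes
    on the graph w = c0 B through z. Near the unit circle eta makes the majorant nonnegative. Near a
    pole the factor 1 - de absorbs the constant of the pole condition. On |w| = |B| the penalty
    outweighs -log|B|. At all remaining points u has the sub-mean property on discs tangent to level
    sets of g. Then eta and de tend to 0. *)
Lemma graph_le (z : R[i] * R[i]) : cabs z.1 < 1 -> (forall j, z.1 != a j) ->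
  cabs z.2 < cabs (B z.1) -> (u z <= (lnB z.1)%:E)%E.
Proof.
move=> z11 zna zB; have p2 := pi2_gt0 R.
have Bz0 : 0 < cabs (B z.1) by rewrite cabs_gt0 blaschke_neq0.
suff main eta de : 0 < eta -> 0 < de < 1 -> (u z <= (eta + (1 - de) * lnB z.1)%:E)%E.
  apply/lee_addgt0Pr => eps eps0; rewrite -EFinD.
  pose L := - lnB z.1; have L0 : 0 <= L by rewrite oppr_ge0 blaschke_ln_le0.
  have de0 : 0 < Num.min (1 / 2) (eps / 2 / (L + 1)).
    by rewrite lt_min !divr_gt0 // ltr_wpDl.
  have := main (eps / 2) (Num.min (1 / 2) (eps / 2 / (L + 1))).
  rewrite de0 divr_gt0 // => /(_ isT) H; apply: le_trans (H _) _.
    by rewrite /= gt_min; apply/orP; left; lra.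
  rewrite lee_fin.
  have : Num.min (1 / 2) (eps / 2 / (L + 1)) * L <= eps / 2.
    rewrite (@le_trans _ _ (eps / 2 / (L + 1) * L)) //.
      by rewrite ler_wpM2r // ge_min lexx orbT.
    by rewrite mulrAC ler_pdivrMr ?ltr_wpDl // ler_wpM2l ?divr_ge0 ?(ltW eps0) // lerDl.
  rewrite mulrBl mul1r /L mulrN; lra.
move=> eta0 /andP[de0 de1].
pose c0 := z.2 / B z.1.
have c01 : cabs c0 < 1 by rewrite cabsM cabsV ltr_pdivrMr // mul1r.
(* radii around the poles inside which the pole condition takes over *)
have radius j : exists d, 0 < d /\ forall x : R[i] * R[i], cabs x.1 < 1 ->
    0 < cabs (x.1 - a j) < d -> (forall i, x.1 != a i) -> cabs x.2 <= cabs (B x.1) ->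
    (u x <= (eta + (1 - de) * lnB x.1)%:E)%E.
  have [c c_ge0 [d1 d10 d1P]] := pole_bound j.
  have [d2 d20 d2P] := @blaschke_ln_pole_le R I a m a1 (- (c / de)) j (m_gt0 j).
  exists (Num.min d1 d2); split; first by rewrite lt_min d10.
  move=> x x1; rewrite !lt_min => /and3P[xa xd1 xd2] xna xB.
  apply: (le_trans (d1P x x1 _ xna xB)); first by rewrite xa.
  rewrite lee_fin; have := d2P _ x1; rewrite xa xd2 => /(_ isT).
  rewrite lerNr ler_pdivrMr // mulrBl mul1r (mulrC _ de) mulrN; lra.
have {radius}/choice[rad radP] := radius.
(* Half of [rad j] is excised, so that small discs about points outside the radius [rad j] remain in
   [X]; the second term keeps [z] in [X]. *)
pose d j := Num.min (rad j / 2) (cabs (z.1 - a j)).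
have d0 j : 0 < d j.
  by rewrite lt_min divr_gt0 ?cabs_gt0 ?subr_eq0 ?zna //; have [] := radP j.
have [rho0 rho01 rhoP] := @blaschke_ln_boundary R I a m a1 _ eta0.
pose p0 := \prod_j d j ^+ m j.
have p00 : 0 < p0 by apply: prodr_gt0 => j _; rewrite exprn_gt0.
(* Over the disc this is |w| <= |B| away from the poles, written without division so as to be closed
   in the whole plane. *)
pose X := [set x : R[i] * R[i] |
  cabs (x.2 * Q.[x.1]) <= cabs P.[x.1] /\ forall j, d j <= cabs (x.1 - a j)].
have Xna x : X x -> forall j, x.1 != a j.
  by move=> [_ xd] j; rewrite -subr_eq0 -cabs_gt0 (lt_le_trans (d0 j)).
have XB x : X x -> cabs x.1 < 1 -> cabs x.2 <= cabs (B x.1).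
  move=> [xPQ _] x1; rewrite blaschkeE cabsM cabsV ler_pdivlMr -?cabsM //.
  by rewrite cabs_gt0 blaschke_den_neq0.
have Xbi x : X x -> cabs x.1 < 1 -> bidisc x.
  by move=> Xx x1; split=> //; rewrite /unit_disc /= (le_lt_trans (XB x Xx x1)) // cabs_blaschke_lt1.
have XP x : X x -> p0 <= cabs P.[x.1].
  move=> [_ xd]; rewrite horner_blaschke_num cabs_prod; apply: ler_prod => j _.
  by rewrite exprn_ge0 ?(ltW (d0 j)) //= cabsX ler_pXn2r ?nnegrE ?cabs_ge0 ?(ltW (d0 j)) // cabsB.
have [L L0 XL] : exists2 L, 0 <= L & forall x, X x -> cabs x.1 < 1 -> - L <= lnB x.1.
  pose q0 : R := \prod_j 2 ^+ m j.
  have q00 : 0 < q0 by apply: prodr_gt0 => j _; rewrite exprn_gt0.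
  exists `|ln (p0 / q0)| => // x Xx x1; rewrite (@le_trans _ _ (ln (p0 / q0))) //.
    by rewrite lerNl (le_trans (ler_norm _)) // normrN.
  have Q0 : 0 < cabs Q.[x.1] by rewrite cabs_gt0 blaschke_den_neq0.
  rewrite -(expRK (lnB x.1)) (expR_blaschke_ln m a1 x1 (Xna x Xx)).
  rewrite blaschkeE cabsM cabsV ler_ln ?posrE ?divr_gt0 ?(lt_le_trans p00 (XP x Xx)) //.
  rewrite ler_pM ?invr_ge0 ?(ltW p00) ?(ltW q00) ?XP // lef_pV2 ?posrE //.
  rewrite horner_blaschke_den cabs_prod; apply: ler_prod => j _; rewrite cabs_ge0 cabsX /=.
  rewrite ler_pXn2r ?nnegrE ?cabs_ge0 //.
  have := cabsD 1 (- ((a j)^* * x.1)); rewrite cabsN cabs1 cabsM cabs_conj.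
  have : cabs (a j) * cabs x.1 <= 1 * 1 by rewrite ler_pM ?cabs_ge0 // ltW.
  lra.
(* Over the disc, g = 0 is the graph w = c0 B. Where |w Q| = |P|, |g| >= (1 - |c0|)|P| >= p0 (1 -
   |c0|), so the factor [Kp] gives a penalty at least L, hence at least -log|B|. *)
pose g x := x.2 * Q.[x.1] - c0 * P.[x.1].
pose Kp := L / (p0 * (1 - cabs c0)) ^+ 2.
have pc0 : 0 < p0 * (1 - cabs c0) by rewrite mulr_gt0 // subr_gt0.
have Kp0 : 0 <= Kp by rewrite divr_ge0 // sqr_ge0.
pose pen x := Kp * cabs (g x) ^+ 2.
have cg : continuous (g : C * C -> C).
  move=> x; apply: (@cvgB _ C); apply: (@cvgM R[i]).
  - exact: snd_continuousC.
  - exact: horner_fst_continuous.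
  - exact: cvg_cst.
  - exact: horner_fst_continuous.
have cpen : continuous (pen : C * C -> R).
  move=> x; apply: (@continuousM R (C * C)%type (cst Kp)); first exact: cst_continuous.
  apply: (@continuous_comp (C * C)%type R R (fun x => cabs (g x)) (fun x => x ^+ 2));
    last exact: exprn_continuous.
  apply: (@continuous_comp (C * C)%type C R g (@cabs R)); first exact: cg.
  exact: cabs_continuous.
pose F (x : C * C) := cabs (x.2 * Q.[x.1]) - cabs P.[x.1].
have cF : continuous F.
  move=> x; apply: (@continuousB _ _ _ (fun x : C * C => cabs (x.2 * Q.[x.1]))).
    apply: (@continuous_comp (C * C)%type C R (fun x => x.2 * Q.[x.1]) (@cabs R));
      last exact: cabs_continuous.
    by apply: (@cvgM R[i]); [exact: snd_continuousC|exact: horner_fst_continuous].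
  apply: (@continuous_comp (C * C)%type C R (fun x => P.[x.1]) (@cabs R)).
    exact: horner_fst_continuous.
  exact: cabs_continuous.
have pen_ge0 x : 0 <= pen x by rewrite mulr_ge0 ?sqr_ge0.
have penz : pen z = 0.
  rewrite /pen /g /c0 blaschkeE.
  have -> : z.2 * Q.[z.1] - z.2 / (P.[z.1] / Q.[z.1]) * P.[z.1] = 0.
    have Pz : P.[z.1] != 0.
      by apply: contraTneq Bz0 => Pz; rewrite blaschkeE Pz mul0r cabs0 ltxx.
    have Qz := blaschke_den_neq0 z11; field.
    by rewrite Pz Qz.
  by rewrite cabs0 expr0n mulr0.
have Xz : X z.
  split; last by move=> j; rewrite ge_min lexx orbT.
  rewrite cabsM -ler_pdivlMr; first by rewrite -cabsV -cabsM -blaschkeE ltW.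
  by rewrite cabs_gt0 blaschke_den_neq0.
have := @disc_comparison R I a m a1 (C * C)%type fst X u pen eta (1 - de).
move=> /(_ _ _ _ _ _ _ _ _ z Xz z11 zna); rewrite penz addr0; apply.
- move=> rho sig rho1 sig0.
  apply: (@subclosed_compact (C * C)%type _ ([set w : C | cabs w <= rho] `*` [set w : C | cabs w <= 1])).
  + have -> : [set x : C * C | [/\ X x, cabs x.1 <= rho & forall j, sig <= cabs (x.1 - a j)]] =
      [set x : C * C | cabs (x.2 * Q.[x.1]) - cabs P.[x.1] <= 0] `&`
      ((fst : C * C -> C) @^-1` [set w : C | cabs w <= rho] `&`
      \bigcap_(j in setT) ((fst : C * C -> C) @^-1` ([set w : C | d j <= cabs (w - a j)] `&`
        [set w : C | sig <= cabs (w - a j)]))).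
      apply/seteqP; split=> [x [[xPQ xd] xr xs]|x [xPQ [xr xs]]].
        split; first by rewrite /= subr_le0.
        by split=> // j _; split; [exact: xd|exact: xs].
      split=> //; first split.
      * by move: xPQ; rewrite /= subr_le0.
      * by move=> j; have [] := xs j Logic.I.
      * by move=> j; have [] := xs j Logic.I.
    apply: closedI; [|apply: closedI].
    * apply: (@preimage_closed (C * C)%type R F [set y | y <= 0]); last exact: closed_le.
      by move=> x _; exact: cF.
    * apply: preimage_closed; last exact: closed_cabs_le.
      by move=> x _; exact: fst_continuousC.
    * apply: closed_bigI => j _; apply: preimage_closed.
        by move=> x _; exact: fst_continuousC.
      by apply: closedI; exact: closed_cabsB_ge.
  + by apply: compact_setX; exact: compact_cabs_le.
  + move=> x [Xx xr _]; split=> //=; have x1 := le_lt_trans xr rho1.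
    by rewrite (le_trans (XB x Xx x1)) // ltW // cabs_blaschke_lt1.
- by move=> x Xx x1; case: psh_u => uoo _ _; apply: uoo; exact: Xbi.
- move=> x Xx x1; case: psh_u => _ usc _; apply: usc; exact: Xbi.
- exact: fst_continuousC.
- by move=> x _ _; exact: cpen.
- exists rho0 => // x Xx xr; have /andP[_ x1] := xr.
  apply: (le_trans (ltW (u_lt0 (Xbi x Xx x1)))); rewrite lee_fin.
  have lr := rhoP _ xr; have l0 := blaschke_ln_le0 m a1 x1; have := pen_ge0 x.
  have : 0 <= de * - lnB x.1 by rewrite mulr_ge0 ?(ltW de0) // oppr_ge0.
  rewrite mulrBl mul1r mulrN; lra.
- by move=> j; exists (d j) => // x [_ xd] _ /andP[_]; rewrite ltNge xd.
- move=> x Xx x1 _; have [xPQ xd] := Xx; have xna := Xna x Xx.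
  have [/existsP[j xj]|/existsPn xfar] := boolP [exists j, cabs (x.1 - a j) < rad j].
    left; have [_ /(_ x x1)] := radP j; rewrite xj cabs_gt0 subr_eq0 xna => /(_ isT xna (XB x Xx x1)).
    by move=> /le_trans; apply; rewrite lee_fin lerDl.
  move: xPQ; rewrite le_eqVlt => /predU1P[xPQ|xPQ].
    left; apply: (le_trans (ltW (u_lt0 (Xbi x Xx x1)))); rewrite lee_fin.
    have gx : p0 * (1 - cabs c0) <= cabs (g x).
      have h : cabs (x.2 * Q.[x.1]) <= cabs (g x) + cabs (c0 * P.[x.1]).
        by rewrite (le_trans _ (cabsD _ _)) // subrK.
      rewrite xPQ cabsM in h.
      have h2 : p0 * (1 - cabs c0) <= cabs P.[x.1] * (1 - cabs c0).
        by rewrite ler_wpM2r ?XP // subr_ge0 ltW.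
      have h3 : cabs P.[x.1] * (1 - cabs c0) = cabs P.[x.1] - cabs c0 * cabs P.[x.1] by ring.
      lra.
    have penL : L <= pen x.
      rewrite /pen /Kp mulrAC ler_pdivlMr ?exprn_gt0 // ler_wpM2l //.
      by rewrite ler_pXn2r ?nnegrE ?cabs_ge0 ?(ltW pc0).
    have l0 := XL x Xx x1; have l1 := blaschke_ln_le0 m a1 x1.
    have : 0 <= de * - lnB x.1 by rewrite mulr_ge0 ?(ltW de0) // oppr_ge0.
    rewrite mulrBl mul1r mulrN; lra.
  right.
  have Qx := blaschke_den_neq0 x1.
  (* The slope of the level set of g through x: in the direction (1, b) the first-order term of g
     vanishes, so g(x) changes only by t^2 times a polynomial in t. *)
  pose b := (c0 * P^`().[x.1] - x.2 * Q^`().[x.1]) / Q.[x.1].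
  have [k1 k1P] := horner_taylor2 P x.1; have [k2 k2P] := horner_taylor2 Q x.1.
  pose k := b%:P * Q^`().[x.1]%:P + (x.2%:P + b%:P * 'X) * k2 - c0%:P * k1.
  have gk t : g (x.1 + t, x.2 + t * b) = g x + t ^+ 2 * k.[t].
    have kt : k.[t] = b * Q^`().[x.1] + (x.2 + b * t) * k2.[t] - c0 * k1.[t].
      by rewrite /k !hornerE.
    have bQ : b * Q.[x.1] = c0 * P^`().[x.1] - x.2 * Q^`().[x.1] by rewrite /b divfK.
    rewrite /g /= k1P k2P kt; apply/subr0_eq.
    transitivity (t * (b * Q.[x.1] - (c0 * P^`().[x.1] - x.2 * Q^`().[x.1]))); first by ring.
    by rewrite bQ subrr mulr0.
  have [c cP] := circle_int_sqr_horner (g x) k.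
  (* the disc stays in X for small radii *)
  have [r0 r00 r0P] : exists2 r0 : R, 0 < r0 & forall t, cabs t < r0 ->
      X (x.1 + t, x.2 + t * b) /\ cabs (x.1 + t) < 1.
    have F0 : 0 < - F x by rewrite oppr_gt0 subr_lt0.
    have := iffLR (@cvgrPdist_lt _ R^o _ _ (nbhs_filter (x : C * C)) _ _) (cF x) _ F0.
    move=> /nbhs_cabs2P[e e0 eP].
    have b0 : 0 < cabs b + 1 by rewrite ltr_wpDl ?cabs_ge0.
    exists (Num.min (Num.min (1 - cabs x.1) (e / (cabs b + 1))) (\big[Num.min/1]_j d j)).
      by rewrite !lt_min subr_gt0 x1 divr_gt0 //=; apply: lt_bigmin.
    move=> t; rewrite !lt_min => /andP[/andP[tx te] td].
    move: te; rewrite ltr_pdivlMr // mulrDr mulr1 => te.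
    have tb0 : 0 <= cabs t * cabs b by rewrite mulr_ge0 ?cabs_ge0.
    have t0 := cabs_ge0 t.
    split; last by rewrite (le_lt_trans (cabsD _ _)) //; lra.
    split.
      have := eP (x.1 + t, x.2 + t * b); rewrite /= !(addrC _ t) !addrK (addrC _ (t * b)) addrK cabsM.
      rewrite ltr_norml => /(_ ltac:(lra) ltac:(lra)) /andP[h _].
      by move: h; rewrite /F /= (addrC t x.1) (addrC (t * b) x.2); lra.
    move=> j /=; have tj : cabs t < d j by apply: lt_le_trans td _; exact: bigmin_le.
    have dj : d j <= rad j / 2 by rewrite ge_min lexx.
    have xj : rad j <= cabs (x.1 - a j) by rewrite leNgt; exact: xfar.
    have := cabsD (x.1 + t - a j) (- t).
    have -> : x.1 + t - a j - t = x.1 - a j by ring.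
    rewrite cabsN; lra.
  exists (Num.min r0 1), (Kp * c); split; first by rewrite lt_min r00 ltr01.
  move=> r; rewrite lt_min => /andP[r_gt0 /andP[rr0 r1]].
  have cr t : cabs (r%:C%C * expi t) = r by rewrite cabsM cabs_expi mulr1 cabs_real ger0_norm // ltW.
  have cgam : continuous (fun t : R => (x.1 + r%:C%C * expi t, x.2 + r%:C%C * expi t * b) : C * C).
    move=> t; apply: (@cvg_pair _ _ _ _ (nbhs (x.1 + r%:C%C * expi t : C)) (nbhs (x.2 + r%:C%C * expi t * b : C))).
      exact: continuous_affine_circle.
    under eq_fun do rewrite mulrAC.
    rewrite mulrAC; exact: continuous_affine_circle.
  exists (fun t => (x.1 + r%:C%C * expi t, x.2 + r%:C%C * expi t * b)); split => //.
  + by move=> t; have [] := r0P (r%:C%C * expi t) ltac:(by rewrite cr).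
  + move=> t; apply: (@continuous_comp R (C * C)%type R
      (fun t : R => (x.1 + r%:C%C * expi t, x.2 + r%:C%C * expi t * b)) pen); first exact: cgam.
    exact: cpen.
  + have := @psh_circle R u psh_u x (1, b) r (ltW r_gt0).
    under eq_integral do rewrite /= mulr1.
    apply=> ze zer; have [] := r0P ze (le_lt_trans zer rr0); rewrite /= mulr1; exact: Xbi.
  + have -> : pen \o (fun t => (x.1 + r%:C%C * expi t, x.2 + r%:C%C * expi t * b)) =
        (fun t => Kp * cabs (g x + (r%:C%C * expi t) ^+ 2 * k.[r%:C%C * expi t]) ^+ 2).
      by apply/funext => t /=; rewrite /pen gk.
    rewrite /circle_int seg_intZ; last first.
      move=> t _; apply: (@continuous_comp R R R (fun t => cabs (g x + (r%:C%C * expi t) ^+ 2 *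
         k.[r%:C%C * expi t])) (fun x => x ^+ 2)); last exact: exprn_continuous.
      apply: (@continuous_comp R C R _ (@cabs R)); last exact: cabs_continuous.
      have -> : (fun t => g x + (r%:C%C * expi t) ^+ 2 * k.[r%:C%C * expi t] : C) =
          horner ((g x)%:P + 'X^2 * k) \o (fun t => r%:C%C * expi t).
        by apply/funext => s; rewrite /= !hornerE ?hornerXn.
      apply: (@continuous_comp R C C (fun t => r%:C%C * expi t)); last exact: horner_continuous.
      by apply: (@cvgM R[i]); [exact: cvg_cst|exact: expi_continuous].
    have := cP r; rewrite r_gt0 r1 => /(_ isT) H.
    apply: (le_trans (ler_wpM2l Kp0 H)); rewrite /pen le_eqVlt; apply/orP; left; apply/eqP.
    by ring.
Qed.

End GreenUpperBound.

(** * Every Green competitor lies below the formula, and every Lempert value above it *)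

Section UpperAndLowerBounds.
Variable R : realType.
Local Notation C := ((R[i])^o).

Lemma derivable_comp_C (f g : R[i] -> R[i]) (z : R[i]) :
  derivable (f : C -> C) (z : C) (1 : C) -> derivable (g : C -> C) (f z : C) (1 : C) ->
  derivable ((fun t => g (f t)) : C -> C) (z : C) (1 : C).
Proof.
move=> /(@derivable1_diffP R[i] C f z) df /(@derivable1_diffP R[i] C g (f z)) dg.
apply/(@derivable1_diffP R[i] C).
exact: (@differentiable_comp R[i] C C C f g z df dg).
Qed.

Lemma logabsE (x : R[i]) : x != 0 -> logabs x = (ln (cabs x))%:E.
Proof. by rewrite /logabs => /negbTE ->. Qed.

Lemma logabs0 : logabs (0 : R[i]) = -oo%E.
Proof. by rewrite /logabs eqxx. Qed.

Lemma natr_mule_ninfty n : (0 < n)%N -> ((n%:R : R)%:E * -oo)%E = -oo%E.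
Proof. by move=> n0; rewrite gt0_muleNy // lte_fin ltr0n. Qed.

(** With its converse [le_logabs], this turns pole conditions into polynomial estimates that remain
    valid at zeros, where the logarithm is -oo. *)
Lemma logabs_bound (x y : R[i]) (n k : nat) (c : R) : (0 < n)%N -> (0 < k)%N ->
  ((n%:R)%:E * logabs x <= (k%:R)%:E * logabs y + c%:E)%E ->
  cabs x ^+ n <= expR c * cabs y ^+ k.
Proof.
move=> n0 k0; have [->|x0] := eqVneq x 0.
  by rewrite cabs0 expr0n (negbTE (lt0n_neq0 n0)) mulr_ge0 ?expR_ge0 ?exprn_ge0 ?cabs_ge0.
have [->|y0] := eqVneq y 0; first by rewrite logabs0 natr_mule_ninfty //= logabsE.
rewrite !logabsE // -!EFinM -EFinD lee_fin => h.
have : expR (n%:R * ln (cabs x)) <= expR (k%:R * ln (cabs y) + c) by rewrite ler_expR.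
by rewrite expRD !expRM_natl mulrC !lnK ?posrE ?cabs_gt0.
Qed.

Lemma le_logabs (x y : R[i]) (n k : nat) (c : R) : (0 < n)%N -> (0 < k)%N ->
  cabs x ^+ n <= expR c * cabs y ^+ k ->
  ((n%:R)%:E * logabs x <= (k%:R)%:E * logabs y + c%:E)%E.
Proof.
move=> n0 k0; have [->|x0] := eqVneq x 0; first by rewrite logabs0 natr_mule_ninfty ?leNye.
have xn0 : 0 < cabs x ^+ n by rewrite exprn_gt0 // cabs_gt0.
have [->|y0] := eqVneq y 0.
  by rewrite cabs0 expr0n (negbTE (lt0n_neq0 k0)) mulr0 leNgt xn0.
rewrite !logabsE // -!EFinM -EFinD lee_fin => h.
rewrite -ler_expR expRD !expRM_natl mulrC.
by rewrite !lnK ?posrE ?cabs_gt0.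
Qed.

Variables (I : finType) (a : I -> R[i]) (m : I -> nat).
Hypothesis a1 : forall j, cabs (a j) < 1.
Hypothesis a_inj : injective a.
Hypothesis m_gt0 : forall j, (0 < m j)%N.
Local Notation lnB := (blaschke_ln a m).
Local Notation B := (blaschke a m).

Definition max_formula (z : R[i] * R[i]) : \bar R :=
  Order.max (\sum_(j : I) ((m j)%:R)%:E * logabs (mobius (a j) z.1))%E (logabs z.2).

Lemma sum_logabs (f : I -> R[i]) : (forall j, f j != 0) ->
  (\sum_(j : I) ((m j)%:R)%:E * logabs (f j))%E = (\sum_j (m j)%:R * ln (cabs (f j)))%:E.
Proof.
by move=> f0; rewrite -sumEFin; apply: eq_bigr => j _; rewrite logabsE.
Qed.

Lemma sum_logabs_eq_ninfty (f : I -> R[i]) (l : I) : f l = 0 ->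
  (\sum_(j : I) ((m j)%:R)%:E * logabs (f j))%E = -oo%E.
Proof.
move=> fl0; rewrite (bigD1 l) //= fl0 logabs0 natr_mule_ninfty; last exact: m_gt0.
by rewrite addNye.
Qed.

Lemma max_formula_pole (l : I) (w : R[i]) : max_formula (a l, w) = logabs w.
Proof.
rewrite /max_formula /= (@sum_logabs_eq_ninfty _ l) ?maxNye //.
by apply/eqP; rewrite mobius_eq0.
Qed.

Lemma max_formula_generic (z : R[i] * R[i]) : cabs z.1 < 1 -> (forall j, z.1 != a j) ->
  max_formula z = Order.max (lnB z.1)%:E (logabs z.2).
Proof.
move=> z1 zna; rewrite /max_formula sum_logabs // => j.
by rewrite mobius_eq0.
Qed.

(** Without poles the first entry of the maximum is 0 and negativity suffices. Over a pole the
    vertical disc is used, with log|w| as majorant. Elsewhere [graph_le] covers |z_2| < |B(z_1)|,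
    and it supplies the inner boundary values for the annulus argument in the remaining case. *)
Lemma psh_neg_le (u : R[i] * R[i] -> \bar R) (z : R[i] * R[i]) :
  psh_on (@bidisc R) u -> (forall x, bidisc x -> (u x < 0)%E) ->
  (forall j, pole_cond (a j, 0) (m j) u) -> bidisc z -> (u z <= max_formula z)%E.
Proof.
move=> psh_u u0 pole_u; case: z => z1 z2 [/= z11 z21].
rewrite /unit_disc /= in z11 z21.
have bi : bidisc (z1, z2) by split.
have [I0|I0] := posnP #|I|.
  rewrite /max_formula big_pred0 ?le_max ?(ltW (u0 _ bi)) // => j.
  by have /card0_eq /(_ j) := I0; rewrite !inE.
have [/existsP[l /eqP zl]|/existsPn zna] := boolP [exists l, z1 == a l].
  rewrite zl max_formula_pole.
  have [c /nbhs_cabs2P[e e0 eP]] := pole_u l.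
  (* The neighbourhood in the pole condition contains the pole itself, where the condition forces u
     = -oo. *)
  have [z20|z20] := eqVneq z2 0.
    have := eP (a l, 0); rewrite /= !subrr cabs0 => /(_ e0 e0).
    by rewrite z20 /Psi /= !logabs0 natr_mule_ninfty // maxxx.
  have near_pole w : cabs w < e -> 0 < cabs w -> (u (a l, w) <= (ln (cabs w) + c)%:E)%E.
    move=> we w0; have := eP (a l, w); rewrite /= subrr subr0 cabs0 => /(_ e0 we).
    rewrite /Psi /= logabs0 natr_mule_ninfty // maxNye logabsE -?cabs_gt0 //.
  rewrite logabsE //; have w0 : 0 < cabs z2 by rewrite cabs_gt0.
  have ln0 : ln (cabs z2) <= 0 by exact: ln_le0 (ltW z21).
  have main eta de : 0 < eta -> 0 < de < 1 -> (u (a l, z2) <= (eta + (1 - de) * ln (cabs z2))%:E)%E.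
    move=> eta0 /andP[de0 de1]; apply: (@slice_le R u psh_u u0 (a l) 0 eta (1 - de)) => //; last exact: cabs_ge0.
      by rewrite subr_ge0 (ltW de1) gerBl ltW.
    (* Once log|w| <= -|c|/de, the constant c of the pole condition is at most -de log|w|. *)
    exists (Num.min e (expR (- (`|c| / de)))); first by rewrite lt_min e0 expR_gt0.
    move=> w w1 w_gt0 /andP[_]; rewrite add0r lt_min => /andP[we wc].
    apply: (le_trans (near_pole w we w_gt0)); rewrite lee_fin.
    have : ln (cabs w) <= - (`|c| / de).
      by rewrite -(expRK (- _)) ler_ln ?posrE ?expR_gt0 // ltW.
    rewrite lerNr ler_pdivrMr // mulrBl mul1r (mulrC _ de) mulrN; have := ler_norm c; lra.
  apply/lee_addgt0Pr => eps eps0; rewrite -EFinD.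
  pose L := - ln (cabs z2); have L0 : 0 <= L by rewrite oppr_ge0.
  have de0 : 0 < Num.min (1 / 2) (eps / 2 / (L + 1)).
    by rewrite lt_min !divr_gt0 // ltr_wpDl.
  have := main (eps / 2) (Num.min (1 / 2) (eps / 2 / (L + 1))).
  rewrite de0 divr_gt0 // => /(_ isT) H; apply: le_trans (H _) _.
    by rewrite /= gt_min; apply/orP; left; lra.
  rewrite lee_fin.
  have : Num.min (1 / 2) (eps / 2 / (L + 1)) * L <= eps / 2.
    rewrite (@le_trans _ _ (eps / 2 / (L + 1) * L)) //.
      by rewrite ler_wpM2r // ge_min lexx orbT.
    by rewrite mulrAC ler_pdivrMr ?ltr_wpDl // ler_wpM2l ?divr_ge0 ?(ltW eps0) // lerDl.
  rewrite mulrBl mul1r /L mulrN; lra.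
have graph w : cabs w < cabs (B z1) -> (u (z1, w) <= (lnB z1)%:E)%E.
  by move=> wB; apply: (@graph_le R I a m a1 a_inj m_gt0 u).
rewrite max_formula_generic // le_max /=.
have [zB|zB] := ltP (cabs z2) (cabs (B z1)); first by rewrite graph.
have B0 : 0 < cabs (B z1) by rewrite cabs_gt0 blaschke_neq0.
have z20 : 0 < cabs z2 by exact: lt_le_trans zB.
apply/orP; right; rewrite logabsE -?cabs_gt0 //.
apply/lee_addgt0Pr => eps eps0; rewrite -EFinD addrC -[ln (cabs z2)]mul1r.
(* On the thin annulus ka |B(z_1)| <= |w| < |B(z_1)| the strict inequality required by [graph_le]
   holds, and log|B(z_1)| exceeds log|w| by at most eps. *)
pose ka := expR (- eps).
have ka1 : ka < 1 by rewrite expR_lt1 oppr_lt0.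
have ka0 : 0 < ka := expR_gt0 _.
apply: (@slice_le R u psh_u u0 z1 (ka * cabs (B z1)) eps 1) => //.
- by rewrite mulr_ge0 ?cabs_ge0 ?(ltW ka0).
- by rewrite ler01 lexx.
- exists ((1 - ka) * cabs (B z1)); first by rewrite mulr_gt0 // subr_gt0.
  move=> w w1 w0 /andP[h1 h2]; apply: le_trans (graph w _) _.
    by move: h2; rewrite -mulrDl addrC subrK mul1r.
  rewrite lee_fin mul1r -lerBlDl -(expRK (lnB z1)) (expR_blaschke_ln m a1 z11 zna).
  have -> : ln (cabs (B z1)) - eps = ln (ka * cabs (B z1)).
    by rewrite lnM ?posrE // expRK addrC.
  by rewrite ler_ln ?posrE // mulr_gt0.
- by apply: le_trans zB; rewrite ler_piMl ?cabs_ge0 // ltW.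
Qed.

(** The pole conditions say that phi2 and phi1 - a_j, the latter raised to the power m_j, are O(|t -
    ze_j|^m_j). So phi2 and B o phi1 satisfy the hypotheses of [schwarz_zeros] with zeros ze_j of
    order m_j. *)
Lemma max_formula_le (z : R[i] * R[i]) (ze : I -> R[i]) (phi1 phi2 : R[i] -> R[i]) :
  (forall j, unit_disc (ze j)) ->
  holo_on (@unit_disc R) phi1 -> holo_on (@unit_disc R) phi2 ->
  (forall t, unit_disc t -> bidisc (phi1 t, phi2 t)) -> (phi1 0, phi2 0) = z ->
  (forall j, exists c : R, \forall t \near (ze j : C),
     (Psi (m j) ((phi1 t - a j)%R, (phi2 t - 0)%R) <=
       ((m j)%:R)%:E * logabs (t - ze j)%R + c%:E)%E) ->
  (max_formula z <= \sum_(j : I) ((m j)%:R)%:E * logabs (ze j))%E.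
Proof.
move=> ze1 d1 d2 bi zE pole.
have D0 : unit_disc (0 : R[i]) by rewrite /unit_disc /= cabs0.
have bnd j : exists2 c : R, 0 < c & \forall t \near (ze j : C),
    cabs (phi1 t - a j) ^+ m j <= c * cabs (t - ze j) ^+ m j /\
    cabs (phi2 t) <= c * cabs (t - ze j) ^+ m j.
  have [c cP] := pole j; exists (expR c); first exact: expR_gt0.
  apply: filterS cP => t; rewrite /Psi ge_max /= subr0 => /andP[h1 h2].
  split; first exact: logabs_bound h1.
  have := @logabs_bound (phi2 t) (t - ze j) 1 (m j) c isT (m_gt0 j).
  by rewrite mul1e expr1; apply.
(* Evaluating the condition at its own centre shows that the disc passes through the poles, so the
   ze_j are distinct because the a_j are. *)
have phi1_ze j : phi1 (ze j) = a j.
  have [c c0 /nbhs_cabsP[e e0 /(_ (ze j))]] := bnd j.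
  rewrite subrr cabs0 => /(_ e0)[+ _]; rewrite (expr0n _ (m j)) (negbTE (lt0n_neq0 (m_gt0 j))) mulr0.
  move=> h; have : cabs (phi1 (ze j) - a j) ^+ m j == 0 by rewrite eq_le h exprn_ge0 ?cabs_ge0.
  by rewrite expf_eq0 m_gt0 cabs_eq0 subr_eq0 => /eqP.
have ze_inj : injective ze by move=> i j zij; apply: a_inj; rewrite -!phi1_ze zij.
have h2 : cabs (phi2 0) <= \prod_j cabs (ze j) ^+ m j.
  apply: schwarz_zeros => //.
    by move=> t t1; have [_ h] := bi t t1; exact: ltW.
  move=> j; have [c c0 cP] := bnd j; exists c => //.
  by apply: filterS cP => t [].
have h1 : cabs (B (phi1 0)) <= \prod_j cabs (ze j) ^+ m j.
  apply: (@schwarz_zeros R I ze m ze1 ze_inj m_gt0 (B \o phi1)).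
  - move=> t t1; have [p1 _] := bi t t1; have db := @derivable_blaschke R I a m _ a1 p1.
    exact: (derivable_comp_C (d1 t t1) db).
  - move=> t t1; have [p1 _] := bi t t1; rewrite /= /blaschke cabs_prod.
    have : \prod_j cabs (mobius (a j) (phi1 t) ^+ m j) <= \prod_(j : I) 1.
      apply: ler_prod => j _; rewrite cabs_ge0 cabsX exprn_ile1 ?cabs_ge0 //.
      by rewrite ltW // cabs_mobius_lt1.
    by rewrite [X in _ <= X -> _]big1.
  - move=> j; have [c c0 cP] := bnd j.
    have A1 : 0 < 1 - cabs (a j) by rewrite subr_gt0.
    exists ((1 - cabs (a j)) ^- m j * c); first by rewrite mulr_gt0 // invr_gt0 exprn_gt0.
    have near_ze : \forall t \near (ze j : C), unit_disc t.
      apply/nbhs_cabsP; exists (1 - cabs (ze j)); first by rewrite subr_gt0; exact: ze1.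
      move=> y yz; have := cabsD (y - ze j) (ze j); rewrite subrK /unit_disc /=; lra.
    near=> t.
    have t1 : unit_disc t by near: t.
    have [p1 _] := bi t t1; rewrite /unit_disc /= in p1.
    have [h1 _] : cabs (phi1 t - a j) ^+ m j <= c * cabs (t - ze j) ^+ m j /\
      cabs (phi2 t) <= c * cabs (t - ze j) ^+ m j by near: t.
    apply: le_trans (@cabs_blaschke_le_factor R I a m a1 _ j p1) _.
    rewrite -mulrA; apply: le_trans (ler_wpM2l _ h1); last by rewrite invr_ge0 exprn_ge0 // ltW.
    rewrite -exprVn -exprMn ler_pXn2r ?nnegrE ?cabs_ge0 ?mulr_ge0 ?invr_ge0 ?cabs_ge0 ?(ltW A1) //.
    rewrite cabs_mobius mulrC cabsB ler_pM ?invr_ge0 ?cabs_ge0 // lef_pV2 ?posrE //.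
      have := cabsD (1 - (a j)^* * phi1 t) ((a j)^* * phi1 t); rewrite subrK cabs1 cabsM cabs_conj.
      have : cabs (a j) * cabs (phi1 t) <= cabs (a j) * 1 by rewrite ler_wpM2l ?cabs_ge0 // ltW.
      lra.
    by rewrite cabs_gt0 mobius_den_neq0 // ltW.
rewrite -zE; have [b1 b2] := bi 0 D0.
rewrite /unit_disc /= in b1 b2.
(* If some ze_l is 0, then z is the pole (a_l, 0) itself and the formula is -oo. *)
have [/existsP[l /eqP zl]|/existsPn zn0] := boolP [exists l, ze l == 0].
  have pl : \prod_j cabs (ze j) ^+ m j = 0.
    by rewrite (bigD1 l) //= zl cabs0 expr0n (negbTE (lt0n_neq0 (m_gt0 l))) mul0r.
  have p2 : phi2 0 = 0.
    by apply/eqP; rewrite -cabs_eq0 eq_le cabs_ge0 andbT -pl.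
  by rewrite -zl phi1_ze max_formula_pole zl p2 logabs0 leNye.
have prod0 : 0 < \prod_j cabs (ze j) ^+ m j.
  by apply: prodr_gt0 => j _; rewrite exprn_gt0 // cabs_gt0 zn0.
have -> : (\sum_(j : I) ((m j)%:R)%:E * logabs (ze j))%E = (ln (\prod_j cabs (ze j) ^+ m j))%:E.
  rewrite sum_logabs //; congr EFin; rewrite -[LHS]expRK; congr (ln _).
  rewrite expR_sum; apply: eq_bigr => j _.
  by rewrite expRM_natl lnK // posrE cabs_gt0 zn0.
have log2 : (logabs (phi2 0%R) <= (ln (\prod_j cabs (ze j) ^+ m j))%:E)%E.
  have [->|p0] := eqVneq (phi2 0) 0; first by rewrite logabs0 leNye.
  by rewrite logabsE // lee_fin ler_ln ?posrE // cabs_gt0.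
have [/existsP[l /eqP pl]|/existsPn pna] := boolP [exists l, phi1 0 == a l].
  by rewrite pl max_formula_pole.
rewrite max_formula_generic // ge_max log2 andbT /= lee_fin.
by rewrite -(expRK (lnB _)) expR_blaschke_ln // ler_ln ?posrE // cabs_gt0 blaschke_neq0.
Unshelve. all: by end_near. Qed.

End UpperAndLowerBounds.

(** * Construction of extremal discs for the Lempert function *)

Section ExtremalDiscs.
Variable R : realType.
Local Notation C := ((R[i])^o).

Lemma eq_logabs (x y : R[i]) : cabs x = cabs y -> logabs x = logabs y.
Proof. by move=> xy; rewrite /logabs -cabs_eq0 xy cabs_eq0. Qed.

Lemma cabs_mobius_le (a z : R[i]) : cabs a < 1 -> cabs z < 1 ->
  cabs (mobius a z) <= (1 - cabs a)^-1 * cabs (z - a).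
Proof.
move=> a1 z1; rewrite cabs_mobius mulrC cabsB ler_pM ?invr_ge0 ?cabs_ge0 //.
rewrite lef_pV2 ?posrE ?subr_gt0 // ?cabs_gt0 ?mobius_den_neq0 ?(ltW z1) //.
have := cabsD (1 - a^* * z) (a^* * z); rewrite subrK cabs1 cabsM cabs_conj.
have : cabs a * cabs z <= cabs a * 1 by rewrite ler_wpM2l ?cabs_ge0 // ltW.
lra.
Qed.

Lemma derivable_lipschitz (f : R[i] -> R[i]) (z : R[i]) :
  derivable (f : C -> C) (z : C) 1 -> exists2 K : R, 0 < K &
  \forall t \near (z : C), cabs (f t - f z) <= K * cabs (t - z).
Proof.
move=> /derivable_linear_error_C[D /(_ _ ltr01)[d d0 dP]].
exists (cabs D + 1); first by rewrite ltr_wpDl ?cabs_ge0.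
apply/nbhs_cabsP; exists d => // t td; have := dP _ td; rewrite (addrC z) subrK mul1r => h.
rewrite -[f t - f z](subrK (D * (t - z))) (le_trans (cabsD _ _)) //.
by rewrite mulrDl mul1r addrC lerD // cabsM.
Qed.

Section Witness.
Variables (I : finType) (a : I -> R[i]) (m : I -> nat).
Hypothesis a1 : forall j, cabs (a j) < 1.
Hypothesis m_gt0 : forall j, (0 < m j)%N.

(** The disc is t -> (mobius z_1 (psi t), c B_ze(t)), B_ze being the Blaschke product of the ze_j.
    The Moebius involution sends psi(ze_j) to a_j, and the second component vanishes to order m_j at
    ze_j. *)
Lemma lempert_le_sum (z : R[i] * R[i]) (psi : R[i] -> R[i]) (ze : I -> R[i]) :
  bidisc z -> holo_on (@unit_disc R) psi -> psi 0 = 0 ->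
  (forall t, cabs t < 1 -> cabs (psi t) < 1) -> (forall j, cabs (ze j) < 1) ->
  (forall j, psi (ze j) = mobius z.1 (a j)) ->
  cabs z.2 <= \prod_j cabs (ze j) ^+ m j ->
  (lempert (fun j => (a j, 0%R)) m z <= \sum_(j : I) ((m j)%:R)%:E * logabs (ze j))%E.
Proof.
case: z => z1 z2 [/= z11 z21] dpsi psi0 psi1 ze1 psize z2le.
rewrite /unit_disc /= in z11 z21.
apply: ereal_inf_lbound; exists ze => //; split=> [j|]; first exact: ze1.
(* Scales the second component so that the disc starts at z. If the product vanishes at 0, then z_2
   = 0, and division by zero gives c = 0 as required. *)
pose c := z2 / blaschke ze m 0.
have B0 : cabs (blaschke ze m 0) = \prod_j cabs (ze j) ^+ m j.
  by rewrite /blaschke cabs_prod; apply: eq_bigr => j _; rewrite cabsX mobius0.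
have cB : c * blaschke ze m 0 = z2.
  rewrite /c; have [b0|b0] := eqVneq (blaschke ze m 0) 0; last by rewrite divfK.
  rewrite b0 mulr0; apply/esym/eqP; rewrite -cabs_eq0 eq_le cabs_ge0 andbT.
  by rewrite (le_trans z2le) // -B0 b0 cabs0.
have c1 : cabs c <= 1.
  rewrite /c cabsM cabsV; have [b0|b0] := eqVneq (cabs (blaschke ze m 0)) 0.
    by rewrite b0 invr0 mulr0 ler01.
  by rewrite ler_pdivrMr ?mul1r ?B0 // -B0 lt0r b0 cabs_ge0.
have dphi1 t : cabs t < 1 -> derivable ((fun t => mobius z1 (psi t)) : C -> C) (t : C) 1.
  move=> t1; apply: (@derivable_comp_C R psi (mobius z1)); first exact: dpsi.
  by apply: derivable_mobius => //; exact: psi1.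
exists (fun t => mobius z1 (psi t)), (fun t => c * blaschke ze m t); split.
- exact: dphi1.
- move=> t t1; apply: (@derivableM R[i] C (cst c) (blaschke ze m)); first exact: derivable_cst.
  exact: derivable_blaschke.
- move=> t t1; split; rewrite /unit_disc /=; first by rewrite cabs_mobius_lt1 ?psi1.
  (* The strict bound |B_ze| < 1 requires a factor; without poles the product is 1 and the second
     component is the constant z_2. *)
  have [I0|I0] := posnP #|I|; last first.
    rewrite cabsM (@le_lt_trans _ _ (1 * cabs (blaschke ze m t))) //.
      by rewrite ler_wpM2r ?cabs_ge0.
    by rewrite mul1r cabs_blaschke_lt1.
  have E w : blaschke ze m w = 1.
    by rewrite /blaschke big_pred0 // => j; have /card0_eq /(_ j) := I0; rewrite !inE.
  by move: z21; rewrite -cB !E.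
- by rewrite psi0 mobius0 cB.
move=> j.
have phize : mobius z1 (psi (ze j)) = a j by rewrite psize mobiusK.
have [K K0 KP] := derivable_lipschitz (dphi1 _ (ze1 j)).
pose A := 1 - cabs (ze j); have A0 : 0 < A by rewrite subr_gt0.
(* K is a Lipschitz constant of the first component at ze_j, and A bounds the denominator of the
   j-th Blaschke factor from below. *)
pose k1 := ln (K ^+ m j); pose k2 := ln (A^-1 ^+ m j).
exists (Num.max k1 k2).
have near_D : \forall t \near (ze j : C), cabs t < 1.
  apply/nbhs_cabsP; exists A => // t tA; have := cabsD (t - ze j) (ze j); rewrite subrK.
  by move: tA; rewrite /A; lra.
near=> t.
have t1 : cabs t < 1 by near: t.
have Kt : cabs (mobius z1 (psi t) - mobius z1 (psi (ze j))) <= K * cabs (t - ze j) by near: t.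
rewrite phize in Kt.
rewrite /Psi /= subr0 ge_max; apply/andP; split.
  apply: (le_trans (@le_logabs R _ (t - ze j) (m j) (m j) k1 (m_gt0 j) (m_gt0 j) _)).
    rewrite lnK ?posrE ?exprn_gt0 // -exprMn ler_pXn2r ?nnegrE ?cabs_ge0 //.
    by rewrite mulr_ge0 ?cabs_ge0 // ltW.
  by apply: leeD2l; rewrite lee_fin le_max lexx.
rewrite -[X in (X <= _)%E]mul1e.
have -> : (1 : \bar R)%E = (1%:R)%:E by [].
apply: (le_trans (@le_logabs R _ (t - ze j) 1 (m j) k2 isT (m_gt0 j) _)).
  rewrite lnK ?posrE ?exprn_gt0 ?invr_gt0 // -exprMn expr1 cabsM.
  apply: (@le_trans _ _ (1 * cabs (blaschke ze m t))); first by rewrite ler_wpM2r ?cabs_ge0.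
  rewrite mul1r; apply: le_trans (@cabs_blaschke_le_factor R I ze m ze1 t j t1) _.
  rewrite ler_pXn2r ?nnegrE ?cabs_ge0 ?mulr_ge0 ?invr_ge0 ?cabs_ge0 ?(ltW A0) //.
  exact: cabs_mobius_le.
by apply: leeD2l; rewrite lee_fin le_max lexx orbT.
Unshelve. all: by end_near. Qed.

End Witness.

(* The equation psi_s ze = b, where psi_s ze = ze (ze + s) / (1 + s ze), reads
   ze ^ 2 + s (1 - b) ze - b = 0.  [root_sqr e s b] is the larger (e = 1) or the smaller
   (e = - 1) of the squared moduli of its two roots; it depends continuously on s. *)
Definition root_trace (s : R) (b : R[i]) : R :=
  (s ^+ 2 * cabs (1 - b) ^+ 2 + cabs ((s ^+ 2)%:C%C * (1 - b) ^+ 2 + b *+ 4)) / 2.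

Definition root_sqr (e s : R) (b : R[i]) : R :=
  (root_trace s b + e * Num.sqrt (root_trace s b ^+ 2 - 4 * cabs b ^+ 2)) / 2.

(** The squared moduli of the two roots have sum [root_trace s b], by the parallelogram law for the
    sum and difference of the roots, and product |b|^2, as the product of the roots is -b. So they
    solve a real quadratic equation, and no continuous choice of a complex square root is needed. *)
Lemma root_sqrP (e s : R) (b : R[i]) : e = 1 \/ e = -1 -> exists2 ze : R[i],
  cabs ze ^+ 2 = root_sqr e s b & ze * (ze + s%:C%C) = b * (1 + s%:C%C * ze).
Proof.
move=> e1; pose p := s%:C%C * (1 - b).
pose d := sqrtc (p ^+ 2 + b *+ 4); have d2 : d ^+ 2 = p ^+ 2 + b *+ 4 := sqr_sqrtc _.
pose r1 := (- p + d) / 2; pose r2 := (- p - d) / 2.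
have eq1 : r1 * (r1 + s%:C%C) = b * (1 + s%:C%C * r1).
  apply/subr0_eq; transitivity ((d ^+ 2 - (p ^+ 2 + b *+ 4)) / 4).
    by rewrite /r1 /p; field.
  by rewrite d2 subrr mul0r.
have eq2 : r2 * (r2 + s%:C%C) = b * (1 + s%:C%C * r2).
  apply/subr0_eq; transitivity ((d ^+ 2 - (p ^+ 2 + b *+ 4)) / 4).
    by rewrite /r2 /p; field.
  by rewrite d2 subrr mul0r.
have par (x y : R[i]) : cabs (x + y) ^+ 2 + cabs (x - y) ^+ 2 = 2 * (cabs x ^+ 2 + cabs y ^+ 2).
  by rewrite !sqr_cabs; case: x => x x'; case: y => y y' /=; ring.
have sumT : cabs r1 ^+ 2 + cabs r2 ^+ 2 = root_trace s b.
  have := par r1 r2.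
  have -> : r1 + r2 = - p by rewrite /r1 /r2; field.
  have -> : r1 - r2 = d by rewrite /r1 /r2; field.
  have -> : cabs d ^+ 2 = cabs ((s ^+ 2)%:C%C * (1 - b) ^+ 2 + b *+ 4).
    by rewrite -cabsX d2 /p exprMn rmorphXn.
  rewrite cabsN /p cabsM exprMn cabs_real real_normK ?num_real // /root_trace; lra.
have prodq : cabs r1 ^+ 2 * cabs r2 ^+ 2 = cabs b ^+ 2.
  rewrite -exprMn -cabsM.
  have -> : r1 * r2 = - b.
    apply/subr0_eq; transitivity (((p ^+ 2 + b *+ 4) - d ^+ 2) / 4).
      by rewrite /r1 /r2; field.
    by rewrite d2 subrr mul0r.
  by rewrite cabsN.
have disc : root_trace s b ^+ 2 - 4 * cabs b ^+ 2 = (cabs r1 ^+ 2 - cabs r2 ^+ 2) ^+ 2.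
  by rewrite -sumT -prodq; ring.
rewrite /root_sqr disc sqrtr_sqr -sumT.
have [r12|r12] := leP (cabs r2 ^+ 2) (cabs r1 ^+ 2).
  rewrite ger0_norm ?subr_ge0 //; case: e1 => ->; [exists r1 => //|exists r2 => //]; lra.
rewrite ltr0_norm ?subr_lt0 //; case: e1 => ->; [exists r2 => //|exists r1 => //]; lra.
Qed.

Lemma root_sqr0 e b : root_sqr e 0 b = cabs b.
Proof.
have b0 := cabs_ge0 b.
have T : root_trace 0 b = 2 * cabs b.
  rewrite /root_trace expr0n /= rmorph0 !mul0r !add0r -[b *+ 4]mulr_natl cabsM.
  have -> : cabs (4 : R[i]) = 4 by rewrite -[4 in LHS](rmorph_nat (real_complex R)) cabs_real ger0_norm.
  by field.
rewrite /root_sqr T; have -> : (2 * cabs b) ^+ 2 - 4 * cabs b ^+ 2 = 0 by ring.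
by rewrite sqrtr0; field.
Qed.

(** At s = 1 the equation factors as (ze + 1)(ze - b) = 0. *)
Lemma root_sqr1 e b : cabs b < 1 -> e = 1 \/ e = -1 ->
  root_sqr e 1 b = if e == 1 then 1 else cabs b ^+ 2.
Proof.
move=> b1 e1; have b0 := cabs_ge0 b.
have T : root_trace 1 b = 1 + cabs b ^+ 2.
  rewrite /root_trace expr1n mul1r.
  have -> : (1 : R)%:C%C * (1 - b) ^+ 2 + b *+ 4 = (1 + b) ^+ 2 by rewrite rmorph1; ring.
  by rewrite cabsX !sqr_cabs; case: b {b0 b1} => x y /=; field.
have D : (1 + cabs b ^+ 2) ^+ 2 - 4 * cabs b ^+ 2 = (1 - cabs b ^+ 2) ^+ 2 by ring.
rewrite /root_sqr T D sqrtr_sqr ger0_norm; last first.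
  by rewrite subr_ge0 expr_le1 // ltW.
case: e1 => ->; first by rewrite eqxx; field.
have -> : (-1 == 1 :> R) = false by apply/eqP; lra.
by field.
Qed.

(** If |ze| >= 1 then |ze + s| >= |1 + s ze|, so |psi_s(ze)| >= |ze| >= 1 > |b|. *)
Lemma root_lt1 (s : R) (b ze : R[i]) : 0 <= s < 1 -> cabs b < 1 ->
  ze * (ze + s%:C%C) = b * (1 + s%:C%C * ze) -> cabs ze < 1.
Proof.
move=> /andP[s0 s1] b1 E; rewrite ltNge; apply/negP => z1.
have cs : cabs s%:C%C = s by rewrite cabs_real ger0_norm.
have n0 : 0 < cabs (ze + s%:C%C).
  have := cabsD (ze + s%:C%C) (- s%:C%C); rewrite addrK cabsN cs; lra.
have sq : cabs (1 + s%:C%C * ze) <= cabs (ze + s%:C%C).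
  rewrite -(@ler_pXn2r _ 2) ?nnegrE ?cabs_ge0 // -subr_ge0.
  have -> : cabs (ze + s%:C%C) ^+ 2 - cabs (1 + s%:C%C * ze) ^+ 2 =
      (cabs ze ^+ 2 - 1) * (1 - s ^+ 2).
    by rewrite !sqr_cabs; case: ze {E z1 n0} => x y /=; ring.
  by rewrite mulr_ge0 // subr_ge0 ?expr_ge1 ?cabs_ge0 // expr_le1 // ltW.
have := congr1 (@cabs R) E; rewrite !cabsM => EE.
have h1 : cabs b * cabs (1 + s%:C%C * ze) <= cabs b * cabs (ze + s%:C%C).
  by rewrite ler_wpM2l ?cabs_ge0.
have h2 : cabs b * cabs (ze + s%:C%C) < 1 * cabs (ze + s%:C%C) by rewrite ltr_pM2r.
have h3 : 1 * cabs (ze + s%:C%C) <= cabs ze * cabs (ze + s%:C%C) by rewrite ler_wpM2r ?cabs_ge0.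
move: EE h1 h2 h3; lra.
Qed.

Lemma real_complex_continuous : continuous (fun x : R => x%:C%C : C).
Proof. by move=> x; apply: cvg_complex; [exact: cvg_id|exact: cvg_cst]. Qed.

Lemma root_sqr_continuous e b : continuous (fun s : R => root_sqr e s b).
Proof.
have cs2 : continuous (fun s : R => s ^+ 2) by exact: exprn_continuous.
have cT : continuous (fun s : R => root_trace s b).
  move=> s; apply: (@cvgMl R R); apply: cvgD; first by apply: (@cvgMl R R); exact: cs2.
  apply: (@continuous_comp R C R (fun s : R => (s ^+ 2)%:C%C * (1 - b) ^+ 2 + b *+ 4) (@cabs R));
    last exact: cabs_continuous.
  apply: (@cvgD _ C); last exact: cvg_cst.
  apply: (@cvgM R[i]); last exact: cvg_cst.
  apply: (@continuous_comp R R C (fun s : R => s ^+ 2) (fun x : R => x%:C%C)); first exact: cs2.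
  exact: real_complex_continuous.
move=> s; apply: (@cvgMl R R); apply: cvgD; first exact: cT.
apply: cvgMr.
apply: (@continuous_comp R R R (fun s : R => root_trace s b ^+ 2 - 4 * cabs b ^+ 2) Num.sqrt);
  last exact: sqrt_continuous.
apply: cvgB; last exact: cvg_cst.
by apply: (@continuous_comp R R R (fun s : R => root_trace s b) (fun x => x ^+ 2));
  [exact: cT|exact: exprn_continuous].
Qed.

Lemma continuous_bigprod (J : Type) (r : seq J) (f : J -> R -> R) :
  (forall j, continuous (f j)) -> continuous (fun s => \prod_(j <- r) f j s).
Proof.
move=> cf; elim: r => [|j r IHr] s.
  have -> : (fun s => \prod_(j <- [::]) f j s) = cst 1 by apply/funext => x; rewrite big_nil.
  exact: cst_continuous.
have -> : (fun s => \prod_(j <- j :: r) f j s) = (fun s => f j s * \prod_(j <- r) f j s).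
  by apply/funext => x; rewrite big_cons.
by apply: cvgM; [exact: cf|exact: IHr].
Qed.

Section Lempert.
Variables (I : finType) (a : I -> R[i]) (m : I -> nat).
Hypothesis a1 : forall j, cabs (a j) < 1.
Hypothesis m_gt0 : forall j, (0 < m j)%N.

(** Let p be the product of the |b_j|^m_j. As s goes from 0 to 1, the product of the squared root
    moduli runs continuously from p to 1 when the larger roots are used, and from p to p^2 with the
    smaller ones. Since p < rho < 1, the value rho^2 is met by one of the two families, at some s <
    1. *)
Lemma exists_roots (b : I -> R[i]) (rho : R) : (forall j, cabs (b j) < 1) ->
  \prod_j cabs (b j) ^+ m j < rho -> rho < 1 -> exists s (ze : I -> R[i]),
  [/\ 0 <= s < 1, forall j, ze j * (ze j + s%:C%C) = b j * (1 + s%:C%C * ze j) &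
      \prod_j cabs (ze j) ^+ m j = rho].
Proof.
move=> b1 brho rho1.
have rho0 : 0 <= rho.
  by apply: ltW; apply: le_lt_trans brho; apply: prodr_ge0 => j _; rewrite exprn_ge0 ?cabs_ge0.
pose F e s := \prod_j root_sqr e s (b j) ^+ m j.
have cF e : continuous (F e).
  apply: continuous_bigprod => j s.
  apply: (@continuous_comp R R R (fun s => root_sqr e s (b j)) (fun x => x ^+ m j)).
    exact: root_sqr_continuous.
  exact: exprn_continuous.
have F0 e : F e 0 = \prod_j cabs (b j) ^+ m j.
  by apply: eq_bigr => j _; rewrite root_sqr0.
have F1 : F 1 1 = 1.
  by rewrite /F big1 // => j _; rewrite root_sqr1 ?eqxx ?expr1n //; left.
have FN1 : F (-1) 1 = (\prod_j cabs (b j) ^+ m j) ^+ 2.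
  rewrite -prodrXl; apply: eq_bigr => j _; rewrite root_sqr1 //; last by right.
  have -> : (-1 == 1 :> R) = false by apply/eqP; lra.
  by rewrite exprAC.
have [e [e1 [s /andP[s0 s1] Fs]]] : exists e, (e = 1 \/ e = -1) /\
    exists2 s, 0 <= s < 1 & F e s = rho ^+ 2.
  have ivt e : Num.min (F e 0) (F e 1) <= rho ^+ 2 <= Num.max (F e 0) (F e 1) ->
      F e 1 != rho ^+ 2 -> exists2 s, 0 <= s < 1 & F e s = rho ^+ 2.
    move=> h hne; have [|s] := @IVT R (F e) 0 1 (rho ^+ 2) ler01 _ h.
      exact: continuous_subspaceT.
    rewrite in_itv /= => /andP[s0 s1] Fs; exists s => //; rewrite s0 lt_neqAle s1 andbT.
    by apply: contraNneq hne => <-; rewrite Fs.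
  have p0 : 0 <= \prod_j cabs (b j) ^+ m j by apply: prodr_ge0 => j _; rewrite exprn_ge0 ?cabs_ge0.
  have rho21 : rho ^+ 2 < 1 by rewrite exprn_ilt1.
  have brho2 : (\prod_j cabs (b j) ^+ m j) ^+ 2 < rho ^+ 2 by rewrite ltr_pXn2r.
  have [h|h] := leP (\prod_j cabs (b j) ^+ m j) (rho ^+ 2).
    exists 1; split; [by left|apply: ivt; rewrite ?F0 F1].
      by rewrite ge_min le_max h (ltW rho21) orbT.
    by rewrite gt_eqF.
  exists (-1); split; [by right|apply: ivt; rewrite ?F0 FN1].
    by rewrite ge_min le_max (ltW h) (ltW brho2) orbT.
  by rewrite lt_eqF.
have /choice[ze zeP] : forall j, exists ze, cabs ze ^+ 2 = root_sqr e s (b j) /\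
    ze * (ze + s%:C%C) = b j * (1 + s%:C%C * ze).
  by move=> j; have [ze ? ?] := @root_sqrP e s (b j) e1; exists ze.
exists s, ze; split; [by rewrite s0|by move=> j; have [] := zeP j|].
apply/eqP; rewrite -(@eqrXn2 _ 2) //; last by apply: prodr_ge0 => j _; rewrite exprn_ge0 ?cabs_ge0.
rewrite -Fs /F -prodrXl; apply/eqP; apply: eq_bigr => j _.
by have [<- _] := zeP j; rewrite exprAC.
Qed.

(** If |z_2| <= |B(z_1)|, psi = id gives the value log|B(z_1)|. Otherwise [exists_roots] with rho =
    |z_2| provides psi_s and points ze_j for which the sum is log|z_2|. *)
Lemma lempert_le (z : R[i] * R[i]) : bidisc z ->
  (lempert (fun j => (a j, 0%R)) m z <= max_formula a m z)%E.
Proof.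
move=> bz; have [z11 z21] := bz; rewrite /unit_disc /= in z11 z21.
pose b j := mobius z.1 (a j).
have b1 j : cabs (b j) < 1 by exact: cabs_mobius_lt1.
have [zb|zb] := leP (cabs z.2) (\prod_j cabs (b j) ^+ m j).
  have did : holo_on (@unit_disc R) id by move=> t _; exact: derivable_id.
  apply: (le_trans (@lempert_le_sum I a m a1 m_gt0 z id b bz did erefl (fun=> id) b1 (fun=> erefl) zb)).
  rewrite /max_formula le_max; apply/orP; left; rewrite le_eqVlt; apply/orP; left; apply/eqP.
  by apply: eq_bigr => j _; congr (_ * _)%E; apply: eq_logabs; rewrite cabs_mobiusC.
have [s [ze [s01 zeP zerho]]] := exists_roots b1 zb z21.
have [s0 s1] := andP s01.
have ze1 j : cabs (ze j) < 1 by exact: (root_lt1 s01 (b1 j) (zeP j)).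
have cs : cabs (- s%:C%C) < 1 by rewrite cabsN cabs_real ger0_norm.
(* This is psi_s, written so that holomorphy and the bound by 1 come from those of Moebius maps. *)
pose psi t := - (t * mobius (- s%:C%C) t).
have psiE t : cabs t < 1 -> psi t = t * (t + s%:C%C) / (1 + s%:C%C * t).
  move=> t1; have := mobius_den_neq0 cs (ltW t1); rewrite /psi /mobius.
  have -> : (- s%:C%C)^* = - s%:C%C by rewrite conjE rmorphN /= oppr0.
  by rewrite mulNr opprK => d0; field.
have dpsi : holo_on (@unit_disc R) psi.
  move=> t t1; apply: derivableN.
  apply: (@derivableM R[i] C (fun t => t) (mobius (- s%:C%C))); first exact: derivable_id.
  exact: derivable_mobius.
have psi0 : psi 0 = 0 by rewrite /psi mul0r oppr0.
have psi1 t : cabs t < 1 -> cabs (psi t) < 1.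
  move=> t1; rewrite cabsN cabsM (@le_lt_trans _ _ (cabs t * 1)) ?mulr1 //.
  by rewrite ler_piMr ?cabs_ge0 // ltW // cabs_mobius_lt1.
have psize j : psi (ze j) = b j.
  rewrite psiE ?ze1 // zeP mulfK //.
  have := mobius_den_neq0 cs (ltW (ze1 j)).
  have -> : (- s%:C%C)^* = - s%:C%C by rewrite conjE rmorphN /= oppr0.
  by rewrite mulNr opprK.
apply: (le_trans (@lempert_le_sum I a m a1 m_gt0 z psi ze bz dpsi psi0 psi1 ze1 psize _)).
  by rewrite zerho.
have z20 : 0 < cabs z.2.
  by apply: le_lt_trans zb; apply: prodr_ge0 => j _; rewrite exprn_ge0 ?cabs_ge0.
have ze0 j : ze j != 0.
  apply/eqP => zj; move: z20; rewrite -zerho (bigD1 j) //= zj cabs0 expr0n.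
  by rewrite (negbTE (lt0n_neq0 (m_gt0 j))) mul0r ltxx.
rewrite /max_formula le_max; apply/orP; right.
rewrite sum_logabs // logabsE -?cabs_gt0 // lee_fin -zerho le_eqVlt; apply/orP; left; apply/eqP.
rewrite -[LHS]expRK expR_sum; congr (ln _); apply: eq_bigr => j _.
by rewrite expRM_natl lnK // posrE cabs_gt0 ze0.
Qed.

End Lempert.
End ExtremalDiscs.

(** * The sub-mean value property of log|B|, zeros included *)

Section Subharmonicity.
Variable R : realType.
Local Notation C := ((R[i])^o).
Notation mu := (@lebesgue_measure R).

Lemma logabsM (x y : R[i]) : logabs (x * y) = (logabs x + logabs y)%E.
Proof.
have [->|x0] := eqVneq x 0; first by rewrite mul0r !logabs0 addNye.
have [->|y0] := eqVneq y 0; first by rewrite mulr0 !logabs0 addeNy.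
by rewrite !logabsE ?mulf_neq0 // cabsM lnM ?posrE ?cabs_gt0.
Qed.

Lemma logabs1 : logabs (1 : R[i]) = 0%E.
Proof. by rewrite logabsE ?oner_eq0 // cabs1 ln1. Qed.

Lemma logabsX (x : R[i]) n : logabs (x ^+ n) = ((n%:R)%:E * logabs x)%E.
Proof.
have [->|x0] := eqVneq x 0.
  by case: n => [|n]; rewrite ?expr0 ?mul0e ?logabs1 // expr0n logabs0 natr_mule_ninfty.
rewrite !logabsE ?expf_neq0 // -EFinM cabsX; congr EFin.
by rewrite lnXn ?cabs_gt0 // mulr_natl.
Qed.

Lemma logabs_blaschke (I : finType) (a : I -> R[i]) (m : I -> nat) z :
  logabs (blaschke a m z) = (\sum_(j : I) ((m j)%:R)%:E * logabs (mobius (a j) z))%E.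
Proof.
rewrite /blaschke (big_morph (@logabs R) logabsM logabs1).
by apply: eq_bigr => j _; rewrite logabsX.
Qed.

Lemma logabs_lt (x : R[i]) (t : R) : (logabs x < t%:E)%E = (cabs x < expR t).
Proof.
have [->|x0] := eqVneq x 0; first by rewrite logabs0 cabs0 expR_gt0 ltNyr.
by rewrite logabsE // lte_fin -[LHS]ltr_expR lnK // posrE cabs_gt0.
Qed.

Lemma le_logabs_cabs (x y : R[i]) : cabs x <= cabs y -> (logabs x <= logabs y)%E.
Proof.
move=> xy; have := @le_logabs R x y 1 1 0 isT isT.
by rewrite !mul1e adde0 expR0 mul1r !expr1; apply.
Qed.

Lemma logabs_le0 (x : R[i]) : cabs x <= 1 -> (logabs x <= 0)%E.
Proof. by move=> x1; rewrite -logabs1 le_logabs_cabs // cabs1. Qed.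

Lemma fine_logabs (x : R[i]) : fine (logabs x) = ln (cabs x).
Proof.
by have [->|x0] := eqVneq x 0; [rewrite logabs0 cabs0 ln0|rewrite logabsE].
Qed.

(** The limit 0, with value -oo, is included, so that the final convergence also holds at the
    poles. *)
Lemma cvg_logabs (T : Type) (F : set_system T) (FF : Filter F) (f : T -> C) (l : C) :
  f @ F --> l -> (fun t => logabs (f t)) @ F --> logabs l.
Proof.
move=> fl; have [l0|l0] := eqVneq (l : R[i]) 0.
  rewrite l0 logabs0; apply/cvgeNyPlt => A.
  have := iffLR (cvg_cabsP FF f l) fl _ (expR_gt0 A).
  by apply: filterS => t; rewrite l0 subr0 logabs_lt.
rewrite (logabsE l0); apply: cvg_EFin.
  have lp : 0 < cabs l by rewrite cabs_gt0.
  have := iffLR (cvg_cabsP FF f l) fl _ lp.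
  apply: filterS => t tl; rewrite logabsE //.
  by apply: contraTneq tl => ->; rewrite sub0r cabsN ltxx.
have -> : fine \o (fun t => logabs (f t)) = (@ln R) \o (@cabs R \o f).
  by apply/funext => t; rewrite /= fine_logabs.
apply: continuous_cvg; first by apply: continuous_ln; rewrite cabs_gt0.
by apply: continuous_cvg => //; exact: cabs_continuous.
Qed.

(** The function -log|g| is lower semicontinuous, even where g vanishes. *)
Lemma measurable_logabs (g : R -> R[i]) : continuous (g : R -> C) ->
  measurable_fun setT (fun t => - logabs (g t))%E.
Proof.
move=> cg; apply: lower_semicontinuous_measurable => x t.
rewrite lteNr -EFinN logabs_lt => gx.
exists [set y | cabs (g y) < expR (- t)]; last first.
  by move=> y /= gy; rewrite lteNr -EFinN logabs_lt.
have e0 : 0 < expR (- t) - cabs (g x) by rewrite subr_gt0.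
have := iffLR (cvg_cabsP (nbhs_filter x) (g : R -> C) (g x)) (cg x) _ e0.
apply: filterS => y gy /=; have := cabsD (g y - g x) (g x); rewrite subrK; lra.
Qed.

(** The denominator has no zero in the disc and contributes its exact mean value. So does the
    numerator if a lies outside the circle. If a lies inside, reflecting in the circle turns the
    mean of the logarithm of the numerator into log|be| > log|a - al|. *)
Lemma mobius_circle_integral_neq (a al be : R[i]) : cabs a < 1 -> cabs al + cabs be < 1 ->
  al != a -> cabs be != cabs (a - al) ->
  (\int[mu]_(t in `[0%R, (pi *+ 2)%R]) (- logabs (mobius a (al + expi t * be)%R))
    <= (pi *+ 2 * (- ln (cabs (mobius a al))))%:E)%E.
Proof.
move=> a1 albe ala beg; have p2 := pi2_gt0 R.
have ga0 : 0 < cabs (a - al) by rewrite cabs_gt0 subr_eq0 eq_sym.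
have be0 := cabs_ge0 be.
have al1 : cabs al < 1 by lra.
have zt t : cabs (al + expi t * be) < 1.
  by rewrite (le_lt_trans (cabsD _ _)) // cabsM cabs_expi mul1r.
have cx : continuous (fun t : R => al + expi t * be : C).
  move=> t; apply: (@cvgD _ C); first exact: cvg_cst.
  by apply: (@cvgM R[i]); [exact: expi_continuous|exact: cvg_cst].
have zn t : al + expi t * be != a.
  apply: contraNneq beg => h; apply/eqP.
  by rewrite -h addrC addKr cabsM cabs_expi mul1r.
pose G t := ln (cabs ((a - al) - be * expi t)).
pose H t := ln (cabs ((1 - a^* * al) - (a^* * be) * expi t)).
have E1 t : a - (al + expi t * be) = (a - al) - be * expi t by ring.
have E2 t : 1 - a^* * (al + expi t * be) = (1 - a^* * al) - (a^* * be) * expi t by ring.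
have Gn t : (a - al) - be * expi t != 0 by rewrite -E1 subr_eq0 eq_sym.
have Hn t : (1 - a^* * al) - (a^* * be) * expi t != 0 by rewrite -E2 mobius_den_neq0 // ltW.
have cl (x y : R[i]) : (forall t : R, x - y * expi t != 0) ->
    continuous (fun t => ln (cabs (x - y * expi t))).
  move=> xy t; apply: (@ln_cabs_continuous R R (fun t => x - y * expi t)) => //.
  apply: (@cvgB _ C); first exact: cvg_cst.
  by apply: (@cvgM R[i]); [exact: cvg_cst|exact: expi_continuous].
have cG : continuous_on_seg G 0 (pi *+ 2) by move=> t _; exact: cl.
have cH : continuous_on_seg H 0 (pi *+ 2) by move=> t _; exact: cl.
have mE t : (- logabs (mobius a (al + expi t * be)%R))%E = (H t - G t)%:E.
  rewrite logabsE ?mobius_eq0 ?zt // cabs_mobius E1 E2 ln_div ?posrE ?cabs_gt0 //.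
  by rewrite -EFinN opprB.
under eq_integral do rewrite mE.
rewrite (@integral_seg_int R (fun t => H t - G t)); last first.
  by move=> t t2; apply: continuousB; [exact: cH|exact: cG].
rewrite lee_fin seg_intB //.
have bal : cabs (a^* * be) < cabs (1 - a^* * al).
  have := cabsD (1 - a^* * al) (a^* * al); rewrite subrK cabs1 !cabsM cabs_conj.
  have : cabs a * (cabs al + cabs be) < 1 * 1.
    by apply: ltr_pM => //; rewrite ?cabs_ge0 // addr_ge0 // cabs_ge0.
  rewrite mulrDr; lra.
have -> : seg_int H 0 (pi *+ 2) = pi *+ 2 * ln (cabs (1 - a^* * al)).
  exact: circle_int_ln_cabsB.
have GE : pi *+ 2 * ln (cabs (a - al)) <= seg_int G 0 (pi *+ 2).
  have [bg|gb] := ltP (cabs be) (cabs (a - al)).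
    by rewrite -[seg_int _ _ _]/(circle_int G) circle_int_ln_cabsB.
  have gb' : cabs (a - al) < cabs be by rewrite lt_neqAle eq_sym beg.
  have -> : seg_int G 0 (pi *+ 2) = circle_int (fun t => ln (cabs (be^* - (a - al)^* * expi t))).
    apply: eq_seg_int => t _; rewrite /G; congr ln.
    rewrite cabsB -[LHS]cabs_conj; set w := a - al.
    have -> : (be * expi t - w)^* = (be^* - w^* * expi t) * (expi t)^*.
      have ee : expi t * (expi t)^* = 1 by rewrite mul_conj cabs_expi expr1n rmorph1.
      by rewrite mulrBl -mulrA ee mulr1 !conjE rmorphB rmorphM.
    by rewrite cabsM cabs_conj cabs_expi mulr1.
  have be_gt0 : 0 < cabs be by exact: lt_trans gb'.
  rewrite circle_int_ln_cabsB; last by rewrite !cabs_conj.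
  by rewrite cabs_conj ler_pM2l // ler_ln ?posrE // ltW.
rewrite cabs_mobius ln_div ?posrE // ?cabs_gt0 ?mobius_den_neq0 ?(ltW al1) //.
by rewrite opprB mulrBr lerD2l lerN2.
Qed.

(* When the circle passes through [a], apply the previous case to smaller circles and
   let the radius increase (Fatou). *)
Lemma mobius_circle_integral (a al be : R[i]) : cabs a < 1 -> cabs al + cabs be < 1 ->
  al != a ->
  (\int[mu]_(t in `[0%R, (pi *+ 2)%R]) (- logabs (mobius a (al + expi t * be)%R))
    <= (pi *+ 2 * (- ln (cabs (mobius a al))))%:E)%E.
Proof.
move=> a1 albe ala.
have [beg|] := eqVneq (cabs be) (cabs (a - al)); last exact: mobius_circle_integral_neq.
have be0 := cabs_ge0 be.
have be_gt0 : 0 < cabs be by rewrite beg cabs_gt0 subr_eq0 eq_sym.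
pose r n : R := 1 - (2^-1) ^+ n.+1.
have h0 n : 0 < (2^-1) ^+ n.+1 :> R by rewrite exprn_gt0.
have h1 n : (2^-1) ^+ n.+1 <= 1 :> R by rewrite exprn_ile1 // invf_le1 // ler1n.
have r0 n : 0 <= r n < 1 by rewrite /r; have := h0 n; have := h1 n => *; apply/andP; split; lra.
have cr n : cabs ((r n)%:C%C * be) < cabs be.
  have /andP[? ?] := r0 n.
  by rewrite cabsM cabs_real ger0_norm // -[ltRHS]mul1r ltr_pM2r.
pose N n t := (- logabs (mobius a (al + expi t * ((r n)%:C%C * be))%R))%E.
have zt n t : cabs (al + expi t * ((r n)%:C%C * be)) < 1.
  rewrite (le_lt_trans (cabsD _ _)) // cabsM cabs_expi mul1r.
  by have := cr n; lra.
have zt' t : cabs (al + expi t * be) < 1.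
  by rewrite (le_lt_trans (cabsD _ _)) // cabsM cabs_expi mul1r.
have cx (c : R[i]) : continuous (fun t : R => al + expi t * c : C).
  move=> t; apply: (@cvgD _ C); first exact: cvg_cst.
  by apply: (@cvgM R[i]); [exact: expi_continuous|exact: cvg_cst].
have mN n : measurable_fun `[0%R, (pi *+ 2)%R] (N n).
  apply: measurable_funTS; apply: measurable_logabs => t.
  apply: (@continuous_comp R C C (fun t => al + expi t * ((r n)%:C%C * be)) (mobius a)).
    exact: cx.
  exact: mobius_continuous.
have N0 n t : (0 <= N n t)%E.
  by rewrite oppe_ge0 logabs_le0 // ltW // cabs_mobius_lt1.
have rcvg : r @ \oo --> (1 : R).
  rewrite -[X in _ --> X]subr0; apply: cvgB; first exact: cvg_cst.
  have : (fun n => 2^-1 * (2^-1) ^+ n) @ \oo --> (2^-1 * 0 : R).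
    by apply: cvgMr; apply: cvg_expr; rewrite ger0_norm // invf_lt1 // ltr1n.
  by rewrite mulr0; under eq_fun do rewrite -exprS.
have Ncvg t : N^~ t @ \oo --> (- logabs (mobius a (al + expi t * be)%R))%E.
  apply: cvgeN; apply: cvg_logabs.
  have cm : {for (al + expi t * be : C), continuous (mobius a : C -> C)} by exact: mobius_continuous.
  apply: (@cvg_comp _ C C (fun n => al + expi t * ((r n)%:C%C * be)) (mobius a) \oo
    (nbhs (al + expi t * be : C))); last exact: cm.
  apply: (@cvgD _ C); first exact: cvg_cst.
  apply: (@cvgM R[i]); first exact: cvg_cst.
  rewrite -[X in _ --> X]mul1r; apply: (@cvgM R[i]); last exact: cvg_cst.
  have -> : (1 : R[i]) = (1 : R)%:C%C by [].
  apply: (@cvg_comp _ R C r (fun x => x%:C%C) \oo (nbhs (1 : R))); first exact: rcvg.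
  exact: real_complex_continuous.
have := @fatou _ _ R mu `[0%R, (pi *+ 2)%R] (measurable_itv _) N mN (fun n t _ => N0 n t).
have -> : (\int[mu]_(t in `[0%R, (pi *+ 2)%R]) limn_einf (N^~ t))%E =
    (\int[mu]_(t in `[0%R, (pi *+ 2)%R]) (- logabs (mobius a (al + expi t * be)%R)))%E.
  apply: eq_integral => t _.
  rewrite is_cvg_limn_einfE; first by apply: cvg_lim => //; exact: Ncvg.
  by apply/cvg_ex; eexists; exact: Ncvg.
move=> /le_trans; apply.
have bound n : (\int[mu]_(t in `[0%R, (pi *+ 2)%R]) N n t <=
    (pi *+ 2 * (- ln (cabs (mobius a al))))%:E)%E.
  apply: mobius_circle_integral_neq => //; first by have := cr n; lra.
  by rewrite lt_eqF // -beg.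
rewrite limn_einf_lim; apply: lime_le; first exact: is_cvg_einfs.
apply: nearW => n; apply: le_trans (bound n).
by apply: ereal_inf_lbound; exists n => /=.
Qed.

(** The logarithm of the product is minus a sum of nonnegative functions, so the integral can be
    split even though values +oo occur. When the centre is a zero the left side is -oo. *)
Lemma blaschke_submean (I : finType) (a : I -> R[i]) (m : I -> nat) (ka : R) (al be : R[i]) :
  (forall j, cabs (a j) < 1) -> (forall j, (0 < m j)%N) -> 0 < ka < 1 -> cabs al + cabs be < 1 ->
  (logabs (ka%:C%C * blaschke a m al)%R <= ((pi *+ 2)^-1)%:E *
     \int[mu]_(t in `[0%R, (pi *+ 2)%R]) logabs (ka%:C%C * blaschke a m (al + expi t * be)%R)%R)%E.
Proof.
move=> a1 m_gt0 /andP[ka0 ka1] albe; have p2 := pi2_gt0 R.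
have be0 := cabs_ge0 be.
have al1 : cabs al < 1 by lra.
have kaC : ka%:C%C != 0 :> R[i] by rewrite -cabs_eq0 cabs_real normr_eq0 gt_eqF.
have logka : logabs (ka%:C%C : R[i]) = (ln ka)%:E.
  by rewrite logabsE // cabs_real gtr0_norm.
have ka_ln : ln ka <= 0 by exact: ln_le0 (ltW ka1).
have [/existsP[l /eqP alal]|/existsPn alna] := boolP [exists l, al == a l].
  by rewrite logabsM logabs_blaschke (@sum_logabs_eq_ninfty R I m m_gt0 _ l) ?addeNy ?leNye //;
    apply/eqP; rewrite mobius_eq0 // alal.
pose N j t := (- logabs (mobius (a j) (al + expi t * be)%R))%E.
have zt t : cabs (al + expi t * be) < 1.
  by rewrite (le_lt_trans (cabsD _ _)) // cabsM cabs_expi mul1r.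
have cx : continuous (fun t : R => al + expi t * be : C).
  move=> t; apply: (@cvgD _ C); first exact: cvg_cst.
  by apply: (@cvgM R[i]); [exact: expi_continuous|exact: cvg_cst].
have N0 j t : (0 <= N j t)%E.
  by rewrite oppe_ge0 logabs_le0 // ltW // cabs_mobius_lt1.
have mN j : measurable_fun `[0%R, (pi *+ 2)%R] (N j).
  apply: measurable_funTS; apply: measurable_logabs => t.
  apply: (@continuous_comp R C C (fun t => al + expi t * be) (mobius (a j))); first exact: cx.
  exact: mobius_continuous.
pose W t := ((- ln ka)%:E + \sum_(j : I) ((m j)%:R)%:E * N j t)%E.
have mj0 j : (0 <= ((m j)%:R : R)%:E)%E by rewrite lee_fin.
have W0 t : (0 <= W t)%E.
  by rewrite adde_ge0 ?lee_fin ?oppr_ge0 // sume_ge0 // => j _; rewrite mule_ge0.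
have WE t : logabs (ka%:C%C * blaschke a m (al + expi t * be)%R) = (- W t)%E.
  rewrite logabsM logabs_blaschke logka /W oppeD; last by rewrite fin_num_adde_defr.
  rewrite -EFinN opprK; congr (_ + _)%E.
  rewrite -sumeN; first by apply: eq_bigr => j _; rewrite /N muleN oppeK.
  by move=> i j _ _; rewrite ge0_adde_def // inE mule_ge0.
have intW : (\int[mu]_(t in `[0%R, (pi *+ 2)%R]) W t <=
    (pi *+ 2 * - (ln ka + blaschke_ln a m al))%:E)%E.
  have mS j : measurable_fun `[0%R, (pi *+ 2)%R] (fun t => ((m j)%:R)%:E * N j t)%E.
    exact: measurable_funeM.
  rewrite ge0_integralD //; last 3 first.
  - by move=> t _; rewrite lee_fin oppr_ge0.
  - by move=> t _; rewrite sume_ge0 // => j _; rewrite mule_ge0.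
  - exact: emeasurable_sum.
  rewrite (@ge0_integral_sum _ _ R mu _ (measurable_itv _) I (fun j t => ((m j)%:R)%:E * N j t)%E) //; last first.
    by move=> j t _; rewrite mule_ge0.
  rewrite opprD mulrDr EFinD; apply: leeD.
    rewrite (@integral_seg_int R (cst (- ln ka))); last by move=> t _; exact: cst_continuous.
    by rewrite lee_fin (seg_int_cst _ (ltW p2)) subr0 mulrC.
  rewrite /blaschke_ln -sumrN mulr_sumr -sumEFin; apply: lee_sum => j _.
  rewrite ge0_integralZl_EFin //; last exact: mN.
  have := @mobius_circle_integral (a j) al be (a1 j) albe (alna j) => h.
  apply: (le_trans (lee_wpmul2l (mj0 j) h)); rewrite -EFinM lee_fin le_eqVlt.
  by apply/orP; left; apply/eqP; ring.
under eq_integral do rewrite WE.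
rewrite integral_ge0N; last by move=> t _; exact: W0.
have B0 : blaschke a m al != 0 by exact: blaschke_neq0.
rewrite logabsM logka logabsE // -EFinD -(expR_blaschke_ln m a1 al1 alna) expRK.
rewrite muleN leeNr; apply: (le_trans (lee_wpmul2l _ intW)).
  by rewrite lee_fin invr_ge0 ltW.
by rewrite -EFinM -EFinN lee_fin mulrA mulVf ?gt_eqF // mul1r.
Qed.

End Subharmonicity.

(** * The competitor for the Green function *)

Section GreenLowerBound.
Variable R : realType.
Local Notation C := ((R[i])^o).
Notation mu := (@lebesgue_measure R).

(* Rotate [ze * b] into the direction of [a]. *)
Lemma affine_disc_cabs (a b : R[i]) :
  (forall ze, cabs ze <= 1 -> cabs (a + ze * b) < 1) -> cabs a + cabs b < 1.
Proof.
move=> ab; have [a0|a0] := eqVneq a 0.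
  by have := ab 1; rewrite cabs1 lexx a0 mul1r add0r cabs0 add0r; exact.
have [b0|b0] := eqVneq b 0.
  by have := ab 0; rewrite b0 cabs0 mul0r !addr0; apply; exact: ler01.
have ca : cabs a != 0 by rewrite cabs_eq0.
have cb : cabs b != 0 by rewrite cabs_eq0.
have := ab (a * (cabs b / cabs a)%:C%C / b).
rewrite divfK // -[X in X + _]mulr1 -mulrDr -(rmorph1 (real_complex R)) -rmorphD.
rewrite !cabsM cabsV !cabs_real !ger0_norm ?addr_ge0 ?divr_ge0 ?cabs_ge0 ?ler01 //.
have -> : cabs a * (cabs b / cabs a) / cabs b = 1 by field; rewrite ca cb.
have -> : cabs a * (1 + cabs b / cabs a) = cabs a + cabs b by field.
by apply.
Qed.

Variables (I : finType) (a : I -> R[i]) (m : I -> nat).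
Hypothesis a1 : forall j, cabs (a j) < 1.
Hypothesis m_gt0 : forall j, (0 < m j)%N.
Local Notation B := (blaschke a m).

Lemma max_formulaE (z : R[i] * R[i]) :
  max_formula a m z = Order.max (logabs (B z.1)) (logabs z.2).
Proof. by rewrite logabs_blaschke. Qed.

(** The factor ka < 1 makes the competitor strictly negative also when there are no poles and B = 1;
    its cost -log(ka) tends to 0. *)
Definition dilated_max (ka : R) (x : R[i] * R[i]) : \bar R :=
  Order.max (logabs (ka%:C%C * B x.1)) (logabs (ka%:C%C * x.2)).

Lemma cabs_blaschke_le1 z : cabs z < 1 -> cabs (B z) <= 1.
Proof.
move=> z1; rewrite /blaschke cabs_prod.
have : \prod_j cabs (mobius (a j) z ^+ m j) <= \prod_(j : I) 1.
  apply: ler_prod => j _; rewrite cabs_ge0 cabsX exprn_ile1 ?cabs_ge0 //.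
  by rewrite ltW // cabs_mobius_lt1.
by rewrite [X in _ <= X -> _]big1.
Qed.

Section Candidate.
Variable ka : R.
Hypothesis ka01 : 0 < ka < 1.

Let cka x : cabs (ka%:C%C * x) = ka * cabs x.
Proof. by rewrite cabsM cabs_real gtr0_norm //; case/andP: ka01. Qed.

Lemma dilated_max_lt0 x : bidisc x -> (dilated_max ka x < 0)%E.
Proof.
move=> [x1 x2]; have [ka0 ka1] := andP ka01.
rewrite /dilated_max gt_max !logabs_lt expR0 !cka; apply/andP; split.
  by rewrite (le_lt_trans _ ka1) // ler_piMr ?(ltW ka0) // cabs_blaschke_le1.
by rewrite (le_lt_trans _ ka1) // ler_piMr ?(ltW ka0) // ltW.
Qed.

Lemma dilated_max_psh : psh_on (@bidisc R) (dilated_max ka).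
Proof.
have [ka0 ka1] := andP ka01; have p2 := pi2_gt0 R.
split.
- by move=> x Dx; apply: lt_trans (dilated_max_lt0 Dx) _; exact: ltry.
- move=> x [x1 x2] t; rewrite /dilated_max gt_max !logabs_lt => /andP[h1 h2].
  have lt_near (f : C * C -> C) : {for (x : C * C), continuous f} -> cabs (f x) < expR t ->
      \forall y \near (x : C * C), cabs (f y) < expR t.
    move=> cf fx; have e0 : 0 < expR t - cabs (f x) by rewrite subr_gt0.
    have := iffLR (cvg_cabsP (nbhs_filter (x : C * C)) f (f x)) cf _ e0.
    apply: filterS => y yx; have := cabsD (f y - f x) (f x); rewrite subrK; lra.
  have c1 : {for (x : C * C), continuous (fun y : C * C => ka%:C%C * B y.1 : C)}.
    apply: (@continuous_comp (C * C)%type C C fst (fun w => ka%:C%C * B w)); first exact: fst_continuousC.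
    apply: derivable_continuous_C; apply: (@derivableM R[i] C (cst ka%:C%C) B); first exact: derivable_cst.
    exact: derivable_blaschke.
  have c2 : {for (x : C * C), continuous (fun y : C * C => ka%:C%C * y.2 : C)}.
    apply: (@continuous_comp (C * C)%type C C snd (fun w => ka%:C%C * w)); first exact: snd_continuousC.
    apply: derivable_continuous_C; apply: (@derivableM R[i] C (cst ka%:C%C) id); first exact: derivable_cst.
    exact: derivable_id.
  have n1 := lt_near _ c1 h1; have n2 := lt_near _ c2 h2.
  by apply: filterS2 n1 n2 => y; rewrite gt_max !logabs_lt => -> ->.
- move=> x b xb.
  have d1 : cabs x.1 + cabs b.1 < 1 by apply: affine_disc_cabs => ze /xb [].
  have d2 : cabs x.2 + cabs b.2 < 1 by apply: affine_disc_cabs => ze /xb [].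
  have ipos : (0 <= ((pi *+ 2)^-1)%:E :> \bar R)%E by rewrite lee_fin invr_ge0 ltW.
  rewrite /dilated_max ge_max; apply/andP; split.
    apply: (le_trans (blaschke_submean a1 m_gt0 ka01 d1)); apply: lee_wpmul2l => //.
    by apply: le_integral_nomeas => t _; rewrite le_max lexx.
  (* The coordinate w has the modulus of the Blaschke product with a single simple zero at 0, so one
     sub-mean lemma serves both entries of the maximum. *)
  have b0 (w : R[i]) : logabs (ka%:C%C * w) =
      logabs (ka%:C%C * blaschke (fun _ : 'I_1 => 0) (fun=> 1%N) w).
    apply: eq_logabs; rewrite !cka; congr (_ * _).
    by rewrite /blaschke big_ord1 expr1 cabs_mobius sub0r cabsN conjE conjc0 mul0r subr0 cabs1 divr1.
  rewrite b0; have z1 (j : 'I_1) : cabs (0 : R[i]) < 1 by rewrite cabs0.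
  apply: (le_trans (@blaschke_submean R 'I_1 (fun=> 0) (fun=> 1%N) ka _ _ z1 (fun=> isT) ka01 d2)).
  apply: lee_wpmul2l => //; apply: le_integral_nomeas => t _.
  by rewrite -b0 le_max lexx orbT.
Qed.

Lemma dilated_max_pole j : pole_cond (a j, 0) (m j) (dilated_max ka).
Proof.
have [ka0 ka1] := andP ka01.
have A0 : 0 < 1 - cabs (a j) by rewrite subr_gt0.
pose c := ln ((1 - cabs (a j))^-1 ^+ m j).
have c_ge0 : 0 <= c.
  by rewrite ln_ge0 // exprn_ege1 // invf_ge1 // gerBl cabs_ge0.
exists c; apply/nbhs_cabs2P; exists (1 - cabs (a j)) => // x xa _.
have x1 : cabs x.1 < 1 by have := cabsD (x.1 - a j) (a j); rewrite subrK; lra.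
rewrite /dilated_max /Psi /= subr0 ge_max; apply/andP; split.
  apply: (@le_trans _ _ (((m j)%:R)%:E * logabs (x.1 - a j)%R + c%:E)%E); last first.
    by apply: leeD2r; rewrite le_max lexx.
  rewrite -[X in (X <= _)%E]mul1e.
  have -> : (1 : \bar R)%E = (1%:R)%:E by [].
  apply: le_logabs => //; rewrite expr1 cka lnK ?posrE ?exprn_gt0 ?invr_gt0 // -exprMn.
  apply: (@le_trans _ _ (cabs (B x.1))); first by rewrite ler_piMl ?cabs_ge0 // ltW.
  apply: le_trans (@cabs_blaschke_le_factor R I a m a1 _ j x1) _.
  rewrite ler_pXn2r ?nnegrE ?cabs_ge0 ?mulr_ge0 ?invr_ge0 ?cabs_ge0 ?(ltW A0) //.
  exact: cabs_mobius_le.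
apply: (@le_trans _ _ (logabs x.2 + c%:E)%E); last first.
  by apply: leeD2r; rewrite le_max lexx orbT.
apply: (@le_trans _ _ (logabs x.2)).
  by apply: le_logabs_cabs; rewrite cka ler_piMl ?cabs_ge0 // ltW.
by rewrite leeDl // lee_fin.
Qed.

End Candidate.

Lemma max_formula_le_green (z : R[i] * R[i]) : bidisc z ->
  (max_formula a m z <= green (fun j => (a j, 0%R)) m z)%E.
Proof.
move=> bz; apply/lee_addgt0Pr => eps eps0.
pose ka := expR (- eps).
have ka01 : 0 < ka < 1 by rewrite expR_gt0 expR_lt1 oppr_lt0.
have : (dilated_max ka z <= green (fun j => (a j, 0%R)) m z)%E.
  apply: ereal_sup_ubound; exists (dilated_max ka) => //; split.
  - exact: dilated_max_psh.
  - exact: dilated_max_lt0.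
  - exact: dilated_max_pole.
have kaE (x : R[i]) : logabs x = (logabs (ka%:C%C * x)%R + eps%:E)%E.
  have [->|x0] := eqVneq x 0; first by rewrite mulr0 logabs0.
  have k0 : ka%:C%C != 0 :> R[i] by rewrite -cabs_eq0 cabs_real normr_eq0 gt_eqF ?expR_gt0.
  rewrite logabsM [in RHS]logabsE // cabs_real gtr0_norm ?expR_gt0 // expRK.
  by rewrite (logabsE x0) -!EFinD; congr EFin; ring.
move=> h; apply: le_trans (leeD h (lexx eps%:E)).
by rewrite max_formulaE ge_max /dilated_max (kaE (B z.1)) (kaE z.2) !leeD2r // le_max lexx ?orbT.
Qed.

End GreenLowerBound.

(** * The formula for both functions, and its continuity in the poles *)

Section Main.
Variable R : realType.
Local Notation C := ((R[i])^o).

Lemma green_lempert_formula (I : finType) (a : I -> R[i]) (m : I -> nat) (z : R[i] * R[i]) :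
  (forall j, unit_disc (a j)) -> injective a -> (forall j, (0 < m j)%N) -> bidisc z ->
  green (fun j => (a j, 0%R)) m z = max_formula a m z /\
  lempert (fun j => (a j, 0%R)) m z = max_formula a m z.
Proof.
move=> a1 a_inj m_gt0 bz; split; apply/eqP; rewrite eq_le; apply/andP; split.
- by apply: ge_ereal_sup => _ [u [psh_u u0 pole_u] <-]; exact: psh_neg_le.
- exact: max_formula_le_green.
- exact: lempert_le.
- apply: le_ereal_inf_tmp => _ [ze [ze1 [phi1 [phi2 [d1 d2 bi zE pole]]]] <-].
  exact: (max_formula_le a1 a_inj m_gt0 ze1 d1 d2 bi zE pole).
Qed.

(** Writes the formula as a single logarithm, so that its convergence follows from that of a real
    number by [cvg_logabs]. *)
Lemma max_logabs (x y : R[i]) :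
  Order.max (logabs x) (logabs y) = logabs ((Num.max (cabs x) (cabs y))%:C%C : R[i]).
Proof.
have E (u v : R[i]) : cabs u <= cabs v -> logabs v = logabs ((cabs v)%:C%C : R[i]).
  by move=> _; apply: eq_logabs; rewrite cabs_real ger0_norm ?cabs_ge0.
have [xy|yx] := leP (cabs x) (cabs y).
  by rewrite max_r ?le_logabs_cabs // (E x).
by rewrite max_l ?le_logabs_cabs ?(ltW yx) // (E y) // ltW.
Qed.

Lemma cvg_max_cst (T : Type) (F : set_system T) (FF : Filter F) (f : T -> R) (l c : R) :
  f @ F --> l -> (fun t => Num.max (f t) c) @ F --> Num.max l c.
Proof.
move=> fl; rewrite maxr_absE; under eq_fun do rewrite maxr_absE.
apply: cvgMl; apply: cvgD; first by apply: cvgD => //; exact: cvg_cst.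
by apply: cvg_norm; apply: cvgB => //; exact: cvg_cst.
Qed.

Lemma cvg_bigprod_C (T : Type) (F : set_system T) (FF : Filter F) (J : Type) (r : seq J)
    (f : J -> T -> C) (l : J -> C) : (forall j, f j @ F --> l j) ->
  (fun t => \prod_(j <- r) f j t : C) @ F --> (\prod_(j <- r) l j : C).
Proof.
move=> fl; elim: r => [|j r IHr].
  by under eq_fun do rewrite big_nil; rewrite big_nil; exact: cvg_cst.
under eq_fun do rewrite big_cons; rewrite big_cons.
exact: (@cvgM R[i] T F FF (f j) (fun t => \prod_(i <- r) f i t) _ _ (fl j) IHr).
Qed.

Lemma cvg_mobius (T : Type) (F : set_system T) (FF : Filter F) (f : T -> C) (a z : R[i]) :
  cabs a < 1 -> cabs z < 1 -> f @ F --> (a : C) ->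
  (fun t => mobius (f t) z : C) @ F --> (mobius a z : C).
Proof.
move=> a1 z1 fa.
have fc : (fun t => (f t)^* : C) @ F --> (a^* : C).
  apply/cvg_cabsP => e e0; have := iffLR (cvg_cabsP FF f a) fa e e0.
  by apply: filterS => t; rewrite -[X in X < e -> _]cabs_conj rmorphB.
have cst_cvg (w : C) : (fun=> w : C) @ F --> w by exact: cvg_cst.
have num_cvg : (fun t => f t - z : C) @ F --> (a - z : C).
  exact: (@cvgB _ C _ F FF f (fun=> z) a z fa (cst_cvg z)).
have cz : (fun t => (f t)^* * z : C) @ F --> (a^* * z : C).
  exact: (@cvgM R[i] T F FF (fun t => (f t)^* : C) (fun=> z) _ _ fc (cst_cvg z)).
have den_cvg : (fun t => 1 - (f t)^* * z : C) @ F --> (1 - a^* * z : C).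
  exact: (@cvgB _ C _ F FF (fun=> 1) (fun t => (f t)^* * z : C) _ _ (cst_cvg 1) cz).
have inv_cvg := @cvgV R[i] T F FF _ _ (mobius_den_neq0 a1 (ltW z1)) den_cvg.
exact: (@cvgM R[i] T F FF _ _ _ _ num_cvg inv_cvg).
Qed.

End Main.
Theorem mainTheorem11 (R : realType) (N : nat) (a : 'I_N -> R[i]) (m : 'I_N -> nat)
  (ha : forall j, unit_disc (a j)) (hinj : injective a)
  (hm : forall j, (0 < m j)%N) :
  (forall z : R[i] * R[i], bidisc z ->
     lempert (fun j => (a j, 0)) m z = green (fun j => (a j, 0)) m z /\
     green (fun j => (a j, 0)) m z =
       Order.max (\sum_(j < N) ((m j)%:R)%:E * logabs (mobius (a j) z.1))%E
                 (logabs z.2))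
  /\
  (forall ak : nat -> forall j : 'I_N, 'I_(m j) -> R[i],
     (forall k j i, unit_disc (ak k j i)) ->
     (forall k, injective (fun x : {j : 'I_N & 'I_(m j)} => ak k (tag x) (tagged x))) ->
     (forall j i, (fun k => (ak k j i : (R[i])^o)) @ \oo --> (a j : (R[i])^o)) ->
     forall z : R[i] * R[i], bidisc z ->
       (fun k => lempert (fun x : {j : 'I_N & 'I_(m j)} => (ak k (tag x) (tagged x), 0))
                         (fun _ => 1%N) z) @ \oo
         --> lempert (fun j => (a j, 0)) m z /\
       (fun k => green (fun x : {j : 'I_N & 'I_(m j)} => (ak k (tag x) (tagged x), 0))
                       (fun _ => 1%N) z) @ \oo
         --> green (fun j => (a j, 0)) m z).
Proof.
have part1 z : bidisc z -> lempert (fun j => (a j, 0)) m z = max_formula a m z /\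
    green (fun j => (a j, 0)) m z = max_formula a m z.
  by move=> bz; have [-> ->] := @green_lempert_formula R 'I_N a m z ha hinj hm bz.
split=> [z bz|ak ak1 ak_inj ak_cvg z bz].
  by have [-> ->] := part1 z bz.
have [-> ->] := part1 z bz; have [z1 z2] := bz.
pose I := {j : 'I_N & 'I_(m j)}.
pose b k (x : I) := ak k (tag x) (tagged x).
(* The split system is indexed by the pairs (j, i), and the same formula applies to it with all
   weights equal to 1. *)
have E k := @green_lempert_formula R I (b k) (fun=> 1%N) z
  (fun x => ak1 k (tag x) (tagged x)) (ak_inj k) (fun=> isT) bz.
suff cv : (fun k => max_formula (b k) (fun=> 1%N) z) @ \oo --> max_formula a m z.
  split.
    have -> : (fun k => lempert (fun x : I => (ak k (tag x) (tagged x), 0)) (fun=> 1%N) z) =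
        (fun k => max_formula (b k) (fun=> 1%N) z).
      by apply/funext => k; have [_ <-] := E k.
    exact: cv.
  have -> : (fun k => green (fun x : I => (ak k (tag x) (tagged x), 0)) (fun=> 1%N) z) =
      (fun k => max_formula (b k) (fun=> 1%N) z).
    by apply/funext => k; have [<- _] := E k.
  exact: cv.
rewrite max_formulaE max_logabs.
under eq_fun do rewrite max_formulaE max_logabs.
apply: cvg_logabs; apply: (@cvg_comp _ R (R[i])^o _ (fun x : R => x%:C%C)); last exact: real_complex_continuous.
apply: cvg_max_cst; apply: (@cvg_comp _ (R[i])^o R _ (@cabs R)); last exact: cabs_continuous.
(* The power m_j becomes a product of m_j equal factors, which matches the limiting product with the
   split ones factor by factor. *)
have -> : blaschke a m z.1 = \prod_(x : I) mobius (a (tag x)) z.1.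
  rewrite /blaschke; under eq_bigr do rewrite -[X in _ ^+ X]card_ord -prodr_const.
  exact: (@sig_big_dep _ _ _ _ _ predT (fun _ => predT) (fun j _ => mobius (a j) z.1)).
rewrite /blaschke; under eq_fun do under eq_bigr do rewrite expr1.
apply: (@cvg_bigprod_C R nat \oo _ I (index_enum I) (fun x k => mobius (b k x) z.1)) => x.
by apply: (@cvg_mobius R nat \oo) => //; [exact: ha|exact: ak_cvg].
Qed.
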